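(* Let $a>0$ be a real number with $a\neq 1$, let $G_a=B_a\rtimes_{\alpha_a}\mathbb{Z}$, let $A=\mathcal{U}_a=C^*(G_a)$ and let $\mathcal{A}=\mathbb{C}[G_a]\subset A$ be the group algebra. (i) There is no finitely summable spectral triple $(\pi(\mathcal{A}),\mathcal{H}_\pi,\mathcal{D})$ in which the representation $\pi$ of $A$ on $\mathcal{H}_\pi$ is quasi-equivalent to the left regular representation of $G_a$ (extended to $\mathcal{U}_a$). (ii) There exist spectral triples $(\pi(\mathcal{A}),\mathcal{H}_\pi,\mathcal{D})$, with $\pi$ quasi-equivalent to the left regular representation, which are $\theta$-summable with $t_0=0$, i.e. $\mathrm{Tr}(e^{-t\mathcal{D}^2})<\infty$ for all $t>0$.
   Context: For real $a>0$, $B_a:=\{\sum_i m_i a^{n_i} : \text{finite sums},\ m_i,n_i\in\mathbb{Z}\}\subset\mathbb{R}$ is regarded as a discrete additive group, $\mathbb{Z}$ acts on it by $\alpha_a(n)b:=a^n b$, and $G_a:=B_a\rtimes_{\alpha_a}\mathbb{Z}$ is the discrete group with law $(b,l)(b',l')=(b+a^l b',\,l+l')$. $\mathcal{U}_a:=C^*(G_a)$ is its group $C^*$-algebra ($G_a$ is solvable, hence amenable, so full and reduced group $C^*$-algebras coincide). A spectral triple $(\pi(\mathcal{A}),\mathcal{H}_\pi,\mathcal{D})$ here means: a faithful representation $\pi$ of the unital $C^*$-algebra $A$ on a Hilbert space $\mathcal{H}_\pi$, and an unbounded self-adjoint operator $\mathcal{D}$ on $\mathcal{H}_\pi$ such that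 $[\mathcal{D},\pi(x)]$ is bounded for all $x$ in the norm-dense $*$-subalgebra $\mathcal{A}$ of $A$ (i.e. $\pi(x)$ preserves the domain of $\mathcal{D}$ and the commutator extends to a bounded operator), and $(1+\mathcal{D}^2)^{-1}$ is compact. It is $p$-summable ($1\le p<\infty$) if $\mathrm{Tr}\big((1+\mathcal{D}^2)^{-p/2}\big)<\infty$, finitely summable if it is $p$-summable for some $p$, and $\theta$-summable if there exists $t_0\ge 0$ such that $\mathrm{Tr}(e^{-t\mathcal{D}^2})<\infty$ for all $t>t_0$. *)

(* Defs.v *)
From HB Require Import structures.
From mathcomp Require Import all_boot all_order all_algebra.
From mathcomp Require Import complex.
From mathcomp Require Import all_classical all_reals all_analysis.
From mathcomp Require Import lra ring.
Set Implicit Arguments. Unset Strict Implicit. Unset Printing Implicit Defensive.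
Import Order.TTheory GRing.Theory Num.Theory.
Import numFieldNormedType.Exports.
Local Open Scope classical_set_scope.
Local Open Scope ring_scope.

HB.mixin Record isHilbert (R : realType) V & CompleteNormedModule R[i] V := {
  hdot : V -> V -> R[i];
  hdot_linearl : forall (a : R[i]) (u v w : V),
    hdot (a *: u + v) w = a * hdot u w + hdot v w;
  hdot_conj : forall u v : V, hdot v u = (hdot u v)^*;
  hdot_norm : forall u : V, hdot u u = `|u| ^+ 2 }.
#[short(type="hilbertType")]
HB.structure Definition Hilbert (R : realType) :=
  {V of isHilbert R V & CompleteNormedModule R[i] V}.

(* Unital C*-algebras. The product is declared here rather than inherited from
   GRing.Algebra, which cannot be joined with CompleteNormedModule: the
   hierarchy below Num.NumDomain lacks a common ancestor. *)
HB.mixin Record isCStarAlgebra (R : realType) A & CompleteNormedModule R[i] A := {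
  cmul : A -> A -> A;
  cone : A;
  cstar : A -> A;
  cmulA : associative cmul;
  cmul1x : left_id cone cmul;
  cmulx1 : right_id cone cmul;
  cmul_linearl : forall (a : R[i]) (x y z : A),
    cmul (a *: x + y) z = a *: cmul x z + cmul y z;
  cmul_linearr : forall (a : R[i]) (x y z : A),
    cmul z (a *: x + y) = a *: cmul z x + cmul z y;
  cstar_conj_linear : forall (a : R[i]) (x y : A),
    cstar (a *: x + y) = a^* *: cstar x + cstar y;
  cstar_mul : forall x y : A, cstar (cmul x y) = cmul (cstar y) (cstar x);
  cstarK : involutive cstar;
  norm_cmul_le : forall x y : A, `|cmul x y| <= `|x| * `|y|;
  norm_cstar_cmul : forall x : A, `|cmul (cstar x) x| = `|x| ^+ 2 }.
#[short(type="cstarType")]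
HB.structure Definition CStarAlgebra (R : realType) :=
  {A of isCStarAlgebra R A & CompleteNormedModule R[i] A}.

Section RealSum.
Context {R : realType} {I : choiceType}.
Implicit Types (h u v : I -> R) (z : I -> R[i]).

(* Unconditional sum of an absolutely summable real family: sum of the
   positive parts minus sum of the negative parts. *)
Definition rsum h : R :=
  fine (\esum_(i in setT) (Num.max (h i) 0)%:E)
  - fine (\esum_(i in setT) (Num.max (- h i) 0)%:E).
Definition csum z : R[i] :=
  (rsum (fun i => complex.Re (z i)) +i* rsum (fun i => complex.Im (z i)))%C.

Definition rsummable h := (\esum_(i in setT) `|h i|%:E < +oo)%E.
Definition csummable z := rsummable (fun i => complex.Re (z i)) /\
  rsummable (fun i => complex.Im (z i)).

Lemma esum_leP u (M : R) : (forall i, 0 <= u i) ->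
  (\esum_(i in setT) (u i)%:E <= M%:E)%E <->
  (forall s : seq I, uniq s -> \sum_(i <- s) u i <= M).
Proof.
move=> u0; split=> [h s us|h].
  rewrite -lee_fin; apply: le_trans h; rewrite -sumEFin.
  apply: esum_ge; exists [set` s]; first by split.
  by rewrite (fsbig_seq _ _ us).
apply: ge_ereal_sup => _ [A [fA _] <-].
by rewrite fsbig_finite// sumEFin lee_fin h// finmap.fset_uniq.
Qed.

Lemma esum_geE u : (forall i, 0 <= u i) ->
  (0 <= \esum_(i in setT) (u i)%:E)%E.
Proof. by move=> u0; apply: esum_ge0 => i _; rewrite lee_fin. Qed.

Lemma le_rsummable u v : (forall i, `|u i| <= v i) ->
  (\esum_(i in setT) (v i)%:E < +oo)%E -> rsummable u.
Proof.
by move=> uv; apply: le_lt_trans; apply: le_esum => i _; rewrite lee_fin.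
Qed.

Lemma esumDr u v : (forall i, 0 <= u i) -> (forall i, 0 <= v i) ->
  (\esum_(i in setT) (u i + v i)%:E
   = \esum_(i in setT) (u i)%:E + \esum_(i in setT) (v i)%:E)%E.
Proof.
by move=> u0 v0; rewrite -esumD// => i _; rewrite lee_fin.
Qed.

Lemma esumD_fin u v : (forall i, 0 <= u i) -> (forall i, 0 <= v i) ->
  (\esum_(i in setT) (u i)%:E < +oo)%E -> (\esum_(i in setT) (v i)%:E < +oo)%E ->
  (\esum_(i in setT) (u i + v i)%:E < +oo)%E.
Proof. by move=> u0 v0 fu fv; rewrite esumDr// lte_add_pinfty. Qed.

Lemma esumZr (a : R) u : 0 <= a -> (forall i, 0 <= u i) ->
  (\esum_(i in setT) (u i)%:E < +oo)%E ->
  (\esum_(i in setT) (a * u i)%:E = a%:E * \esum_(i in setT) (u i)%:E)%E.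
Proof.
have H (b : R) (w : I -> R) : 0 <= b -> (forall i, 0 <= w i) ->
    (\esum_(i in setT) (w i)%:E < +oo)%E ->
    (\esum_(i in setT) (b * w i)%:E <= b%:E * \esum_(i in setT) (w i)%:E)%E.
  move=> b0 w0 fw; have fn : (\esum_(i in setT) (w i)%:E)%E \is a fin_num.
    by rewrite ge0_fin_numE// esum_geE.
  rewrite -(fineK fn) -EFinM; apply/esum_leP => [i|s us].
    by rewrite mulr_ge0.
  rewrite -mulr_sumr ler_wpM2l//.
  by move: s us; apply/(esum_leP _ w0); rewrite fineK.
move=> a0 u0 fu; apply/eqP; rewrite eq_le H//=.
have [->|an0] := eqVneq a 0; first by rewrite mul0e esum_geE// => i; rewrite mul0r.
have ap : 0 < a by rewrite lt_def an0.
have aK : (fun i => (u i)%:E) = (fun i => (a^-1 * (a * u i))%:E).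
  by apply/funext => i; rewrite mulKf.
rewrite {1}aK -lee_pdivlMl// H// ?invr_ge0//.
  by move=> i; rewrite mulr_ge0.
by apply: le_lt_trans (H _ _ a0 u0 fu) _; rewrite lte_mul_pinfty// ?lee_fin.
Qed.

Lemma rsumE h u v : (forall i, 0 <= u i) -> (forall i, 0 <= v i) ->
  (\esum_(i in setT) (u i)%:E < +oo)%E -> (\esum_(i in setT) (v i)%:E < +oo)%E ->
  (forall i, h i = u i - v i) ->
  rsum h = fine (\esum_(i in setT) (u i)%:E) - fine (\esum_(i in setT) (v i)%:E).
Proof.
move=> u0 v0 fu fv hE.
set p := fun i => Num.max (h i) 0; set n := fun i => Num.max (- h i) 0.
have p0 i : 0 <= p i by rewrite /p le_max lexx orbT.
have n0 i : 0 <= n i by rewrite /n le_max lexx orbT.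
have pu i : p i <= u i by rewrite /p ge_max hE gerBl// v0 u0.
have nv i : n i <= v i by rewrite /n ge_max hE opprB gerBl// u0 v0.
have fp : (\esum_(i in setT) (p i)%:E < +oo)%E.
  by apply: le_lt_trans fu; apply: le_esum => i _; rewrite lee_fin.
have fn : (\esum_(i in setT) (n i)%:E < +oo)%E.
  by apply: le_lt_trans fv; apply: le_esum => i _; rewrite lee_fin.
have E : (\esum_(i in setT) (p i)%:E + \esum_(i in setT) (v i)%:E
        = \esum_(i in setT) (u i)%:E + \esum_(i in setT) (n i)%:E)%E.
  rewrite -!esumDr//; apply: eq_esum => i _; congr (_%:E).
  by rewrite /p /n hE; case: (leP (u i - v i) 0) => ?; case: (leP (- (u i - v i)) 0) => ?; lra.
have F (w : I -> R) : (forall i, 0 <= w i) -> (\esum_(i in setT) (w i)%:E < +oo)%E ->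
    (\esum_(i in setT) (w i)%:E)%E \is a fin_num.
  by move=> w0 fw; rewrite ge0_fin_numE ?esum_geE.
move: (congr1 fine E); rewrite !fineD ?F// /rsum -/p -/n => {}E.
by apply/eqP; rewrite subr_eq addrAC eq_sym subr_eq E.
Qed.

Lemma rsum_ge0E u : (forall i, 0 <= u i) ->
  (\esum_(i in setT) (u i)%:E < +oo)%E ->
  rsum u = fine (\esum_(i in setT) (u i)%:E).
Proof.
move=> u0 fu; have e0 : (\esum_(i in [set: I]) (0%R : R)%:E = 0)%E by apply: esum1.
rewrite (@rsumE u u (fun=> 0)) ?e0 ?ltry//= ?subr0// => i.
by rewrite subr0.
Qed.

Lemma rsummable_posneg h : rsummable h -> exists u v,
  [/\ (forall i, 0 <= u i), (forall i, 0 <= v i),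
    (\esum_(i in setT) (u i)%:E < +oo)%E,
    (\esum_(i in setT) (v i)%:E < +oo)%E & forall i, h i = u i - v i].
Proof.
move=> fh; exists (fun i => Num.max (h i) 0), (fun i => Num.max (- h i) 0).
split=> [i|i|||i].
- by rewrite le_max lexx orbT.
- by rewrite le_max lexx orbT.
- apply: le_lt_trans fh; apply: le_esum => i _; rewrite lee_fin.
  by rewrite ge_max normr_ge0 ler_norm.
- apply: le_lt_trans fh; apply: le_esum => i _; rewrite lee_fin.
  by rewrite ge_max normr_ge0 -normrN ler_norm.
- by case: (leP (h i) 0) => ?; case: (leP (- h i) 0) => ?; lra.
Qed.

Lemma rsumD h k : rsummable h -> rsummable k ->
  rsum (fun i => h i + k i) = rsum h + rsum k.
Proof.
move=> /rsummable_posneg[u [v [u0 v0 fu fv hE]]].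
move=> /rsummable_posneg[u' [v' [u'0 v'0 fu' fv' kE]]].
have F (w : I -> R) : (forall i, 0 <= w i) -> (\esum_(i in setT) (w i)%:E < +oo)%E ->
    (\esum_(i in setT) (w i)%:E)%E \is a fin_num.
  by move=> w0 fw; rewrite ge0_fin_numE ?esum_geE.
rewrite (@rsumE h _ _ u0 v0)// (@rsumE k _ _ u'0 v'0)//.
rewrite (@rsumE _ (fun i => u i + u' i) (fun i => v i + v' i)).
- by rewrite !esumDr// !fineD ?F//; lra.
- by move=> i; rewrite addr_ge0.
- by move=> i; rewrite addr_ge0.
- exact: esumD_fin.
- exact: esumD_fin.
- by move=> i; rewrite hE kE; lra.
Qed.

Lemma rsumN h : rsum (fun i => - h i) = - rsum h.
Proof.
rewrite /rsum opprB; congr (_ - fine _).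
by apply: eq_esum => i _; rewrite opprK.
Qed.

Lemma rsumZ (a : R) h : rsummable h -> rsum (fun i => a * h i) = a * rsum h.
Proof.
wlog a0 : a / 0 <= a => [H fh|].
  have [/H->//|a0] := leP 0 a.
  have := H (- a); rewrite oppr_ge0 (ltW a0) => /(_ isT fh).
  under [X in rsum X]funext do rewrite mulNr.
  by rewrite rsumN mulNr => /oppr_inj.
move=> /rsummable_posneg[u [v [u0 v0 fu fv hE]]].
rewrite (@rsumE h _ _ u0 v0)// (@rsumE _ (fun i => a * u i) (fun i => a * v i)).
- by rewrite !esumZr// !fineM// ?ge0_fin_numE ?esum_geE// mulrBr.
- by move=> i; rewrite mulr_ge0.
- by move=> i; rewrite mulr_ge0.
- by rewrite esumZr// lte_mul_pinfty// lee_fin.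
- by rewrite esumZr// lte_mul_pinfty// lee_fin.
- by move=> i; rewrite hE mulrBr.
Qed.

Lemma rsummableD h k : rsummable h -> rsummable k ->
  rsummable (fun i => h i + k i).
Proof.
move=> fh fk; apply: (@le_rsummable _ (fun i => `|h i| + `|k i|)).
  by move=> i; exact: ler_normD.
exact: esumD_fin.
Qed.

Lemma rsummableZ (a : R) h : rsummable h -> rsummable (fun i => a * h i).
Proof.
move=> fh; apply: (@le_rsummable _ (fun i => `|a| * `|h i|)).
  by move=> i; rewrite normrM.
by rewrite esumZr// lte_mul_pinfty// lee_fin.
Qed.

Lemma csumD z w : csummable z -> csummable w ->
  csum (fun i => z i + w i) = csum z + csum w.
Proof.
move=> [? ?] [? ?]; rewrite /csum; apply/eqP; rewrite eq_complex /=.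
rewrite -!rsumD//; apply/andP; split; apply/eqP; congr rsum; apply/funext => i.
  by case: (z i) (w i) => ? ? [? ?].
by case: (z i) (w i) => ? ? [? ?].
Qed.

Lemma csumZ (a : R[i]) z : csummable z ->
  csum (fun i => a * z i) = a * csum z.
Proof.
move=> [fx fy]; case: a => a b; rewrite /csum; apply/eqP.
rewrite eq_complex /=; apply/andP; split; apply/eqP.
  rewrite -!rsumZ// -rsumN -rsumD; last 2 first.
    exact: rsummableZ.
    by under [X in rsummable X]funext do rewrite -mulNr; exact: rsummableZ.
  by congr rsum; apply/funext => i; case: (z i).
rewrite -!rsumZ// -rsumD; [|exact: rsummableZ|exact: rsummableZ].
by congr rsum; apply/funext => i; case: (z i).
Qed.

Lemma csum_conj z : csum (fun i => (z i)^*) = (csum z)^*.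
Proof.
apply/eqP; rewrite eq_complex /=; apply/andP; split; apply/eqP.
  by congr rsum; apply/funext => i; case: (z i).
by rewrite -rsumN; congr rsum; apply/funext => i; case: (z i).
Qed.

End RealSum.

Section EllTwo.
Context {R : realType} (I : choiceType).
Local Notation C := R[i].
Implicit Types f g h : I -> C.

Definition sqmod (z : C) : R := complex.Re z ^+ 2 + complex.Im z ^+ 2.

Definition square_summable f := (\esum_(i in setT) (sqmod (f i))%:E < +oo)%E.
Definition ell2_pred : {pred I -> C} := mem [set f | square_summable f].

Lemma sqmod_ge0 z : 0 <= sqmod z.
Proof. by rewrite addr_ge0 ?sqr_ge0. Qed.

Lemma sqmodM z w : sqmod (z * w) = sqmod z * sqmod w.
Proof. by case: z w => a b [c d]; rewrite /sqmod /=; ring. Qed.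

Lemma sqmodD z w : sqmod (z + w) <= 2 * sqmod z + 2 * sqmod w.
Proof.
case: z w => a b [c d]; rewrite /sqmod /=.
have := sqr_ge0 (a - c); have := sqr_ge0 (b - d); rewrite !sqrrB.
by rewrite !sqrrD; lra.
Qed.

Lemma sqmodE z : (sqmod z)%:C%C = `|z| ^+ 2.
Proof. by rewrite add_Re2_Im2. Qed.

Lemma square_summable_lin (a : C) f g : square_summable f ->
  square_summable g -> square_summable (fun i => a * f i + g i).
Proof.
move=> ff fg; apply: (@le_lt_trans _ _
  (\esum_(i in setT) (2 * sqmod a * sqmod (f i) + 2 * sqmod (g i))%:E)%E).
  apply: le_esum => i _; rewrite lee_fin.
  by rewrite -mulrA -sqmodM sqmodD.
have s0 := sqmod_ge0.
apply: esumD_fin => [i|i||].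
- by rewrite !mulr_ge0.
- by rewrite mulr_ge0.
- by rewrite esumZr// ?lte_mul_pinfty ?lee_fin ?mulr_ge0.
- by rewrite esumZr// ?lte_mul_pinfty ?lee_fin.
Qed.

Lemma ell2_submod_closed : submod_closed ell2_pred.
Proof.
split.
  rewrite inE /= /square_summable esum1 ?ltry// => i _.
  by rewrite /sqmod /= expr0n /= addr0.
by move=> a f g; rewrite !inE /=; exact: square_summable_lin.
Qed.
HB.instance Definition _ := GRing.isSubmodClosed.Build _ _ ell2_pred
  ell2_submod_closed.

Record ell2 := Ell2 { ell2_fun :> I -> C; ell2P : ell2_fun \in ell2_pred }.
HB.instance Definition _ := [isSub for ell2_fun].
HB.instance Definition _ := gen_eqMixin ell2.
HB.instance Definition _ := gen_choiceMixin ell2.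
HB.instance Definition _ := [SubChoice_isSubLmodule of ell2 by <:].

Definition ell2_dot (f g : ell2) : C := csum (fun i => f i * (g i)^*).

Lemma ell2_summable (f : ell2) : square_summable f.
Proof. by have := ell2P f; rewrite inE. Qed.

Lemma ell2_ext (f g : ell2) : (forall i, f i = g i) -> f = g.
Proof. by move=> fg; apply: val_inj; apply/funext. Qed.

Lemma ell2_csummable (f g : ell2) : csummable (fun i => f i * (g i)^*).
Proof.
have s0 := sqmod_ge0.
have fin : (\esum_(i in setT) (sqmod (f i) + sqmod (g i))%:E < +oo)%E.
  by apply: esumD_fin => //; exact: ell2_summable.
split; apply: le_rsummable fin => i; case: (f i) (g i) => a b [c d];
  rewrite /sqmod /=.
- have := sqr_ge0 (a - c); have := sqr_ge0 (b + d); rewrite sqrrB sqrrD => ? ?.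
  have := sqr_ge0 (a + c); have := sqr_ge0 (b - d); rewrite sqrrB sqrrD => ? ?.
  by rewrite ler_norml; apply/andP; split; nra.
- have := sqr_ge0 (a - d); have := sqr_ge0 (b + c); rewrite sqrrB sqrrD => ? ?.
  have := sqr_ge0 (a + d); have := sqr_ge0 (b - c); rewrite sqrrB sqrrD => ? ?.
  by rewrite ler_norml; apply/andP; split; nra.
Qed.

Lemma ell2_dot_linearl (a : C) (f g h : ell2) :
  ell2_dot (a *: f + g) h = a * ell2_dot f h + ell2_dot g h.
Proof.
have E : (fun i => (a *: f + g) i * (h i)^*)
    = (fun i => a * (f i * (h i)^*) + g i * (h i)^*).
  by apply/funext => i; rewrite mulrDl mulrA.
rewrite /ell2_dot E csumD ?csumZ//.
- exact: ell2_csummable.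
- by have := ell2_csummable (a *: f) h; under eq_fun do rewrite -mulrA.
- exact: ell2_csummable.
Qed.

Lemma ell2_dot_conj (f g : ell2) : ell2_dot g f = (ell2_dot f g)^*.
Proof.
rewrite /ell2_dot -csum_conj; congr csum; apply/funext => i.
by rewrite rmorphM /= conjCK mulrC.
Qed.

Lemma ell2_dotE (f : ell2) :
  ell2_dot f f = (fine (\esum_(i in setT) (sqmod (f i))%:E))%:C%C.
Proof.
rewrite /ell2_dot /csum -rsum_ge0E; last 2 first.
- by move=> i; exact: sqmod_ge0.
- exact: ell2_summable.
apply/eqP; rewrite eq_complex /=; apply/andP; split; apply/eqP.
  by congr rsum; apply/funext => i; case: (f i) => a b; rewrite /sqmod /=; ring.
rewrite (_ : (fun i => _) = (fun=> 0)); last first.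
  by apply/funext => i; case: (f i) => a b /=; ring.
have e0 : (\esum_(i in [set: I]) (0%R : R)%:E = 0)%E by apply: esum1.
by rewrite rsum_ge0E ?e0.
Qed.

Lemma ell2_dot_ge0 (f : ell2) : 0 <= ell2_dot f f.
Proof.
by rewrite ell2_dotE ler0c fine_ge0// esum_geE// => i; exact: sqmod_ge0.
Qed.

Lemma ell2_dot_le (f : ell2) (M : R) : 0 <= M ->
  (forall s : seq I, uniq s -> \sum_(i <- s) sqmod (f i) <= M) <->
  ell2_dot f f <= M%:C%C.
Proof.
move=> M0; rewrite ell2_dotE lecR -lee_fin fineK.
  by symmetry; apply: esum_leP => i; exact: sqmod_ge0.
rewrite ge0_fin_numE; first exact: ell2_summable.
by apply: esum_geE => i; exact: sqmod_ge0.
Qed.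

Lemma ell2_dot_eq0 (f : ell2) : ell2_dot f f = 0 -> f = 0.
Proof.
move=> f0; apply: ell2_ext => i.
have /ell2_dot_le : ell2_dot f f <= (0 : R)%:C%C by rewrite f0.
move=> /(_ (lexx _) [:: i] isT); rewrite big_seq1 => h.
have /eqP : sqmod (f i) = 0 by apply/eqP; rewrite eq_le h sqmod_ge0.
rewrite paddr_eq0 ?sqr_ge0// !sqrf_eq0 => /andP[/eqP a /eqP b].
by apply/eqP; rewrite eq_complex a b /= !eqxx.
Qed.

Lemma ell2_dotDl (f g h : ell2) :
  ell2_dot (f + g) h = ell2_dot f h + ell2_dot g h.
Proof. by rewrite -[f]scale1r ell2_dot_linearl mul1r scale1r. Qed.

Lemma ell2_dot0l (h : ell2) : ell2_dot 0 h = 0.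
Proof. by apply: (addIr (ell2_dot 0 h)); rewrite -ell2_dotDl !add0r. Qed.

Lemma ell2_dotZl (a : C) (f h : ell2) :
  ell2_dot (a *: f) h = a * ell2_dot f h.
Proof. by rewrite -[a *: f]addr0 ell2_dot_linearl ell2_dot0l addr0. Qed.

Lemma ell2_dotDr (f g h : ell2) :
  ell2_dot h (f + g) = ell2_dot h f + ell2_dot h g.
Proof. by rewrite ell2_dot_conj ell2_dotDl rmorphD /= -!ell2_dot_conj. Qed.

Lemma ell2_dotZr (a : C) (f h : ell2) :
  ell2_dot h (a *: f) = a^* * ell2_dot h f.
Proof. by rewrite ell2_dot_conj ell2_dotZl rmorphM /= -ell2_dot_conj. Qed.

Definition ell2_norm (f : ell2) : C := sqrtC (ell2_dot f f).

Lemma ell2_norm_ge0 (f : ell2) : 0 <= ell2_norm f.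
Proof. by rewrite sqrtC_ge0 ell2_dot_ge0. Qed.

Lemma ell2_CauchySchwarz (f g : ell2) :
  `|ell2_dot f g| <= ell2_norm f * ell2_norm g.
Proof.
have [g0|gn0] := eqVneq (ell2_dot g g) 0.
  rewrite (ell2_dot_eq0 g0) ell2_dot_conj ell2_dot0l conjC0 normr0.
  by rewrite mulr_ge0 ?ell2_norm_ge0.
have gp : 0 < ell2_dot g g by rewrite lt_def gn0 ell2_dot_ge0.
set c := ell2_dot f g / ell2_dot g g.
have := ell2_dot_ge0 (f + (- c) *: g).
rewrite ell2_dotDl !ell2_dotDr !ell2_dotZl !ell2_dotZr.
rewrite (ell2_dot_conj f g) !rmorphN /=.

have gr : (ell2_dot g g)^* = ell2_dot g g by rewrite -ell2_dot_conj.
have -> : c^* = (ell2_dot f g)^* / ell2_dot g g.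
  by rewrite /c rmorphM fmorphV /= gr.
have -> : ell2_dot f f + - ((ell2_dot f g)^* / ell2_dot g g) * ell2_dot f g +
   (- c * (ell2_dot f g)^* + - c * (- ((ell2_dot f g)^* / ell2_dot g g) * ell2_dot g g))
   = ell2_dot f f - `|ell2_dot f g| ^+ 2 / ell2_dot g g.
  by rewrite normCK /c; field.
rewrite subr_ge0 ler_pdivrMr// => h.
rewrite -ler_sqr ?nnegrE ?normr_ge0 ?mulr_ge0 ?ell2_norm_ge0//.
by rewrite exprMn !sqrtCK.
Qed.

Lemma ell2_norm_triangle (f g : ell2) : ell2_norm (f + g) <= ell2_norm f + ell2_norm g.
Proof.
rewrite -ler_sqr ?nnegrE ?addr_ge0 ?ell2_norm_ge0//.
rewrite sqrtCK sqrrD !sqrtCK ell2_dotDl !ell2_dotDr.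
rewrite [X in X <= _](_ : _ = ell2_dot f f + (ell2_dot f g + (ell2_dot f g)^*) + ell2_dot g g);
  last by rewrite (ell2_dot_conj f g); ring.
rewrite lerD2r lerD2l addcJ.
rewrite -[leRHS]mulr_natl ler_wpM2l ?ler0n//.
apply: le_trans (ell2_CauchySchwarz f g).
by apply: le_trans (normc_ge_Re _); rewrite lecR ler_norm.
Qed.

Lemma ell2_normZ (a : C) (f : ell2) : ell2_norm (a *: f) = `|a| * ell2_norm f.
Proof.
rewrite /ell2_norm ell2_dotZl ell2_dotZr mulrA -normCK.
by rewrite sqrtCM ?sqrCK// nnegrE ?exprn_ge0 ?ell2_dot_ge0.
Qed.

Lemma ell2_norm0_eq0 (f : ell2) : ell2_norm f = 0 -> f = 0.
Proof. by move/eqP; rewrite sqrtC_eq0 => /eqP; exact: ell2_dot_eq0. Qed.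

HB.instance Definition _ := Lmodule_isNormed.Build R[i] ell2
  ell2_norm_triangle ell2_normZ ell2_norm0_eq0.
End EllTwo.

Section EllTwoComplete.
Context {R : realType} (I : choiceType).
Local Notation C := R[i].
Local Notation ell2 := (@ell2 R I).

Let ltr0c (k : R) : (0 < k%:C%C) = (0 < k). Proof. exact: (ltcR 0 k). Qed.

Lemma ell2_normE (f : ell2) : `|f| = sqrtC (ell2_dot f f). Proof. by []. Qed.

Lemma ell2_norm_leP (f : ell2) (e : R) : 0 <= e -> `|f| <= e%:C%C <->
  (forall s : seq I, uniq s -> \sum_(i <- s) sqmod (f i) <= e ^+ 2).
Proof.
move=> e0; rewrite ell2_dot_le ?exprn_ge0// ell2_normE.
rewrite -ler_sqr ?nnegrE ?ler0c ?ell2_norm_ge0// sqrtCK rmorphXn //.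
Qed.

Lemma ell2_cauchy_cvg (F : set_system ell2) :
  ProperFilter F -> cauchy F -> cvg F.
Proof.
move=> FF /cauchy_ballP Fc.
have Fe (e : R) : 0 < e -> \forall f & g \near F, `|f - g| < e%:C%C.
  by move=> e0; have := Fc e%:C%C; rewrite ltr0c => /(_ e0); rewrite -ball_normE.
have coord (p : C -> R) : (forall z w, p (z - w) = p z - p w) ->
    (forall z, `|p z| ^+ 2 <= sqmod z) -> forall i, cvg ((fun f : ell2 => p (f i)) @ F).
  move=> pB ple i; apply: R_complete; apply/cauchy_ballP => e e0.
  have [[A B] /= [FA FB] AB] := Fe _ e0.
  exists ((fun f : ell2 => p (f i)) @` A, (fun f : ell2 => p (f i)) @` B).
    split; rewrite /= /nbhs /=.
      by apply: filterS FA => f Af; exists f.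
    by apply: filterS FB => f Bf; exists f.
  move=> [_ _] /= [[f Af <-] [g Bg <-]].
  rewrite /ball /= -pB.
  have /(_ (f, g) (conj Af Bg)) /= fg := AB.
  have [r re] : exists2 r : R, 0 <= r < e & `|f - g| <= r%:C%C.
    have /ger0_real/RRe_real E : 0 <= `|f - g| by [].
    exists (complex.Re `|f - g|); last by rewrite E.
    by rewrite -ler0c -ltcR E normr_ge0.
  case/andP: re => r0 re /(ell2_norm_leP _ r0)/(_ [:: i] isT).
  rewrite big_seq1 => h; apply: le_lt_trans re.
  by rewrite -ler_sqr ?nnegrE//; exact: le_trans (ple _) h.
have cRe := coord (@complex.Re R); have cIm := coord (@complex.Im R).
have {}cRe i : cvg ((fun f : ell2 => complex.Re (f i)) @ F).
  apply: cRe => [[? ?] [? ?]//|[a b]].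
  by rewrite /sqmod /= real_normK ?num_real// lerDl sqr_ge0.
have {}cIm i : cvg ((fun f : ell2 => complex.Im (f i)) @ F).
  apply: cIm => [[? ?] [? ?]//|[a b]].
  by rewrite /sqmod /= real_normK ?num_real// lerDr sqr_ge0.
pose l i : C := (lim ((fun f : ell2 => complex.Re (f i)) @ F)
            +i* lim ((fun f : ell2 => complex.Im (f i)) @ F))%C.
have lim_sum (f : ell2) (s : seq I) :
    (fun g : ell2 => \sum_(i <- s) sqmod (f i - g i)) @ F
      --> \sum_(i <- s) sqmod (f i - l i).
  elim: s => [|i s IH].
    rewrite big_nil; under eq_fun do rewrite big_nil; exact: cvg_cst.
  rewrite big_cons; under eq_fun do rewrite big_cons.
  apply: cvgD => //.
  have -> : (fun g : ell2 => sqmod (f i - g i)) = (fun g : ell2 =>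
      (complex.Re (f i) - complex.Re (g i)) * (complex.Re (f i) - complex.Re (g i))
    + (complex.Im (f i) - complex.Im (g i)) * (complex.Im (f i) - complex.Im (g i))).
    by apply/funext => g; case: (f i) (g i) => ? ? [? ?]; rewrite /sqmod /= !expr2.
  have -> : sqmod (f i - l i) =
      (complex.Re (f i) - complex.Re (l i)) * (complex.Re (f i) - complex.Re (l i))
    + (complex.Im (f i) - complex.Im (l i)) * (complex.Im (f i) - complex.Im (l i)).
    by case: (f i) (l i) => ? ? [? ?]; rewrite /sqmod /= !expr2.
  have kR i' : (fun g : ell2 => complex.Re (f i') - complex.Re (g i')) @ F
      --> complex.Re (f i') - complex.Re (l i').
    by apply: cvgB; [exact: cvg_cst|exact: cRe].
  have kI i' : (fun g : ell2 => complex.Im (f i') - complex.Im (g i')) @ F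
      --> complex.Im (f i') - complex.Im (l i').
    by apply: cvgB; [exact: cvg_cst|exact: cIm].
  apply: cvgD; [exact: (cvgM (kR i) (kR i))|exact: (cvgM (kI i) (kI i))].
have bound (e : R) : 0 < e -> \forall f \near F, forall s : seq I, uniq s ->
    \sum_(i <- s) sqmod ((f : ell2) i - l i) <= e ^+ 2.
  move=> e0; have [[A B] /= [FA FB] AB] := Fe _ e0.
  near=> f => s us.
  apply: (cvgr_to_le (lim_sum f s)).
  near=> g.
  have Af : A f by near: f.
  have Bg : B g by near: g.
  have /(_ (f, g) (conj Af Bg)) /= /ltW := AB.
  by move=> /(ell2_norm_leP _ (ltW e0))/(_ s us).
have lP : l \in @ell2_pred R I.
  have /filter_ex[f] := bound 1 ltr01; rewrite expr1n => fl.
  have /square_summable_lin H : square_summable (fun i => f i - l i).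
    rewrite /square_summable; apply: (@le_lt_trans _ _ 1%:E); last exact: ltry.
    by apply/esum_leP => // i; exact: sqmod_ge0.
  have := H (-1) _ (ell2_summable f).
  rewrite inE /=; under eq_fun do rewrite mulN1r opprB subrK.
  by [].
apply/cvg_ex; exists (Ell2 lP).
apply/cvgrPdist_lt => /= e e0.
have eR : e = (complex.Re e)%:C%C by rewrite RRe_real// gtr0_real.
have e0' : 0 < complex.Re e / 2 by rewrite divr_gt0// -ltr0c -eR.
near=> f.
rewrite distrC; apply: (@le_lt_trans _ _ (complex.Re e / 2)%:C%C).
  apply/ell2_norm_leP; first exact: ltW.
  near: f; exact: bound.
by rewrite [ltRHS]eR ltcR ltr_pdivrMr// mulr_natr mulr2n ltrDr -ltr0c -eR.
Unshelve. all: by end_near. Qed.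

HB.instance Definition _ := Uniform_isComplete.Build ell2 ell2_cauchy_cvg.

Lemma ell2_dot_norm (f : ell2) : ell2_dot f f = `|f| ^+ 2.
Proof. by rewrite ell2_normE sqrtCK. Qed.

HB.instance Definition _ := isHilbert.Build R ell2
  (@ell2_dot_linearl R I) (@ell2_dot_conj R I) ell2_dot_norm.
End EllTwoComplete.

Section Semidirect.
Context {R : realType}.

Definition Ba (a : R) : set R :=
  [set x | exists s : seq (int * int), x = \sum_(p <- s) p.1%:~R * a ^ p.2].

Record Ga (a : R) (a_gt0 : 0 < a) := MkGa {
  Ga_b : R;
  Ga_l : int;
  Ga_bP : Ba a Ga_b }.

Context {a : R} {a_gt0 : 0 < a}.
Local Notation G := (Ga a_gt0).

HB.instance Definition _ := gen_eqMixin G.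
HB.instance Definition _ := gen_choiceMixin G.

Lemma Ga_ext (x y : G) : Ga_b x = Ga_b y -> Ga_l x = Ga_l y -> x = y.
Proof.
case: x y => [b l p] [b' l' p'] /= eb el; subst b' l'.
by congr MkGa; exact: Prop_irrelevance.
Qed.

Lemma Ba0 : Ba a 0. Proof. by exists [::]; rewrite big_nil. Qed.

Lemma BaD x y : Ba a x -> Ba a y -> Ba a (x + y).
Proof. by move=> [s ->] [t ->]; exists (s ++ t); rewrite big_cat. Qed.

Lemma BaN x : Ba a x -> Ba a (- x).
Proof.
move=> [s ->]; exists [seq (- p.1, p.2) | p <- s]; rewrite big_map -sumrN.
by apply: eq_bigr => p _; rewrite mulrNz mulNr.
Qed.

Lemma BaM (n : int) x : Ba a x -> Ba a (a ^ n * x).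
Proof.
move=> [s ->]; exists [seq (p.1, n + p.2) | p <- s]; rewrite big_map mulr_sumr.
by apply: eq_bigr => p _; rewrite mulrCA expfzDr ?gt_eqF.
Qed.

Definition Ga_mul (x y : G) : G :=
  MkGa a_gt0 (Ga_l x + Ga_l y) (BaD (Ga_bP x) (BaM (Ga_l x) (Ga_bP y))).
Definition Ga_one : G := MkGa a_gt0 0 Ba0.
Definition Ga_inv (x : G) : G :=
  MkGa a_gt0 (- Ga_l x) (BaN (BaM (- Ga_l x) (Ga_bP x))).

Let an0 : a != 0. Proof. by rewrite gt_eqF. Qed.

Lemma Ga_mulA : associative Ga_mul.
Proof.
move=> x y z; apply: Ga_ext => /=; last by rewrite addrA.
by rewrite expfzDr// mulrDr addrA mulrA.
Qed.

Lemma Ga_mul1g : left_id Ga_one Ga_mul.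
Proof. by move=> x; apply: Ga_ext; rewrite /= ?expr0z ?mul1r add0r. Qed.

Lemma Ga_mulg1 : right_id Ga_one Ga_mul.
Proof. by move=> x; apply: Ga_ext; rewrite /= ?mulr0 addr0. Qed.

Lemma Ga_mulVg : left_inverse Ga_one Ga_inv Ga_mul.
Proof. by move=> x; apply: Ga_ext; rewrite /= addNr. Qed.

Lemma Ga_mulgV : right_inverse Ga_one Ga_inv Ga_mul.
Proof.
move=> x; apply: Ga_ext; rewrite /= ?subrr//.
by rewrite mulrN mulrA -expfzDr// subrr expr0z mul1r subrr.
Qed.

HB.instance Definition _ := isGroup.Build G
  Ga_mulA Ga_mul1g Ga_mulg1 Ga_mulVg Ga_mulgV.

End Semidirect.

Section Operators.
Context {R : realType}.
Local Notation C := R[i].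

Definition linear_subspace (V : lmodType C) (S : set V) : Prop :=
  S 0 /\ forall (c : C) (v w : V), S v -> S w -> S (c *: v + w).

Definition lspan (V : lmodType C) (X : set V) : set V :=
  [set v | exists s : seq (C * V),
    (forall p, p \in s -> X p.2) /\ v = \sum_(p <- s) p.1 *: p.2].

Definition bounded_operator (V W : normedModType C) (T : V -> W) : Prop :=
  linear T /\ continuous T.

Definition op_norm (V : normedModType C) (T : V -> V) : R :=
  sup [set complex.Re `|T v| | v in [set v : V | `|v| <= 1]].

Definition compact_operator (V : normedModType C) (T : V -> V) : Prop :=
  linear T /\ compact (closure (T @` [set v : V | `|v| <= 1])).

Definition orthonormal_basis (H : hilbertType R) (B : set H) : Prop :=
  (forall e f, B e -> B f -> hdot e f = (e == f)%:R) /\ dense (lspan B).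

(* For positive T: the sum does not depend on the orthonormal basis B. *)
Definition finite_trace (H : hilbertType R) (T : H -> H) : Prop :=
  exists2 B : set H, orthonormal_basis B &
    (\esum_(e in B) (complex.Re (hdot (T e) e))%:E < +oo)%E.

(* uop is only meaningful on udom. *)
Record unbounded_operator (H : hilbertType R) := UnboundedOperator {
  udom : set H;
  uop :> H -> H;
  udom_subspace : linear_subspace udom;
  uop_linear : forall (c : C) (v w : H), udom v -> udom w ->
    uop (c *: v + w) = c *: uop v + uop w }.

Definition adjoint_graph (H : hilbertType R) (D : unbounded_operator H)
  (v w : H) : Prop := forall x, udom D x -> hdot (D x) v = hdot x w.

Definition self_adjoint (H : hilbertType R) (D : unbounded_operator H) : Prop :=
  dense (udom D) /\
  forall v w, adjoint_graph D v w <-> udom D v /\ w = D v.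

(* K = (1 + D^2)^-1, where D^2 has domain {v in dom D | D v in dom D}. *)
Definition inverse_1addD2 (H : hilbertType R) (D : unbounded_operator H)
    (K : H -> H) : Prop :=
  (forall v, [/\ udom D (K v), udom D (D (K v)) & K v + D (D (K v)) = v]) /\
  (forall v, udom D v -> udom D (D v) -> K (v + D (D v)) = v).

Record projection_valued_measure (H : hilbertType R) := PVM {
  pvm :> set (measurableTypeR R) -> H -> H;
  pvm_scalar : H -> {measure set (measurableTypeR R) -> \bar R};
  pvm_linear : forall B, measurable B -> linear (pvm B);
  pvm_symmetric : forall B, measurable B ->
    forall v w, hdot (pvm B v) w = hdot v (pvm B w);
  pvm_setI : forall B B', measurable B -> measurable B' ->
    forall v, pvm (B `&` B') v = pvm B (pvm B' v);
  pvm_setT : forall v, pvm setT v = v;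
  pvm_scalarE : forall B, measurable B ->
    forall v, pvm_scalar v B = (complex.Re (hdot (pvm B v) v))%:E }.

(* D is the integral of x over E, domain included. On the dense domain of D
   the quadratic form determines D, by polarization. *)
Definition spectral_measure (H : hilbertType R) (D : unbounded_operator H)
    (E : projection_valued_measure H) : Prop :=
  forall v, (udom D v <-> (\int[pvm_scalar E v]_x (x ^+ 2)%:E < +oo)%E) /\
    (udom D v -> hdot (D v) v = (\int[pvm_scalar E v]_x (x : R))%:C%C).

(* T = f(D), for a bounded Borel f and E the spectral measure of D. *)
Definition borel_calculus (H : hilbertType R)
    (E : projection_valued_measure H) (f : R -> R) (T : H -> H) : Prop :=
  bounded_operator T /\
  forall v, hdot (T v) v = (\int[pvm_scalar E v]_x f x)%:C%C.

(* Tr f(D) < oo, for a bounded Borel f >= 0 and a self-adjoint D. *)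
Definition finite_trace_calculus (H : hilbertType R)
    (D : unbounded_operator H) (f : R -> R) : Prop :=
  exists (E : projection_valued_measure H) (T : H -> H),
    [/\ spectral_measure D E, borel_calculus E f T & finite_trace T].

Definition summable_at (H : hilbertType R) (D : unbounded_operator H)
    (p : R) : Prop :=
  finite_trace_calculus D (fun x => (1 + x ^+ 2) `^ (- (p / 2))).

Definition finitely_summable (H : hilbertType R) (D : unbounded_operator H)
    : Prop :=
  exists2 p : R, 1 <= p & summable_at D p.

Definition theta_summable_from (H : hilbertType R) (D : unbounded_operator H)
    (t0 : R) : Prop :=
  forall t : R, t0 < t -> finite_trace_calculus D (fun x => expR (- (t * x ^+ 2))).

End Operators.

Section Representations.
Context {R : realType}.
Local Notation C := R[i].

Record representation (A : cstarType R) (H : hilbertType R)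
    (pi : A -> H -> H) : Prop := Representation {
  rep_bounded : forall x, bounded_operator (pi x);
  rep_linear : forall (c : C) (x y : A) (v : H),
    pi (c *: x + y) v = c *: pi x v + pi y v;
  rep_mul : forall (x y : A) (v : H), pi (cmul x y) v = pi x (pi y v);
  rep_one : forall v : H, pi cone v = v;
  rep_star : forall (x : A) (v w : H), hdot (pi x v) w = hdot v (pi (cstar x) w) }.

Definition star_subalgebra (A : cstarType R) (S : set A) : Prop :=
  [/\ linear_subspace S, (forall x y, S x -> S y -> S (cmul x y)) &
      (forall x, S x -> S (cstar x))].

Record spectral_triple (A : cstarType R) (S : set A) (H : hilbertType R)
    (pi : A -> H -> H) (D : unbounded_operator H) : Prop := SpectralTriple {
  st_subalgebra : star_subalgebra S;
  st_dense : dense S;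
  st_rep : representation pi;
  st_faithful : injective pi;
  st_self_adjoint : self_adjoint D;
  st_domain : forall x v, S x -> udom D v -> udom D (pi x v);
  st_commutator : forall x, S x -> exists M : C, forall v, udom D v ->
    `|D (pi x v) - pi x (D v)| <= M * `|v|;
  st_compact : exists2 K, inverse_1addD2 D K & compact_operator K }.

(* The subspaces of H carrying the subrepresentations of pi. *)
Definition subrep (A : cstarType R) (H : hilbertType R) (pi : A -> H -> H)
    (K : set H) : Prop :=
  [/\ linear_subspace K, closed K & forall x v, K v -> K (pi x v)].

Definition nonzero_subrep (A : cstarType R) (H : hilbertType R)
    (pi : A -> H -> H) (K : set H) : Prop :=
  subrep pi K /\ exists2 v, K v & v != 0.

Definition equivalent_subreps (A : cstarType R) (H H' : hilbertType R)
    (pi : A -> H -> H) (K : set H) (pi' : A -> H' -> H') (K' : set H') : Prop :=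
  exists U : H -> H',
    [/\ (forall (c : C) v w, K v -> K w -> U (c *: v + w) = c *: U v + U w),
        (forall v w, K v -> K w -> hdot (U v) (U w) = hdot v w),
        U @` K = K' &
        (forall x v, K v -> U (pi x v) = pi' x (U v))].

Definition disjoint_subreps (A : cstarType R) (H H' : hilbertType R)
    (pi : A -> H -> H) (K : set H) (pi' : A -> H' -> H') (K' : set H') : Prop :=
  forall L L', nonzero_subrep pi L -> L `<=` K ->
    nonzero_subrep pi' L' -> L' `<=` K' -> ~ equivalent_subreps pi L pi' L'.

(* Mackey's definition: neither representation has a nonzero
   subrepresentation disjoint from the other one. *)
Definition quasi_equivalent (A : cstarType R) (H H' : hilbertType R)
    (pi : A -> H -> H) (pi' : A -> H' -> H') : Prop :=
  (forall K, nonzero_subrep pi K -> ~ disjoint_subreps pi K pi' setT) /\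
  (forall K', nonzero_subrep pi' K' -> ~ disjoint_subreps pi' K' pi setT).

End Representations.

Section GroupCStar.
Context {R : realType} (G : groupType).
Local Notation C := R[i].

Record unitary_rep (H : hilbertType R) (sigma : G -> H -> H) : Prop :=
  UnitaryRep {
  urep_linear : forall g, linear (sigma g);
  urep_dot : forall g v w, hdot (sigma g v) (sigma g w) = hdot v w;
  urep_mul : forall g h v, sigma (g * h)%g v = sigma g (sigma h v);
  urep_one : forall v, sigma 1%g v = v }.

(* The norm of the element \sum_(p <- s) p.1 p.2 of C[G] in C^*(G). *)
Definition max_norm (s : seq (C * G)) : R :=
  sup [set r | exists (H : hilbertType R) (sigma : G -> H -> H),
    unitary_rep sigma /\
    r = op_norm (fun v : H => \sum_(p <- s) p.1 *: sigma p.2 v)].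

Definition group_algebra (A : cstarType R) (u : G -> A) : set A :=
  lspan (range u).

(* (A, u) is the completion of C[G] in max_norm, which determines it up to a
   unique isomorphism; u is the inclusion of G. *)
Record group_cstar (A : cstarType R) (u : G -> A) : Prop := GroupCStar {
  gcs_mul : forall g h, u (g * h)%g = cmul (u g) (u h);
  gcs_one : u 1%g = cone;
  gcs_star : forall g, cstar (u g) = u (g^-1)%g;
  gcs_norm : forall s : seq (C * G),
    `|\sum_(p <- s) p.1 *: u p.2| = (max_norm s)%:C%C;
  gcs_dense : dense (group_algebra u) }.

Lemma lreg_subproof (g : G) (f : ell2 (R := R) G) :
  (fun h => f (g^-1 * h)%g) \in @ell2_pred R G.
Proof.
rewrite inE /= /square_summable.
have := ell2_summable f; rewrite /square_summable.
rewrite (@reindex_esum _ _ _ setT setT (fun h => g^-1 * h)%g)//.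
split=> // [x y _ _ /mulgI//|y _]; exists (g * y)%g => //.
by rewrite mulKg.
Qed.

Definition left_regular (g : G) (f : ell2 (R := R) G) : ell2 G :=
  Ell2 (lreg_subproof g f).

Definition quasi_equivalent_left_regular (A : cstarType R) (u : G -> A)
    (H : hilbertType R) (pi : A -> H -> H) : Prop :=
  exists rho : A -> ell2 (R := R) G -> ell2 G,
    [/\ representation rho, (forall g f, rho (u g) f = left_regular g f) &
        quasi_equivalent pi rho].

End GroupCStar.

(* Main.v *)
(** Part (i).  Choose k with a^k <= 1/3: the 2^n words of length n in (0,k) and
    (1,k) are distinct.  Quasi-equivalence provides a vector eta <> 0 whose
    translates form a Bessel sequence, and a vector xi of the domain of D close
    to eta.  Since the commutators of D with the two generators are bounded,
    the norm of D pi(w) xi grows linearly in n, so the spectral projection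
    P_n of D onto [-Kn, Kn], for a large constant K, satisfies
    |P_n pi(w) eta| >= |eta| / 4.  Summing over the words, 2^n is at most a
    multiple of the rank of P_n, which p-summability bounds by a polynomial.

    Part (ii).  On l^2(G_a), let D be the multiplication by the word length.
    Left translations change the length by a bounded amount, and the ball of
    radius n has at most 5^n elements, so that exp(-t D^2) has finite trace for
    every t > 0.  The regular representation is faithful on C^*(G_a) because
    G_a is amenable: almost invariant multisets are obtained by averaging first
    over finitely many translations and then over (0,0), ..., (0,N-1), and Fell
    absorption turns them into the bound of the maximal norm by the reduced
    one. *)

Require Import Defs.
From HB Require Import structures.
From mathcomp Require Import all_boot all_order all_algebra.
From mathcomp Require Import complex.
From mathcomp Require Import all_classical all_reals all_analysis.
From mathcomp Require Import measurable_realfun.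
From mathcomp Require Import lra ring zify.
Import Order.TTheory GRing.Theory Num.Theory.
Import numFieldNormedType.Exports.
Local Open Scope classical_set_scope.
Local Open Scope ring_scope.
Set Implicit Arguments. Unset Strict Implicit. Unset Printing Implicit Defensive.

(** * Norms as real numbers, Hilbert space geometry *)

(** Part (i) uses two vectors because the two properties it needs come from different sources: [eta]
    has Bessel translates but need not lie in the domain of [D], while [xi] lies in the domain but
    its translates satisfy no Bessel inequality. The operators [pi (u g)] are isometric, so the
    distance between the two vectors is the same along all words. No rank is computed: the given
    function of [D] dominates, as a quadratic form, a multiple of the spectral projection, and a
    Bessel family tests that projection as an orthonormal one would. The spectral data are weak: [D]
    and its functions are tied to the spectral measure through quadratic forms only, and additivity
    is given only for the scalar measures. Orthogonality, additivity and energy bounds for the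
    projections therefore have to be recovered first. In part (ii) exponential growth does no harm,
    since Gaussian weights beat every exponential. The delicate condition is faithfulness: the norm
    of [A] is a supremum over all unitary representations, and one representation has to attain
    it. *)

Section RealNorm.
Context {R : realType}.
Local Notation C := R[i].

(** Norms over [R[i]] are complex numbers; taking the real part moves every estimate to [R], where
    order lemmas and [lra] apply. *)
Definition nrm (V : normedZmodType C) (v : V) : R := complex.Re `|v|.

Lemma nrmE (V : normedZmodType C) (v : V) : `|v| = (nrm v)%:C%C.
Proof. by rewrite /nrm RRe_real// ger0_real. Qed.

Lemma nrm_ge0 (V : normedZmodType C) (v : V) : 0 <= nrm v.
Proof. by rewrite -ler0c -nrmE. Qed.
#[local] Hint Extern 0 (is_true (0 <= nrm _)) => apply: nrm_ge0 : core.

Lemma ler_nrmD (V : normedZmodType C) (v w : V) : nrm (v + w) <= nrm v + nrm w.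
Proof. by rewrite -lecR rmorphD /= -!nrmE ler_normD. Qed.

Lemma nrmN (V : normedZmodType C) (v : V) : nrm (- v) = nrm v.
Proof. by rewrite /nrm normrN. Qed.

Lemma nrm_distC (V : normedZmodType C) (v w : V) : nrm (v - w) = nrm (w - v).
Proof. by rewrite /nrm distrC. Qed.

Lemma nrm0 (V : normedZmodType C) : nrm (0 : V) = 0.
Proof. by rewrite /nrm normr0. Qed.

Lemma nrm0_eq0 (V : normedZmodType C) (v : V) : nrm v = 0 -> v = 0.
Proof. by move=> v0; apply/eqP; rewrite -normr_eq0 nrmE v0. Qed.

Lemma ler_nrm_sum (V : normedZmodType C) (I : Type) (s : seq I) (P : pred I) (F : I -> V) :
  nrm (\sum_(i <- s | P i) F i) <= \sum_(i <- s | P i) nrm (F i).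
Proof.
elim/big_ind2 : _ => [|x u y v ux vy|//]; first by rewrite nrm0.
by apply: le_trans (ler_nrmD _ _) _; exact: lerD.
Qed.

Lemma nrm_distD (V : normedZmodType C) (u v w : V) :
  nrm (v - w) <= nrm (v - u) + nrm (u - w).
Proof. by apply: le_trans (ler_nrmD _ _); rewrite addrA subrK. Qed.

Lemma ler_nrmB (V : normedZmodType C) (v w : V) : nrm v - nrm w <= nrm (v - w).
Proof. by rewrite lerBlDr; apply: le_trans (ler_nrmD _ _); rewrite subrK. Qed.

Lemma nrmZ (V : normedModType C) (c : C) (v : V) : nrm (c *: v) = nrm c * nrm v.
Proof. by apply: complexI; rewrite -nrmE normrZ rmorphM /= -!nrmE. Qed.

Lemma nrmM (c d : C) : nrm (c * d) = nrm c * nrm d.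
Proof. by apply: complexI; rewrite -nrmE normrM rmorphM /= -!nrmE. Qed.

Lemma nrmJ (c : C) : nrm c^* = nrm c.
Proof. by rewrite /nrm normcJ. Qed.

Lemma nrm_real (x : R) : nrm (x%:C%C : C) = `|x|.
Proof. by rewrite /nrm normc_def /= expr0n /= addr0 sqrtr_sqr. Qed.

Lemma conj_real (x : R) : (x%:C%C : C)^* = x%:C%C.
Proof. exact: conjc_real. Qed.

Lemma nrm1 : nrm (1 : C) = 1. Proof. by rewrite /nrm normr1. Qed.

Lemma sqmod_nrm (c : C) : sqmod c = nrm c ^+ 2.
Proof. by apply: complexI; rewrite sqmodE nrmE rmorphXn. Qed.

Lemma mulJ_nrm (c : C) : c^* * c = (nrm c ^+ 2)%:C%C.
Proof. by rewrite mulrC -normCK nrmE rmorphXn. Qed.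

Lemma nrm_eps (V : normedZmodType C) (v w : V) : 
  (forall e : R, 0 < e -> nrm (v - w) <= e) -> v = w.
Proof.
move=> h; apply/eqP; rewrite -subr_eq0; apply/eqP/nrm0_eq0.
by apply/eqP; rewrite eq_le nrm_ge0 andbT; apply/ler_addgt0Pr => e e0; rewrite add0r h.
Qed.

Lemma gt0_RRe (e : C) : 0 < e -> exists2 r : R, 0 < r & e = r%:C%C.
Proof.
move=> e0; exists (complex.Re e); last by rewrite RRe_real// gtr0_real.
by rewrite -ltcR RRe_real// gtr0_real.
Qed.

Section Topology.
Variable V : normedModType C.
Implicit Types (v w : V) (S : set V).

Lemma ball_nrm v w (r : R) : ball v r%:C%C w <-> nrm (v - w) < r.
Proof. by rewrite -ball_normE /= nrmE ltcR. Qed.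

Lemma nrm_closure S v : closure S v <-> 
  (forall e : R, 0 < e -> exists2 w, S w & nrm (v - w) < e).
Proof.
split=> [cS e e0|h B /nbhs_ballP[e /= /gt0_RRe[r r0 ->] eB]].
  have [w [Sw /ball_nrm vw]] := cS _ (@nbhsx_ballx _ _ v e%:C%C (etrans (ltcR 0 e) e0)).
  by exists w.
have [w Sw vw] := h r r0; exists w; split=> //; apply: eB; exact/ball_nrm.
Qed.

Lemma nrm_closed S : closed S -> forall v, 
  (forall e : R, 0 < e -> exists2 w, S w & nrm (v - w) < e) -> S v.
Proof. by move=> cS v h; apply: cS; exact/nrm_closure. Qed.

Lemma nrm_dense S : dense S <-> 
  (forall v (e : R), 0 < e -> exists2 w, S w & nrm (v - w) < e).
Proof.
split=> [dS v e e0|h O [v Ov] oO].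
  have oB : open (ball v e%:C%C) by apply: ball_open; rewrite ?ltcR.
  have [|w [/ball_nrm vw Sw]] := dS (ball v e%:C%C) _ oB.
    by exists v; apply/ball_nrm; rewrite subrr nrm0.
  by exists w.
have : nbhs v O by apply: open_nbhs_nbhs.
move=> /nbhs_ballP[e /= /gt0_RRe[r r0 ->] eO].
have [w Sw vw] := h v r r0; exists w; split=> //; apply: eO; exact/ball_nrm.
Qed.

Lemma lipschitz_continuous (W : normedModType C) (T : V -> W) (M : R) :
  (forall v w, nrm (T v - T w) <= M * nrm (v - w)) -> continuous T.
Proof.
move=> TM v; apply/cvgrPdist_lt => _ /gt0_RRe[e e0 ->].
(* [M] may be zero or negative, hence the modulus [e / (|M| + 1)]. *)
have M0 : 0 < `|M| + 1 by rewrite ltr_wpDl.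
have eM : 0 < (e / (`|M| + 1))%:C%C :> C by rewrite ltcR divr_gt0.
near=> w.
have /ball_nrm vw : ball v (e / (`|M| + 1))%:C%C w by near: w; exact: nbhsx_ballx.
rewrite nrmE ltcR; apply: le_lt_trans (TM _ _) _.
rewrite ltr_pdivlMr// in vw.
apply: le_lt_trans vw; rewrite mulrC ler_wpM2l//.
by apply: le_trans (ler_norm _) _; rewrite lerDl.
Unshelve. all: by end_near. Qed.

Lemma linear_bounded_operator (W : normedModType C) (T : V -> W) (M : R) :
  linear T -> (forall v, nrm (T v) <= M * nrm v) -> bounded_operator T.
Proof.
move=> lT TM; split=> //; apply: (@lipschitz_continuous _ _ M) => v w.
have -> : T v - T w = T (v - w).
  by have := lT (-1) w v; rewrite !scaleN1r !(addrC (- _)) => ->.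
exact: TM.
Qed.

End Topology.

(** The rate survives in the limit, and it is needed there: both the projection onto a closed
    subspace and the extension of the regular representation use the distance from the [n]-th term
    to the limit. *)
Lemma nrm_cauchy_cvg (V : completeNormedModType C) (f : nat -> V) (r : nat -> R) :
  (forall n m, (n <= m)%N -> nrm (f n - f m) <= r n) ->
  r @ \oo --> 0 -> exists l, forall n, nrm (f n - l) <= r n.
Proof.
move=> fr r0.
have : cauchy (f @ \oo).
  apply/cauchy_ballP => _ /gt0_RRe[e e0 ->].
  have e20 : 0 < e / 2 by rewrite divr_gt0.
  have [N _ HN] : \forall n \near \oo, `|r n| < e / 2.
    have /cvgrPdist_lt/(_ _ e20) := r0.
    by apply: filterS => n; rewrite sub0r normrN.
  have fN n : (N <= n)%N -> nrm (f N - f n) < e / 2.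
    move=> Nn; apply: le_lt_trans (fr _ _ Nn) _.
    by apply: le_lt_trans (ler_norm _) _; exact: HN (leqnn _).
  exists (f @` [set n | (N <= n)%N], f @` [set n | (N <= n)%N]) => /=.
    by split; exists N => //= n Nn; exists n.
  move=> [_ _] /= [[n Nn <-] [m Nm <-]]; apply/ball_nrm.
  apply: le_lt_trans (nrm_distD (f N) _ _) _.
  by rewrite nrm_distC [ltRHS]splitr ltrD// fN.
move=> /cauchy_cvg/cvg_ex[l fl]; exists l => n.
apply/ler_addgt0Pr => e e0.
have e0' : 0 < e%:C%C :> C by rewrite ltcR.
have /cvgrPdist_lt/(_ _ e0')[N _ HN] := fl.
have := HN (maxn n N) (leq_maxr _ _); rewrite nrmE ltcR => h.
apply: le_trans (nrm_distD (f (maxn n N)) _ _) _.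
by rewrite lerD ?fr ?leq_maxl// nrm_distC ltW.
Qed.

End RealNorm.
#[export] Hint Extern 0 (is_true (0 <= nrm _)) => apply: nrm_ge0 : core.

Section HilbertGeometry.
Context {R : realType} {H : hilbertType R}.
Local Notation C := R[i].
Implicit Types u v w : H.

Lemma hdotDl u v w : hdot (u + v) w = hdot u w + hdot v w.
Proof. by rewrite -[u]scale1r hdot_linearl mul1r scale1r. Qed.

Lemma hdot0l w : hdot (0 : H) w = 0.
Proof. by apply: (addIr (hdot 0 w)); rewrite -hdotDl !add0r. Qed.

Lemma hdotZl (c : C) u w : hdot (c *: u) w = c * hdot u w.
Proof. by rewrite -[c *: u]addr0 hdot_linearl hdot0l addr0. Qed.

Lemma hdotNl u w : hdot (- u) w = - hdot u w.
Proof. by rewrite -scaleN1r hdotZl mulN1r. Qed.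

Lemma hdotBl u v w : hdot (u - v) w = hdot u w - hdot v w.
Proof. by rewrite hdotDl hdotNl. Qed.

Lemma hdot_suml (I : Type) (s : seq I) (P : pred I) (F : I -> H) w :
  hdot (\sum_(i <- s | P i) F i) w = \sum_(i <- s | P i) hdot (F i) w.
Proof. by elim/big_rec2: _ => [|i y x _ <-]; rewrite ?hdot0l ?hdotDl. Qed.

Lemma hdotDr u v w : hdot w (u + v) = hdot w u + hdot w v.
Proof. by rewrite hdot_conj hdotDl rmorphD /= -!hdot_conj. Qed.

Lemma hdotZr (c : C) u w : hdot w (c *: u) = c^* * hdot w u.
Proof. by rewrite hdot_conj hdotZl rmorphM /= -hdot_conj. Qed.

Lemma hdot0r w : hdot w (0 : H) = 0.
Proof. by rewrite hdot_conj hdot0l rmorph0. Qed.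

Lemma hdotNr u w : hdot w (- u) = - hdot w u.
Proof. by rewrite hdot_conj hdotNl rmorphN /= -hdot_conj. Qed.

Lemma hdotBr u v w : hdot w (u - v) = hdot w u - hdot w v.
Proof. by rewrite hdotDr hdotNr. Qed.

Lemma hdot_sumr (I : Type) (s : seq I) (P : pred I) (F : I -> H) w :
  hdot w (\sum_(i <- s | P i) F i) = \sum_(i <- s | P i) hdot w (F i).
Proof. by elim/big_rec2: _ => [|i y x _ <-]; rewrite ?hdot0r ?hdotDr. Qed.

Lemma hdotvv v : hdot v v = (nrm v ^+ 2)%:C%C.
Proof. by rewrite hdot_norm nrmE rmorphXn. Qed.

Lemma nrm_sqr v : nrm v ^+ 2 = complex.Re (hdot v v).
Proof. by rewrite hdotvv. Qed.

Lemma nrm_sqrD u v : nrm (u + v) ^+ 2 =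
  nrm u ^+ 2 + nrm v ^+ 2 + 2 * complex.Re (hdot u v).
Proof.
rewrite !nrm_sqr hdotDl !hdotDr (hdot_conj u v).
by case: (hdot u u) (hdot u v) (hdot v v) => a b [c d] [e f] /=; ring.
Qed.

Lemma nrm_sqrD_orth u v : hdot u v = 0 -> nrm (u + v) ^+ 2 = nrm u ^+ 2 + nrm v ^+ 2.
Proof. by move=> uv; rewrite nrm_sqrD uv mulr0 addr0. Qed.

Lemma nrm_sqrB u v : nrm (u - v) ^+ 2 =
  nrm u ^+ 2 + nrm v ^+ 2 - 2 * complex.Re (hdot u v).
Proof. by rewrite nrm_sqrD nrmN hdotNr raddfN /= mulrN. Qed.

Lemma hdot_CauchySchwarz u v : nrm (hdot u v) <= nrm u * nrm v.
Proof.
have [->|un0] := eqVneq (hdot u v) 0; first by rewrite nrm0 mulr_ge0.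
set z := hdot u v in un0 *.
have nz : 0 < nrm z.
  by rewrite lt_def nrm_ge0 andbT; apply: contra un0 => /eqP/nrm0_eq0->.
have [v0|vn0] := eqVneq (nrm v) 0.
  by move: un0; rewrite /z (nrm0_eq0 v0) hdot0r eqxx.
have vp : 0 < nrm v by rewrite lt_def vn0 nrm_ge0.
(* The square expands to [|v|^2 (|u|^2 |v|^2 - |z|^2)]; the inequality follows on cancelling
   [|v|^2]. *)
have := sqr_ge0 (nrm (((nrm v ^+ 2)%:C%C *: u) - z *: v)).
rewrite nrm_sqrB !nrmZ hdotZl hdotZr -/z mulJ_nrm nrm_real ger0_norm ?sqr_ge0//.
rewrite -rmorphM /= => h.
rewrite -ler_sqr ?nnegrE ?mulr_ge0//.
have v2 : 0 < nrm v ^+ 2 by rewrite exprn_gt0.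
rewrite -subr_ge0 -(pmulr_rge0 _ v2).
by apply: le_trans h _; rewrite le_eqVlt; apply/orP; left; apply/eqP; ring.
Qed.

Lemma hdotC_eq0 u v : hdot u v = 0 -> hdot v u = 0.
Proof. by move=> uv; rewrite hdot_conj uv rmorph0. Qed.

Lemma parallelogram u v : nrm (u - v) ^+ 2 =
  2 * nrm u ^+ 2 + 2 * nrm v ^+ 2 - nrm (u + v) ^+ 2.
Proof. by rewrite nrm_sqrB nrm_sqrD; ring. Qed.

Lemma orth_projection (L : set H) v : linear_subspace L -> closed L ->
  exists2 p, L p & forall l, L l -> hdot (v - p) l = 0.
Proof.
move=> [L0 Ll] cL.
have LZ (c : C) x : L x -> L (c *: x) by move=> Lx; rewrite -[_ *: _]addr0; exact: Ll.
have LD x y : L x -> L y -> L (x + y) by move=> Lx Ly; rewrite -[x]scale1r; exact: Ll.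
pose S := [set nrm (v - l) | l in L].
have hS : has_inf S.
  by split; [exists (nrm (v - 0)), 0 | exists 0 => _ [l _ <-]].
set d := inf S.
have dle l : L l -> d <= nrm (v - l).
  by move=> Ll'; apply: ge_inf; [exact: hS.2|exists l].
have d0 : 0 <= d by apply: lb_le_inf; [exact: hS.1|move=> _ [l _ <-]].
(* By the parallelogram law and the minimality of [d] at the midpoint, two points of [L] that are
   almost closest to [v] are close to each other. *)
have key (e : R) x y : 0 <= e -> L x -> L y -> nrm (v - x) ^+ 2 <= d ^+ 2 + e ->
    nrm (v - y) ^+ 2 <= d ^+ 2 + e -> nrm (x - y) ^+ 2 <= 4 * e.
  move=> e0 Lx Ly hx hy.
  have -> : x - y = (v - y) - (v - x) by rewrite opprB [RHS]addrC addrA subrK.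
  rewrite parallelogram.
  have -> : v - y + (v - x) = (2 : R)%:C%C *: (v - (2^-1 : R)%:C%C *: (x + y)).
    rewrite scalerBr scalerA -rmorphM /= divff ?pnatr_eq0// scale1r.
    by rewrite -[2]/(1 + 1) rmorphD /= scalerDl scale1r opprD addrACA [- x - y]addrC.
  rewrite nrmZ nrm_real ger0_norm// exprMn.
  have : d ^+ 2 <= nrm (v - (2^-1 : R)%:C%C *: (x + y)) ^+ 2.
    by rewrite ler_sqr ?nnegrE// dle//; apply/LZ/LD.
  by move: hx hy; lra.
(* The excess is chosen so that [key] yields exactly the rate [1 / n.+1]. *)
have ex n : exists x, L x /\ nrm (v - x) ^+ 2 <= d ^+ 2 + n.+1%:R^-1 ^+ 2 / 4.
  have n0 : 0 < (n.+1%:R : R)^-1 ^+ 2 / 4 by rewrite divr_gt0// exprn_gt0// invr_gt0.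
  have sd : d < Num.sqrt (d ^+ 2 + n.+1%:R^-1 ^+ 2 / 4).
    rewrite -ltr_sqr ?nnegrE ?sqrtr_ge0// sqr_sqrtr ?ltrDl//.
    by rewrite addr_ge0 ?sqr_ge0// ltW.
  have [_ [x Lx <-] hx] := inf_adherent (etrans (subr_gt0 _ _) sd) hS.
  exists x; split=> //; move: hx; rewrite -/d subrKC => hx.
  rewrite -[leRHS]sqr_sqrtr ?addr_ge0 ?sqr_ge0// ?(ltW n0)//.
  by rewrite ler_sqr ?nnegrE ?sqrtr_ge0// ltW.
have [f fP] := choice ex.
have [|//|p fp] := @nrm_cauchy_cvg _ _ f (fun n => n.+1%:R^-1).
  - move=> n m nm; rewrite -ler_sqr ?nnegrE ?invr_ge0//.
    have := @key (n.+1%:R^-1 ^+ 2 / 4) (f n) (f m).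
    rewrite mulrCA divff ?mulr1 ?pnatr_eq0//; apply.
    + by rewrite divr_ge0// sqr_ge0.
    + by case: (fP n).
    + by case: (fP m).
    + by case: (fP n).
    + case: (fP m) => _ /le_trans->//; rewrite lerD2l ler_pM2r// ler_sqr ?nnegrE ?invr_ge0//.
      by rewrite lef_pV2 ?posrE// ler_nat.
  - exact: cvg_harmonic.
have Lp : L p.
  apply: (nrm_closed cL) => e e0.
  have [n ne] : exists n, n.+1%:R^-1 < e.
    have /cvgrPdist_lt/(_ _ e0)[N _ /(_ N (leqnn _))] := @cvg_harmonic R.
    rewrite /harmonic sub0r normrN ger0_norm ?invr_ge0// => ?; by exists N.
  by exists (f n); [case: (fP n)|rewrite nrm_distC (le_lt_trans (fp n))].
have dp : nrm (v - p) <= d.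
  have : forall e : R, 0 < e -> nrm (v - p) <= d + e.
    move=> e e0.
    have e20 : 0 < e / 2 by rewrite divr_gt0.
    have [n ne] : exists n, n.+1%:R^-1 < e / 2.
      have /cvgrPdist_lt/(_ _ e20)[N _ /(_ N (leqnn _))] := @cvg_harmonic R.
      rewrite /harmonic sub0r normrN ger0_norm ?invr_ge0// => ?; by exists N.
    apply: le_trans (nrm_distD (f n) _ _) _.
    have := fp n; have [_ h] := fP n.
    have : nrm (v - f n) <= d + n.+1%:R^-1 / 2.
      rewrite -ler_sqr ?nnegrE ?addr_ge0 ?divr_ge0 ?invr_ge0//.
      apply: le_trans h _; rewrite sqrrD -addrA lerD2l.
      have : 0 <= d * (n.+1%:R^-1 / 2) by rewrite mulr_ge0// divr_ge0 ?invr_ge0.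
      set x := (n.+1%:R)^-1; move=> ?.
      have -> : (x / 2) ^+ 2 = x ^+ 2 / 4 by field.
      by rewrite lerDr mulrn_wge0.
    have : 0 <= (n.+1%:R : R)^-1 by rewrite invr_ge0.
    set x := (n.+1%:R : R)^-1 in ne *.
    by lra.
  by move=> h; apply/ler_addgt0Pr.
exists p => // l Ll'.
have [l0|ln0] := eqVneq (nrm l) 0; first by rewrite (nrm0_eq0 l0) hdot0r.
have lp : 0 < nrm l ^+ 2 by rewrite exprn_gt0// lt_def ln0 nrm_ge0.
set z := hdot (v - p) l.
(* Moving [p] by this multiple of [l] lowers the squared distance to [v] by [|z|^2 / |l|^2], so
   minimality forces [z = 0]. *)
set c := z / (nrm l ^+ 2)%:C%C.
have := dle (p + c *: l) (LD _ _ Lp (LZ _ _ Ll')).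
move=> /(le_trans dp); rewrite -ler_sqr ?nnegrE// opprD addrA [leRHS]nrm_sqrB.
have -> : hdot (v - p) (c *: l) = (nrm z ^+ 2 / nrm l ^+ 2)%:C%C.
  rewrite hdotZr -/z /c rmorphM /= -fmorphV conj_real mulrAC mulJ_nrm.
  by rewrite -rmorphM.
have -> : nrm (c *: l) ^+ 2 = nrm z ^+ 2 / nrm l ^+ 2.
  rewrite nrmZ exprMn /c nrmM exprMn -fmorphV nrm_real ger0_norm ?invr_ge0 ?sqr_ge0//.
  by field.
move=> /= h.
have : nrm z ^+ 2 / nrm l ^+ 2 <= 0 by lra.
rewrite pmulr_lle0 ?invr_gt0// => z2.
by apply/nrm0_eq0/eqP; rewrite -sqrf_eq0 eq_le z2 sqr_ge0.
Qed.

End HilbertGeometry.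

(** * Spectral measures *)

Section PVMTheory.
Context {R : realType} {H : hilbertType R}.
Local Notation C := R[i].
Variable E : projection_valued_measure H.
Implicit Types (B : set (measurableTypeR R)) (u v w : H).

Lemma pvmD B u v : measurable B -> pvm E B (u + v) = pvm E B u + pvm E B v.
Proof. by move=> mB; have := pvm_linear E mB 1 u v; rewrite !scale1r. Qed.

Lemma pvm0 B : measurable B -> pvm E B 0 = 0.
Proof. by move=> mB; apply: (addrI (pvm E B 0)); rewrite -pvmD// !addr0. Qed.

Lemma pvmZ B (c : C) v : measurable B -> pvm E B (c *: v) = c *: pvm E B v.
Proof. by move=> mB; have := pvm_linear E mB c v 0; rewrite pvm0// !addr0. Qed.

Lemma pvm_dot B v : measurable B -> hdot (pvm E B v) v = (nrm (pvm E B v) ^+ 2)%:C%C.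
Proof. by move=> mB; rewrite -hdotvv -pvm_symmetric// -pvm_setI// setIid. Qed.

Lemma pvm_scalar_nrm B v : measurable B -> pvm_scalar E v B = (nrm (pvm E B v) ^+ 2)%:E.
Proof. by move=> mB; rewrite pvm_scalarE// pvm_dot. Qed.

Lemma pvm_scalarT v : pvm_scalar E v setT = (nrm v ^+ 2)%:E.
Proof. by rewrite pvm_scalar_nrm// pvm_setT. Qed.

Lemma pvm_set0 v : pvm E set0 v = 0.
Proof.
apply/nrm0_eq0/eqP; rewrite -sqrf_eq0; apply/eqP.
have h : pvm_scalar E v set0 = 0%E by exact: measure0.
by move: h; rewrite pvm_scalar_nrm// => -[].
Qed.

Lemma pvm_setU_nrm A B v : measurable A -> measurable B -> A `&` B = set0 ->
  nrm (pvm E (A `|` B) v) ^+ 2 = nrm (pvm E A v) ^+ 2 + nrm (pvm E B v) ^+ 2.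
Proof.
move=> mA mB AB; apply: EFin_inj; rewrite EFinD -!pvm_scalar_nrm//; last exact: measurableU.
by rewrite measureU.
Qed.

Lemma pvm_setC_orth A B u v : measurable A -> measurable B -> A `&` B = set0 ->
  hdot (pvm E A u) (pvm E B v) = 0.
Proof.
by move=> mA mB AB; rewrite pvm_symmetric// -pvm_setI// AB pvm_set0 hdot0r.
Qed.

(** Additivity is only assumed for the scalar measures. It passes to vectors because the squared
    norm of [v - (E(B) v + E(~B) v)] equals [|v|^2 - |E(B) v|^2 - |E(~B) v|^2], which is 0. *)
Lemma pvm_setC B v : measurable B -> pvm E B v + pvm E (~` B) v = v.
Proof.
move=> mB; have mC := measurableC mB.
apply/eqP; rewrite eq_sym -subr_eq0; apply/eqP/nrm0_eq0/eqP; rewrite -sqrf_eq0.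
rewrite nrm_sqrB hdotDr raddfD /=.
rewrite [hdot v (pvm E B v)]hdot_conj [hdot v (pvm E _ v)]hdot_conj !pvm_dot// !conj_real /=.
rewrite nrm_sqrD_orth; last by rewrite pvm_setC_orth// setICr.
have := pvm_setU_nrm v mB mC (setICr _).
rewrite setUv pvm_setT => ->; apply/eqP; ring.
Qed.

Lemma pvm_scalar_pvm B v A : measurable B -> measurable A ->
  pvm_scalar E (pvm E B v) A = pvm_scalar E v (A `&` B).
Proof.
move=> mB mA; rewrite !pvm_scalar_nrm//; last exact: measurableI.
by rewrite pvm_setI.
Qed.

Variable D : unbounded_operator H.
Hypothesis DE : spectral_measure D E.

Lemma spectral_dom v : udom D v <-> (\int[pvm_scalar E v]_x (x ^+ 2)%:E < +oo)%E.
Proof. exact: (DE v).1. Qed.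

Lemma spectral_form v : udom D v -> hdot (D v) v = (\int[pvm_scalar E v]_x (x : R))%:C%C.
Proof. exact: (DE v).2. Qed.

Lemma udomD u v : udom D u -> udom D v -> udom D (u + v).
Proof. by move=> Du Dv; rewrite -[u]scale1r; exact: (udom_subspace D).2. Qed.

Lemma udomZ (c : C) v : udom D v -> udom D (c *: v).
Proof. by move=> Dv; rewrite -[_ *: _]addr0; apply: (udom_subspace D).2 => //;
  exact: (udom_subspace D).1. Qed.

Lemma uopD u v : udom D u -> udom D v -> D (u + v) = D u + D v.
Proof. by move=> Du Dv; have := uop_linear 1 Du Dv; rewrite !scale1r. Qed.

Lemma uop0 : D 0 = 0.
Proof.
have [d0 _] := udom_subspace D.
by apply: (addrI (D 0)); rewrite -uopD// !addr0.
Qed.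

Lemma uopZ (c : C) v : udom D v -> D (c *: v) = c *: D v.
Proof.
by have [d0 _] := udom_subspace D; move=> Dv; have := uop_linear c Dv d0; rewrite uop0 !addr0.
Qed.

Let msqr : @measurable_fun _ _ (measurableTypeR R) (\bar R) setT (fun x : measurableTypeR R
  => ((x : R) ^+ 2)%:E).
Proof. by apply/measurable_EFinP; exact: exprn_measurable. Qed.

Let mid : @measurable_fun _ _ (measurableTypeR R) (\bar R) setT (fun x : measurableTypeR R
  => (x : R)%:E).
Proof. by apply/measurable_EFinP; exact: measurable_id. Qed.

(** The scalar measure of [E(B) v] is dominated by that of [v], so its second moment is finite as
    well. *)
Lemma udom_pvm B v : measurable B -> udom D v -> udom D (pvm E B v).
Proof.
move=> mB /spectral_dom h; apply/spectral_dom; apply: le_lt_trans h.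
apply: ge0_le_measure_integral => //.
  by move=> A mA; rewrite pvm_scalar_pvm// le_measure// inE//; exact: measurableI.
by move=> x; rewrite lee_fin sqr_ge0.
Qed.

Lemma spectral_integrable v : udom D v ->
  (pvm_scalar E v).-integrable setT (fun x : measurableTypeR R => (x : R)%:E).
Proof.
move=> /spectral_dom h.
apply: (@le_integrable _ _ _ _ _ measurableT _ (cst 1%:E \+ (fun x : measurableTypeR R =>
  ((x : R) ^+ 2)%:E))%E) => //.
  move=> x _ /=; rewrite lee_fin [leRHS]ger0_norm ?addr_ge0 ?sqr_ge0//.
  by rewrite ler_norml; apply/andP; split; nra.
apply: integrableD => //.
  apply/integrableP; split; first exact: measurable_cst.
  under eq_integral do rewrite /= normr1.
  by rewrite integral_cst// mul1e pvm_scalarT ltry.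
apply/integrableP; split => //.
by under eq_integral do rewrite /= ger0_norm ?sqr_ge0//.
Qed.

Lemma spectral_form_split B v : measurable B -> udom D v ->
  hdot (D v) v = hdot (D (pvm E B v)) (pvm E B v)
               + hdot (D (pvm E (~` B) v)) (pvm E (~` B) v).
Proof.
move=> mB Dv; have mC := measurableC mB.
have DB := udom_pvm mB Dv; have DC := udom_pvm mC Dv.
rewrite !spectral_form// -rmorphD /=; congr (_%:C%C).
rewrite /Rintegral -fineD; last 2 first.
  by apply: integrable_fin_num => //; exact: spectral_integrable.
  by apply: integrable_fin_num => //; exact: spectral_integrable.
congr fine; rewrite -integral_measure_add//; last 2 first.
  exact: spectral_integrable.
  exact: spectral_integrable.
apply: eq_measure_integral => A mA _; rewrite [RHS]measure_addE !pvm_scalar_pvm//.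
rewrite -measureU; first by rewrite -setIUr setUv setIT.
- exact: measurableI.
- exact: measurableI.
- by rewrite setIACA setICr setI0.
Qed.

(* [D] is only tied to [E] through its quadratic form; splitting the form at
   [c *: E(B) v + E(~B) v] for [c = 1] and [c = 'i] kills the cross terms. *)
Lemma spectral_cross B v : measurable B -> udom D v ->
  hdot (D (pvm E (~` B) v)) (pvm E B v) = 0.
Proof.
move=> mB Dv; have mC := measurableC mB.
set v1 := pvm E B v; set v2 := pvm E (~` B) v.
have D1 : udom D v1 := udom_pvm mB Dv; have D2 : udom D v2 := udom_pvm mC Dv.
have cr (c : C) : c * hdot (D v1) v2 + c^* * hdot (D v2) v1 = 0.
  have D12 : udom D (c *: v1 + v2) by apply: udomD => //; exact: udomZ.
  have := spectral_form_split mB D12.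
  rewrite !pvmD// !pvmZ// -!pvm_setI// setIid setICr setICl setIid pvm_set0 scaler0 addr0 add0r.
  rewrite -/v1 -/v2 uopD//; last exact: udomZ.
  rewrite uopZ// hdotDl !hdotDr !hdotZl !hdotZr.
  rewrite -addrA => /(congr1 (fun z => z - c * (c^* * hdot (D v1) v1) - hdot (D v2) v2)).
  rewrite (_ : _ - _ - _ = c * hdot (D v1) v2 + c^* * hdot (D v2) v1); last by ring.
  by move=> ->; ring.
have := cr 1; rewrite rmorph1 !mul1r => /eqP; rewrite addr_eq0 => /eqP h1.
have /eqP := cr 'i; rewrite conjCi h1 mulrN mulNr -opprD oppr_eq0 -mulr2n mulrn_eq0 /=.
by rewrite mulf_eq0 (negPf (neq0Ci _)) /= => /eqP.
Qed.

(** The vanishing cross term turns information about the quadratic form of [D] into information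
    about the vector [D v], to which Cauchy-Schwarz can be applied. *)
Lemma pvm_uop_dot B v : measurable B -> udom D v ->
  hdot (D v) (pvm E B v) = (\int[pvm_scalar E (pvm E B v)]_x (x : R))%:C%C.
Proof.
move=> mB Dv; rewrite -spectral_form; last exact: udom_pvm.
rewrite -{1}(pvm_setC v mB) uopD; [|exact: udom_pvm|by apply: udom_pvm => //; exact: measurableC].
by rewrite hdotDl spectral_cross// addr0.
Qed.

Let supported B v : measurable B -> udom D v ->
  (\int[pvm_scalar E (pvm E B v)]_x (x : R) =
   \int[pvm_scalar E (pvm E B v)]_(x in B) (x : R)).
Proof.
move=> mB Dv; have mC := measurableC mB.
rewrite /Rintegral (@negligible_integral _ _ _ _ _ (~` B))//.
- by rewrite setDE setCK setTI.
- by apply: spectral_integrable; exact: udom_pvm.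
- by rewrite [LHS]pvm_scalar_pvm// setICl measure0.
Qed.

Let mass B v : measurable B -> pvm_scalar E (pvm E B v) B = (nrm (pvm E B v) ^+ 2)%:E.
Proof. by move=> mB; rewrite pvm_scalar_pvm// setIid pvm_scalar_nrm. Qed.

Let cst_int B v (K : R) : measurable B ->
  (pvm_scalar E (pvm E B v)).-integrable B (cst K%:E).
Proof.
move=> mB; apply/integrableP; split; first exact: measurable_cst.
by rewrite (eq_integral (cst `|K|%:E))// integral_cst// mass// -EFinM ltry.
Qed.

Let id_int B v : measurable B -> udom D v ->
  (pvm_scalar E (pvm E B v)).-integrable B (fun x : measurableTypeR R => (x : R)%:E).
Proof.
move=> mB Dv; apply: (integrableS measurableT) => //.
by apply: spectral_integrable; exact: udom_pvm.
Qed.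

Let cstR B v (K : R) : measurable B ->
  \int[pvm_scalar E (pvm E B v)]_(x in B) K = K * nrm (pvm E B v) ^+ 2.
Proof. by move=> mB; rewrite Rintegral_cst// mass. Qed.

(** On one side of 0 the integral of [x] suffers no cancellation, so its modulus is at least
    [K |E(B) v|^2]; it is also the pairing of [D v] with [E(B) v], and Cauchy-Schwarz concludes. *)
Lemma pvm_energy B v (K : R) : 0 < K -> measurable B -> udom D v ->
  (forall x : R, B x -> K <= x) \/ (forall x : R, B x -> x <= - K) ->
  K * nrm (pvm E B v) <= nrm (D v).
Proof.
move=> K0 mB Dv hB.
have [->|n0] := eqVneq (nrm (pvm E B v)) 0; first by rewrite mulr0.
have np : 0 < nrm (pvm E B v) by rewrite lt_def n0 nrm_ge0.
rewrite -(ler_pM2r np) -mulrA -expr2.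
apply: le_trans (hdot_CauchySchwarz _ _); rewrite pvm_uop_dot// nrm_real supported//.
case: hB => hB.
  apply: le_trans (ler_norm _); rewrite -cstR//.
  by apply: le_Rintegral => //; [exact: cst_int|exact: id_int].
rewrite -normrN; apply: le_trans (ler_norm _); rewrite lerNr -mulNr -cstR//.
by apply: le_Rintegral => //; [exact: id_int|exact: cst_int].
Qed.

(** The complement of the interval consists of two half-lines, each controlled by [pvm_energy];
    hence the factor 2. *)
Lemma pvm_low_energy v (K : R) : 0 < K -> udom D v ->
  nrm (v - pvm E `[- K, K]%classic v) ^+ 2 <= 2 * (nrm (D v) / K) ^+ 2.
Proof.
move=> K0 Dv; have mI : measurable (`[- K, K]%classic : set (measurableTypeR R))
  by exact: measurable_itv.
have -> : v - pvm E `[- K, K]%classic v = pvm E (~` `[- K, K]%classic) v.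
  by rewrite -{1}(pvm_setC v mI) addrC addKr.
have -> : ~` `[- K, K]%classic = `]-oo, - K[%classic `|` `]K, +oo[%classic.
  apply/seteqP; split => x /=; rewrite !in_itv /= ?andbT.
    by move=> /negP; rewrite negb_and -!ltNge => /orP.
  by move=> h /andP[h1 h2]; case: h => h;
    [move: (lt_le_trans h h1)|move: (lt_le_trans h h2)]; rewrite ltxx.
rewrite pvm_setU_nrm//; last first.
  apply/seteqP; split => x //=; rewrite !in_itv /= ?andbT => -[h1 h2].
  by have : K < - K := lt_trans h2 h1; lra.
have h (B : set (measurableTypeR R)) : measurable B ->
    (forall x : R, B x -> K <= x) \/ (forall x : R, B x -> x <= - K) ->
    nrm (pvm E B v) ^+ 2 <= (nrm (D v) / K) ^+ 2.
  move=> mB hB; rewrite ler_sqr ?nnegrE ?divr_ge0 ?(ltW K0)// ler_pdivlMr// mulrC.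
  exact: pvm_energy.
rewrite mulr_natl mulr2n lerD//; apply: h => //.
  by right => x /=; rewrite in_itv /= => /ltW.
by left => x /=; rewrite in_itv /= andbT => /ltW.
Qed.

End PVMTheory.

Section CalculusBound.
Context {R : realType} {H : hilbertType R}.
Variable E : projection_valued_measure H.

(** Chebyshev's inequality for the scalar measure of [e]; that measure is finite, so the bounded [f]
    is integrable. *)
Lemma borel_calculus_ge (f : R -> R) (T : H -> H) (c K : R) (e : H) :
  borel_calculus E f T -> measurable_fun setT f -> (forall x, 0 <= f x <= 1) -> 0 <= c ->
  (forall x : R, - K <= x <= K -> c <= f x) ->
  c * nrm (pvm E `[- K, K]%classic e) ^+ 2 <= complex.Re (hdot (T e) e).
Proof.
move=> [_ ->] mf f01 c0 fc /=.
set I := `[- K, K]%classic.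
have mI : measurable (I : set (measurableTypeR R)) by exact: measurable_itv.
have fint : (pvm_scalar E e).-integrable setT (fun x : measurableTypeR R => (f x)%:E).
  apply: (@le_integrable _ _ _ _ _ measurableT _ (cst 1%:E)) => //.
  - exact/measurable_EFinP.
  - by move=> x _ /=; have /andP[? ?] := f01 x; rewrite lee_fin normr1 ger0_norm.
  - apply/integrableP; split; first exact: measurable_cst.
    under eq_integral do rewrite /= normr1.
    by rewrite integral_cst// mul1e pvm_scalarT ltry.
rewrite /Rintegral -lee_fin fineK; last exact: integrable_fin_num.
rewrite EFinM -pvm_scalar_nrm//.
rewrite -integral_cst//; apply: (@le_trans _ _ (\int[pvm_scalar E e]_(x in I) (f x)%:E)%E).
  apply: ge0_le_integral => //.
  - by apply: measurable_funTS; exact/measurable_EFinP.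
apply: ge0_subset_integral => //; first exact/measurable_EFinP.
by move=> x _; have /andP[] := f01 x; rewrite lee_fin.
Qed.

End CalculusBound.

(** * Traces and Bessel sequences *)

Section Parseval.
Context {R : realType} {H : hilbertType R}.
Local Notation C := R[i].

(** This is the half of Parseval's identity that rests on the density of the span; Bessel's
    inequality would be the other half. *)
Lemma parseval_le (B : set H) (v : H) : orthonormal_basis B ->
  ((nrm v ^+ 2)%:E <= \esum_(e in B) (nrm (hdot v e) ^+ 2)%:E)%E.
Proof.
move=> [Bo /nrm_dense Bd].
have Be e f : B e -> B f -> hdot e f = (e == f)%:R by exact: Bo.
have h (d : R) : 0 < d -> ((nrm v ^+ 2 - d ^+ 2)%:E <= \esum_(e in B) (nrm (hdot v e) ^+ 2)%:E)%E.
  move=> d0; have [u [t [tB ut]] vu] := Bd v d d0.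
  pose s := undup [seq p.2 | p <- t].
  have sB e : e \in s -> B e by rewrite mem_undup => /mapP[p pt ->]; exact: tB.
  (* The best approximation of [v] in the span of the basis vectors occurring in [u], hence at least
     as close to [v] as [u] is. *)
  pose v' := \sum_(e <- s) hdot v e *: e.
  have v's f : f \in s -> hdot v' f = hdot v f.
    move=> fs; rewrite /v' hdot_suml (bigD1_seq f)//=; last exact: undup_uniq.
    have Bf := sB f fs; rewrite hdotZl (Be f f)// eqxx mulr1 big1_seq ?addr0// => e /andP[ef es].
    by rewrite hdotZl (Be e f (sB e es) Bf) (negPf ef) mulr0.
  have orth w : (exists2 c : H -> C, true & w = \sum_(e <- s) c e *: e) -> hdot (v - v') w = 0.
    move=> [c _ ->]; rewrite hdot_sumr big1_seq// => e /andP[_ es].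
    by rewrite hdotZr hdotBl v's// subrr mulr0.
  have v'2 : nrm v' ^+ 2 = \sum_(e <- s) nrm (hdot v e) ^+ 2.
    apply: complexI; rewrite -hdotvv {2}/v' hdot_sumr rmorph_sum /=.
    by apply: eq_big_seq => e es; rewrite hdotZr v's// mulJ_nrm.
  have uE : exists2 c : H -> C, true & u = \sum_(e <- s) c e *: e.
    exists (fun e => \sum_(p <- t | p.2 == e) p.1) => //; rewrite ut.
    under [RHS]eq_bigr do rewrite scaler_suml.
    rewrite (exchange_big_dep predT) //=.
    apply: eq_big_seq => p pt; rewrite (big_rem p.2)/=; last first.
      by rewrite mem_undup; apply/mapP; exists p.
    rewrite ?eqxx -[LHS]addr0; congr (_ + _); rewrite big1_seq// => e /andP[/eqP <-].
    by rewrite mem_rem_uniq ?undup_uniq// inE eqxx.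
  have vv' : nrm (v - v') <= d.
    apply: le_trans (ltW vu); rewrite -ler_sqr ?nnegrE//.
    have -> : v - u = (v - v') + (v' - u) by rewrite addrA subrK.
    rewrite [leRHS]nrm_sqrD_orth ?lerDl ?sqr_ge0// hdotBr !orth ?subrr//.
    by exists (hdot v).
  have nv : nrm v ^+ 2 = nrm v' ^+ 2 + nrm (v - v') ^+ 2.
    have {1}-> : v = (v - v') + v' by rewrite subrK.
    by rewrite nrm_sqrD_orth; [rewrite addrC|apply: orth; exists (hdot v)].
  apply: esum_ge; exists [set` s].
    by split; [exact: finite_seq|move=> e /= /sB].
  rewrite -fsbig_seq ?undup_uniq//= sumEFin lee_fin -v'2 nv.
  have : nrm (v - v') ^+ 2 <= d ^+ 2 by rewrite ler_sqr ?nnegrE// ltW.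
  lra.
apply/lee_addgt0Pr => e e0.
have := h (Num.sqrt e); rewrite sqrtr_gt0 e0 (sqr_sqrtr (ltW e0)) => /(_ isT).
by rewrite EFinB leeBlDr// .
Qed.

(** If the synthesis map of a family is a contraction, so is its adjoint. Testing with the
    conjugates of [<x i, e>] gives [S = <z, e>] and [|z|^2 <= S], whence [S^2 <= S |e|^2]. *)
Lemma bessel_dot (I : eqType) (s : seq I) (x : I -> H) (e : H) :
  (forall c : I -> C, nrm (\sum_(i <- s) c i *: x i) ^+ 2 <= \sum_(i <- s) nrm (c i) ^+ 2) ->
  \sum_(i <- s) nrm (hdot (x i) e) ^+ 2 <= nrm e ^+ 2.
Proof.
move=> /(_ (fun i => (hdot (x i) e)^*)).
set z := \sum_(i <- s) _; set S := \sum_(i <- s) nrm (hdot (x i) e) ^+ 2.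
rewrite (_ : \sum_(i <- s) _ = S); last by apply: eq_bigr => i _; rewrite nrmJ.
move=> zS.
have ze : hdot z e = S%:C%C.
  rewrite /z hdot_suml rmorph_sum /=; apply: eq_bigr => i _.
  by rewrite hdotZl mulJ_nrm.
have S0 : 0 <= S by apply: sumr_ge0 => i _; rewrite sqr_ge0.
have := hdot_CauchySchwarz z e; rewrite ze nrm_real ger0_norm// => h.
have [->|Sn0] := eqVneq S 0; first by rewrite sqr_ge0.
have Sp : 0 < S by rewrite lt_def Sn0.
rewrite -(ler_pM2l Sp) -expr2; apply: le_trans (_ : (nrm z * nrm e) ^+ 2 <= _).
  by rewrite ler_sqr ?nnegrE ?mulr_ge0.
by rewrite exprMn ler_wpM2r ?sqr_ge0.
Qed.

Lemma esum_scale_le (J : choiceType) (B : set J) (f : J -> R) (k tau : R) : 0 <= k ->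
  (forall e, 0 <= f e) ->
  (\esum_(e in B) (f e)%:E <= tau%:E)%E -> (\esum_(e in B) (k * f e)%:E <= (k * tau)%:E)%E.
Proof.
move=> k0 f0 ft; apply: ge_ereal_sup => _ [F FB <-].
rewrite fsbig_finite; last by case: FB.
rewrite sumEFin lee_fin -mulr_sumr ler_wpM2l// -lee_fin; apply: le_trans ft.
apply: esum_ge; exists F => //.
by rewrite fsbig_finite ?sumEFin//; case: FB.
Qed.

(** This replaces the count of the rank of [E(I)]. Expanding each [|E(I) x_i|^2] along the basis and
    exchanging the sums leaves, for each [e], the sum over [i] of [|<x_i, E(I) e>|^2], which the
    Bessel property bounds by [|E(I) e|^2]. *)
Lemma bessel_trace (E : projection_valued_measure H) (I : set (measurableTypeR R))
   (T : H -> H) (k tau : R) (B : set H) (J : choiceType) (s : seq J) (x : J -> H) :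
  measurable I -> orthonormal_basis B -> 0 < k ->
  (forall e, nrm (pvm E I e) ^+ 2 <= k * complex.Re (hdot (T e) e)) ->
  (\esum_(e in B) (complex.Re (hdot (T e) e))%:E <= tau%:E)%E ->
  (forall c : J -> C, nrm (\sum_(i <- s) c i *: x i) ^+ 2 <= \sum_(i <- s) nrm (c i) ^+ 2) ->
  \sum_(i <- s) nrm (pvm E I (x i)) ^+ 2 <= k * tau.
Proof.
move=> mI Bb k0 kT Tt bes; rewrite -lee_fin.
apply: (@le_trans _ _ (\sum_(i <- s) \esum_(e in B) (nrm (hdot (pvm E I (x i)) e) ^+ 2)%:E)%E).
  by rewrite -sumEFin; apply: lee_sum => i _; exact: parseval_le.
rewrite -esum_sum; last by move=> *; rewrite lee_fin sqr_ge0.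
apply: (@le_trans _ _ (\esum_(e in B) (k * complex.Re (hdot (T e) e))%:E)%E); last first.
  apply: esum_scale_le => //; first exact: ltW.
  by move=> e; rewrite -(pmulr_rge0 _ k0); apply: le_trans (kT e); rewrite sqr_ge0.
apply: le_esum => e _; rewrite sumEFin lee_fin; apply: le_trans (kT e).
rewrite (eq_bigr (fun i => nrm (hdot (x i) (pvm E I e)) ^+ 2)).
  exact: bessel_dot.
by move=> i _; rewrite pvm_symmetric.
Qed.
End Parseval.

(** * Square summable functions *)

Section EllTwoTheory.
Context {R : realType} {I : choiceType}.
Local Notation C := R[i].
Local Notation ell2 := (@ell2 R I).
Implicit Types (f g : ell2) (i : I) (m : I -> R).

Lemma ell2_nrm_le f (e : R) : 0 <= e -> nrm f <= e <->
  (forall s : seq I, uniq s -> \sum_(i <- s) nrm (f i) ^+ 2 <= e ^+ 2).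
Proof.
move=> e0; rewrite -lecR -nrmE ell2_norm_leP//.
split=> h s us; have := h s us; under eq_bigr do rewrite ?sqmod_nrm//.
  by [].
by under eq_bigr do rewrite -sqmod_nrm.
Qed.

Lemma ell2_sum_le f (s : seq I) : uniq s -> \sum_(i <- s) nrm (f i) ^+ 2 <= nrm f ^+ 2.
Proof. by move=> us; exact: (ell2_nrm_le f (nrm_ge0 f)).1. Qed.

Lemma ell2_coord_le f i : nrm (f i) <= nrm f.
Proof.
rewrite -ler_sqr ?nnegrE ?nrm_ge0//; have := @ell2_sum_le f [:: i] isT.
by rewrite big_seq1.
Qed.

Lemma square_summable_le (h : I -> C) (M : R) :
  (forall s : seq I, uniq s -> \sum_(i <- s) nrm (h i) ^+ 2 <= M) -> square_summable h.
Proof.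
move=> hM; apply: (@le_lt_trans _ _ M%:E); last exact: ltry.
apply/esum_leP => [i|s us]; first exact: sqmod_ge0.
by under eq_bigr do rewrite sqmod_nrm; exact: hM.
Qed.

Lemma ell2D f g i : (f + g) i = f i + g i. Proof. by []. Qed.
Lemma ell2N f i : (- f) i = - f i. Proof. by []. Qed.
Lemma ell2Z (c : C) f i : (c *: f) i = c * f i. Proof. by []. Qed.
Lemma ell20 i : (0 : ell2) i = 0. Proof. by []. Qed.
Lemma ell2B f g i : (f - g) i = f i - g i. Proof. by []. Qed.

Lemma ell2_sum (J : Type) (s : seq J) (P : pred J) (F : J -> ell2) i :
  (\sum_(j <- s | P j) F j) i = \sum_(j <- s | P j) F j i.
Proof. by elim/big_rec2: _ => [|j y x _ <-]; rewrite ?ell20 ?ell2D. Qed.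

Lemma delta_subproof i : (fun j => (j == i)%:R : C) \in @ell2_pred R I.
Proof.
rewrite inE /=; apply: (@square_summable_le _ 1) => s us.
have [is_|is_] := boolP (i \in s).
  rewrite (bigD1_seq i)//= eqxx nrm1 expr1n big1 ?addr0// => j /negPf->.
  by rewrite nrm0 expr0n.
rewrite big1_seq ?ler01// => j /andP[_ js].
by case: eqP js is_ => [->->//|_ _ _]; rewrite nrm0 expr0n.
Qed.

Definition delta i : ell2 := Ell2 (delta_subproof i).

Lemma deltaE i j : delta i j = (j == i)%:R. Proof. by []. Qed.

Lemma esum_single (u : I -> \bar R) i : (0 <= u i)%E -> (forall j, j != i -> u j = 0%E) ->
  (\esum_(j in setT) u j = u i)%E.
Proof.
move=> ui0 u0; rewrite -(esum_set1 ui0) [RHS]esum_mkcond; apply: eq_esum => j _.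
case: ifPn => //; rewrite notin_setE /= => /eqP; exact: u0.
Qed.

Lemma rsum_single (h : I -> R) i : (forall j, j != i -> h j = 0) -> rsum h = h i.
Proof.
move=> h0; rewrite /rsum !(@esum_single _ i)/=.
- by case: (leP (h i) 0) => ?; case: (leP (- h i) 0) => ?; lra.
- by rewrite lee_fin le_max lexx orbT.
- by move=> j /h0 ->; rewrite oppr0 maxxx.
- by rewrite lee_fin le_max lexx orbT.
- by move=> j /h0 ->; rewrite maxxx.
Qed.

Lemma hdot_delta f i : hdot f (delta i) = f i.
Proof.
rewrite /hdot /= /ell2_dot /csum !(@rsum_single _ i) ?deltaE ?eqxx ?rmorph1 ?mulr1.
- by case: (f i).
- by move=> j /negPf ji; rewrite deltaE ji rmorph0 mulr0.
- by move=> j /negPf ji; rewrite deltaE ji rmorph0 mulr0.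
Qed.

Lemma sum_deltaE (s : seq I) (c : I -> C) i : uniq s ->
  (\sum_(j <- s) c j *: delta j) i = if i \in s then c i else 0.
Proof.
move=> us; rewrite ell2_sum (eq_bigr (fun j => c j * (i == j)%:R))//.
case: ifPn => is_.
  rewrite (bigD1_seq i)//= eqxx mulr1 big1 ?addr0// => j ji.
  by rewrite eq_sym (negPf ji) mulr0.
rewrite big1_seq// => j /andP[_ js].
by case: eqP js is_ => [->->//|_ _ _]; rewrite mulr0.
Qed.

Lemma nrm_sum_delta (s : seq I) (c : I -> C) : uniq s ->
  nrm (\sum_(i <- s) c i *: delta i) ^+ 2 = \sum_(i <- s) nrm (c i) ^+ 2.
Proof.
move=> us; apply: complexI; rewrite -hdotvv hdot_sumr rmorph_sum /=.
apply: eq_big_seq => i is_; rewrite hdotZr hdot_delta sum_deltaE// is_.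
by rewrite mulJ_nrm.
Qed.

Definition cut (s : seq I) f : ell2 := \sum_(i <- s) f i *: delta i.

Lemma cutE (s : seq I) f i : uniq s -> cut s f i = if i \in s then f i else 0.
Proof.
by move=> us; rewrite /cut sum_deltaE.
Qed.

Lemma esum_approx f (e : R) : 0 < e -> exists2 s : seq I, uniq s & 
  nrm f ^+ 2 - e <= \sum_(i <- s) nrm (f i) ^+ 2.
Proof.
move=> e0; apply: contrapT => h.
have [fe|fe] := leP (nrm f ^+ 2) e.
  by apply: h; exists [::] => //; rewrite big_nil subr_le0.
have fe0 : 0 <= nrm f ^+ 2 - e by rewrite subr_ge0 ltW.
suff : nrm f ^+ 2 <= nrm f ^+ 2 - e by lra.
have : nrm f <= Num.sqrt (nrm f ^+ 2 - e).
  apply/(ell2_nrm_le _ (sqrtr_ge0 _)) => s us; rewrite sqr_sqrtr//.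
  by rewrite leNgt; apply/negP => /ltW hs; apply: h; exists s.
by rewrite -ler_sqr ?nnegrE ?sqrtr_ge0 ?nrm_ge0// sqr_sqrtr.
Qed.

Lemma cut_approx f (e : R) : 0 < e -> exists2 s : seq I, uniq s & nrm (f - cut s f) <= e.
Proof.
move=> e0; have e20 : 0 < e ^+ 2 by rewrite exprn_gt0.
have [s us h] := esum_approx f e20; exists s => //.
rewrite -ler_sqr ?nnegrE ?nrm_ge0 ?(ltW e0)//.
have : nrm f ^+ 2 = nrm (f - cut s f) ^+ 2 + nrm (cut s f) ^+ 2.
  rewrite -{1}(subrK (cut s f) f) nrm_sqrD_orth//.
  rewrite hdot_sumr big1_seq// => i /andP[_ is_].
  by rewrite hdotZr hdot_delta ell2B cutE// is_ subrr mulr0.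
have -> : nrm (cut s f) ^+ 2 = \sum_(i <- s) nrm (f i) ^+ 2 by exact: nrm_sum_delta.
by move=> ?; lra.
Qed.

Lemma delta_basis : orthonormal_basis (range delta).
Proof.
split=> [_ _ [i _ <-] [j _ <-]|].
  rewrite hdot_delta deltaE; congr (_%:R); congr nat_of_bool.
  apply/eqP/eqP => [->//|/(congr1 (fun f : ell2 => f j))].
  by rewrite !deltaE eqxx; case: eqP => // _ /eqP; rewrite eq_sym oner_eq0.
apply/nrm_dense => f e e0; have e20 : 0 < e / 2 by rewrite divr_gt0.
have [s us fs] := cut_approx f e20; exists (cut s f).
  exists [seq (f i, delta i) | i <- s]; rewrite big_map; split=> // p /mapP[i _ ->] /=.
  by exists i.
by apply: le_lt_trans fs _; rewrite ltr_pdivrMr// mulr_natr mulr2n ltrDr.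
Qed.

Definition diag_fun m f : I -> C := fun i => (m i)%:C%C * f i.

(* [diag m f] is [0] when [diag_fun m f] is not square summable. *)
Definition diag m f : ell2 := insubd (0 : ell2) (diag_fun m f).

Lemma diagE m f i : square_summable (diag_fun m f) -> diag m f i = (m i)%:C%C * f i.
Proof.
move=> h; have hm : diag_fun m f \in @ell2_pred R I by rewrite inE.
exact: (congr1 (fun k : I -> C => k i) (insubdK (0 : ell2) hm)).
Qed.

Lemma diag_fun_summable m f (M : R) : (forall i, `|m i| <= M) -> square_summable (diag_fun m f).
Proof.
move=> mM; apply: (@square_summable_le _ (M ^+ 2 * nrm f ^+ 2)) => s us.
apply: le_trans (ler_wpM2l (sqr_ge0 M) (ell2_sum_le f us)).
rewrite mulr_sumr; apply: ler_sum => i _.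
rewrite /diag_fun nrmM nrm_real exprMn ler_wpM2r ?sqr_ge0//.
by rewrite ler_sqr ?nnegrE//; exact: le_trans (mM i).
Qed.

Lemma diagEb m f (M : R) i : (forall i, `|m i| <= M) -> diag m f i = (m i)%:C%C * f i.
Proof. by move=> mM; apply: diagE; exact: diag_fun_summable mM. Qed.

Lemma diag_linear m (M : R) : (forall i, `|m i| <= M) -> linear (diag m).
Proof.
move=> mM c f g; apply: ell2_ext => i.
by rewrite ell2D ell2Z !(diagEb _ _ mM) ell2D ell2Z; ring.
Qed.

Lemma diag_nrm m (M : R) f : 0 <= M -> (forall i, `|m i| <= M) -> nrm (diag m f) <= M * nrm f.
Proof.
move=> M0 mM; apply/ell2_nrm_le; first by rewrite mulr_ge0 ?nrm_ge0.
move=> s us; rewrite exprMn.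
apply: le_trans (ler_wpM2l (sqr_ge0 M) (ell2_sum_le f us)).
rewrite mulr_sumr; apply: ler_sum => i _.
rewrite (diagEb _ _ mM) nrmM nrm_real exprMn ler_wpM2r ?sqr_ge0//.
by rewrite ler_sqr ?nnegrE//; exact: le_trans (mM i).
Qed.

Lemma diag_bounded m (M : R) : (forall i, `|m i| <= M) -> bounded_operator (diag m).
Proof.
move=> mM; have mM' i : `|m i| <= `|M| by apply: le_trans (mM i) (ler_norm _).
by apply: (@linear_bounded_operator _ _ _ _ `|M|); [exact: diag_linear mM|move=> f;
  exact: diag_nrm].
Qed.

End EllTwoTheory.

(** * Exponential growth of the group and part (i) *)

(** At [n = k (m + 1)] the left side is [(2^k)^(m+1)], at least [(k+1)^(m+1)], and the right side is
    at most [c ((m+1)(k+1))^m]. Cancelling [(k+1)^m] would bound every natural number. *)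
Lemma expn2_not_poly (R : realType) (c : R) (m : nat) :
  ~ (forall n : nat, 2 ^+ n <= c * n.+1%:R ^+ m).
Proof.
move=> h.
have key (k : nat) : k.+1%:R <= c * m.+1%:R ^+ m.
  have kp : 0 < (k.+1%:R : R) ^+ m by rewrite exprn_gt0.
  rewrite -(ler_pM2r kp) -exprS -mulrA -exprMn -natrM.
  have c0 : 0 <= c by have := h 0%N; rewrite expr0 expr1n mulr1 => /(le_trans ler01).
  apply: le_trans (_ : c * (k * m.+1).+1%:R ^+ m <= _); last first.
    by rewrite ler_wpM2l// lerXn2r ?nnegrE// ler_nat; nia.
  apply: le_trans (h _); rewrite exprM lerXn2r ?nnegrE ?exprn_ge0//.
  by rewrite -natrX ler_nat ltn_expl.
have /archi_boundP hN : 0 <= c * m.+1%:R ^+ m by apply: le_trans (key 0%N).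
by have := le_lt_trans (key (Num.bound (c * m.+1%:R ^+ m))) hN; rewrite ltr_nat ltnNge leqnSn.
Qed.

(** * A free semigroup inside the group *)

Section FreeSemigroup.
Context {R : realType} {a : R} {a_gt0 : 0 < a}.
Local Notation G := (Ga a_gt0).

Lemma Ba1 : Ba a 1.
Proof. by exists [:: (1, 0)]; rewrite big_seq1 /= expr0z mulr1. Qed.

Variable k : int.
Hypothesis ak : a ^ k <= 3^-1.

Definition gen0 : G := MkGa a_gt0 k Ba0.
Definition gen1 : G := MkGa a_gt0 k Ba1.

Fixpoint words (n : nat) : seq G :=
  if n is n'.+1 then [seq (gen0 * g)%g | g <- words n'] ++ [seq (gen1 * g)%g | g <- words n']
  else [:: 1%g].

Lemma size_words n : size (words n) = (2 ^ n)%N.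
Proof. by elim: n => //= n IH; rewrite size_cat !size_map IH expnS mul2n addnn. Qed.

(* Since [a ^ k <= 1/3], the first letter of a word can be read off its
   [B_a]-component, which is at most [1/2] after [gen0] and at least [1] after
   [gen1]. *)
Let contract b : 0 <= b <= 3 / 2 -> 0 <= a ^ k * b <= 2^-1.
Proof.
have ak0 : 0 < a ^ k by rewrite exprz_gt0.
move=> /andP[b0 b1]; rewrite mulr_ge0 ?(ltW ak0)//=.
by apply: le_trans (ler_pM (ltW ak0) b0 ak b1) _; lra.
Qed.

(** [3 / 2] is the fixed point of [b |-> 1 + b / 3], so the interval is stable under both
    generators. *)
Lemma words_bound n g : g \in words n -> 0 <= Ga_b g <= 3 / 2.
Proof.
elim: n g => [|n IH] g /=.
  by rewrite inE => /eqP -> /=; apply/andP; split; lra.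
rewrite mem_cat => /orP[] /mapP[h /IH/contract/andP[h0 h1] ->] /=.
  by rewrite add0r h0 /=; lra.
by apply/andP; split; lra.
Qed.

Lemma words_uniq n : uniq (words n).
Proof.
elim: n => //= n IH; rewrite cat_uniq !map_inj_uniq ?IH//=; try exact: mulgI.
rewrite andbT; apply/hasPn => _ /mapP[h hn ->];
  apply/negP => /mapP[h' hn' /(congr1 (@Ga_b _ _ _))] /=.
have /contract/andP[? ?] := words_bound hn; have /contract/andP[? ?] := words_bound hn'.
by move=> ?; lra.
Qed.

End FreeSemigroup.

Lemma exists_contraction (R : realType) (a : R) : 0 < a -> a != 1 ->
  exists k : int, a ^ k <= 3^-1.
Proof.
move=> a0 a1.
have H (b : R) : 0 < b -> b < 1 -> exists n : nat, b ^+ n <= 3^-1.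
  move=> b0 b1.
  have /cvgrPdist_lt/(_ 3^-1) : (fun n : nat => b ^+ n) @ \oo --> (0 : R).
    by apply: cvg_expr; rewrite ger0_norm// ltW.
  move=> /(_ ltac:(lra))[N _ /(_ N (leqnn _))]; rewrite sub0r normrN => h.
  by exists N; apply: le_trans (ler_norm _) (ltW h).
(* Positive powers contract when [a < 1], negative ones when [a > 1]. *)
have [al1|a1l|aE] := ltgtP a 1; last by rewrite aE eqxx in a1.
  by have [n hn] := H a a0 al1; exists n%:Z.
have [||n hn] := H a^-1; rewrite ?invr_gt0 ?invf_lt1//.
by exists (- n%:Z); rewrite -exprz_inv.
Qed.

Section Subspaces.
Context {R : realType}.
Local Notation C := R[i].

Lemma subspaceD (V : lmodType C) (L : set V) x y : linear_subspace L -> L x -> L y -> L (x + y).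
Proof. by move=> [_ Ll] Lx Ly; rewrite -[x]scale1r; exact: Ll. Qed.

Lemma subspaceZ (V : lmodType C) (L : set V) (c : C) x : linear_subspace L -> L x -> L (c *: x).
Proof. by move=> [L0 Ll] Lx; rewrite -[_ *: _]addr0; exact: Ll. Qed.

Lemma subspace_sum (V : lmodType C) (L : set V) (I : eqType) (s : seq I) (c : I ->
  C) (x : I -> V) :
  linear_subspace L -> (forall i, i \in s -> L (x i)) -> L (\sum_(i <- s) c i *: x i).
Proof.
move=> sL Lx; rewrite big_seq; elim/big_ind : _ => [|y z Ly Lz|i /Lx Li]; first exact: sL.1.
  exact: subspaceD.
exact: subspaceZ.
Qed.

End Subspaces.

Section LeftRegular.
Context {R : realType} (G : groupType).

Lemma left_regular_dot (g : G) (f f' : ell2 (R:=R) G) :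
  hdot (left_regular g f) (left_regular g f') = hdot f f'.
Proof.
have ri (h : G -> R) : rsum (fun x => h (g^-1 * x)%g) = rsum h.
  have bij : set_bij setT setT (fun x : G => g^-1 * x)%g.
    by split=> // [x y _ _ /mulgI//|y _]; exists (g * y)%g => //; rewrite mulKg.
  rewrite /rsum; congr (fine _ - fine _); by rewrite [RHS](@reindex_esum _ _ _ _ _ _ _ bij).
rewrite /hdot /= /ell2_dot /csum /=.
by congr Complex; rewrite -[RHS]ri.
Qed.

Lemma left_regular_delta (g h : G) : left_regular g (delta h : ell2 (R:=R) G) = delta (g * h)%g.
Proof.
apply: ell2_ext => x; rewrite -[LHS]/(delta h (g^-1 * x)%g) !deltaE.
by rewrite -(inj_eq (mulgI g)) mulVKg.
Qed.

Lemma left_regularM (g h : G) (f : ell2 (R:=R) G) :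
  left_regular (g * h)%g f = left_regular g (left_regular h f).
Proof. by apply: ell2_ext => x /=; rewrite invgM mulgA. Qed.

Lemma left_regular1 (f : ell2 (R:=R) G) : left_regular 1%g f = f.
Proof. by apply: ell2_ext => x /=; rewrite invg1 mul1g. Qed.

Lemma left_regularB (g : G) (f h : ell2 (R:=R) G) :
  left_regular g (f - h) = left_regular g f - left_regular g h.
Proof. exact: ell2_ext. Qed.

End LeftRegular.

(** * A Bessel vector from quasi-equivalence *)

Section BesselVector.
Context {R : realType} (G : groupType) (A : cstarType R) (u : G -> A).
Local Notation C := R[i].
Context (H : hilbertType R) (pi : A -> H -> H).
Hypothesis qpi : quasi_equivalent_left_regular u pi.

(* [eta] corresponds to the projection of [delta 1] onto a subrepresentation of
   the regular representation that is contained in [pi]. *)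
Lemma bessel_vector : exists2 eta : H, eta != 0 & forall (s : seq G) (c : G -> C), uniq s ->
  nrm (\sum_(g <- s) c g *: pi (u g) eta) ^+ 2 <= \sum_(g <- s) nrm (c g) ^+ 2.
Proof.
have [rho [rrho rhoE [_ q2]]] := qpi.
have sT : subrep rho setT by split => //; exact: closedT.
have nzT : nonzero_subrep rho setT.
  split=> //; exists (delta 1%g) => //; apply/eqP => /(congr1 (fun f : ell2 G => f 1%g)).
  by rewrite deltaE eqxx ell20 => /eqP; rewrite oner_eq0.
(* The regular representation, as a subrepresentation of itself, is not disjoint from [pi]: some
   nonzero [L] inside it is carried by an isometry [U] onto a subrepresentation of [pi]. *)
have /existsNP[L /existsNP[L' /not_implyP[[[sL cL LI] [l0 Ll0 l0n]] /not_implyP[_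
  /not_implyP[_ /not_implyP[_ /contrapT]]]]]]
  := q2 _ nzT.
move=> [U [Ul Ud _ UI]].
have [p Lp pP] := orth_projection (delta 1%g) sL cL.
have Llam g l : L l -> L (left_regular g l) by move=> Ll; rewrite -rhoE; exact: LI.
(* By invariance of [L] and unitarity of translations, [left_regular g p] is the projection of
   [delta g] onto [L]. *)
have pgP g l : L l -> hdot (delta g - left_regular g p) l = 0.
  move=> Ll; rewrite -(pP _ (Llam g^-1%g _ Ll)) -[RHS](left_regular_dot g).
  by rewrite -left_regularM mulgV left_regular1 left_regularB left_regular_delta mulg1.
have U0 : U 0 = 0.
  have := Ul 1 0 0 sL.1 sL.1; rewrite !scale1r addr0 => /eqP.
  by rewrite -subr_eq0 opprD addrA subrr sub0r oppr_eq0 => /eqP.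
have UZ (c : C) v : L v -> U (c *: v) = c *: U v.
  by move=> Lv; have := Ul c v 0 Lv sL.1; rewrite U0 !addr0.
have UD v w : L v -> L w -> U (v + w) = U v + U w.
  by move=> Lv Lw; have := Ul 1 v w Lv Lw; rewrite !scale1r.
have Unrm v : L v -> nrm (U v) = nrm v.
  by move=> Lv; apply/eqP; rewrite -(eqrXn2 (n := 2))// ?nrm_ge0// !nrm_sqr Ud.
exists (U p).
  (* If [p] vanished, [L] would be orthogonal to every [delta g], hence zero. *)
  apply/negP => /eqP Up.
  have p0 : p = 0 by apply: nrm0_eq0; rewrite -Unrm// Up nrm0.
  move/eqP : l0n; apply; apply: ell2_ext => g; rewrite ell20.
  have := pgP g _ Ll0; rewrite p0.
  rewrite (_ : left_regular g 0 = 0); last by apply: ell2_ext.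
  by rewrite subr0 => /hdotC_eq0; rewrite hdot_delta.
move=> s c us.
set z := \sum_(g <- s) c g *: left_regular g p.
have Lz : L z by apply: subspace_sum => // g _; exact: Llam.
have -> : \sum_(g <- s) c g *: pi (u g) (U p) = U z.
  rewrite /z; elim: (s) => [|g t IH]; first by rewrite !big_nil U0.
  rewrite !big_cons UD ?UZ ?IH//; [|exact: Llam|by apply: subspaceZ => //; exact: Llam|
    by apply: subspace_sum => // h _; exact: Llam].
  by rewrite -rhoE UI.
rewrite Unrm//.
set d : ell2 G := \sum_(g <- s) c g *: delta g.
rewrite -(nrm_sum_delta c us) -/d.
(* [z] is the projection onto [L] of the combination [d] of orthonormal vectors, so it is no longer
   than [d]. *)
have dz : hdot (d - z) z = 0.
  rewrite -sumrB hdot_suml big1// => g _.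
  by rewrite -scalerBr hdotZl pgP ?mulr0.
rewrite -[d](subrK z) (nrm_sqrD_orth dz) lerDr sqr_ge0 //.
Qed.

End BesselVector.

Section Representations.
Context {R : realType} (G : groupType) (A : cstarType R) (u : G -> A).
Local Notation C := R[i].
Hypothesis Au : group_cstar u.
Context (H : hilbertType R) (pi : A -> H -> H).
Hypothesis rpi : representation pi.

Lemma rep_linB x v w : pi x (v - w) = pi x v - pi x w.
Proof. by have [lx _] := rep_bounded rpi x; have := lx (-1) w v;
  rewrite !scaleN1r !(addrC (- _)) => ->. Qed.

Lemma rep_group_nrm g v : nrm (pi (u g) v) = nrm v.
Proof.
apply/eqP; rewrite -(eqrXn2 (n := 2))// ?nrm_ge0// !nrm_sqr (rep_star rpi) (gcs_star Au).
by rewrite -(rep_mul rpi) -(gcs_mul Au) mulVg (gcs_one Au) (rep_one rpi).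
Qed.

Lemma group_algebra_gen g : group_algebra u (u g).
Proof.
by exists [:: (1, u g)]; rewrite big_seq1 scale1r; split=> // p; rewrite inE => /eqP -> /=;
  exists g.
Qed.

End Representations.

Lemma pvm_contract (R : realType) (H : hilbertType R) (E : projection_valued_measure H)
  (B : set (measurableTypeR R)) (v : H) : measurable B -> nrm (pvm E B v) <= nrm v.
Proof.
move=> mB; rewrite -ler_sqr ?nnegrE ?nrm_ge0// -[in leRHS](pvm_setC E v mB).
rewrite nrm_sqrD_orth ?lerDl ?sqr_ge0//.
by apply: pvm_setC_orth => //; [exact: measurableC|rewrite setICr].
Qed.

(** The commutator bound of a spectral triple is a complex number; the order of [R[i]] compares real
    parts, so its real part already serves as a bound. *)
Lemma commutator_nrm (R : realType) (H : hilbertType R) (x y : H) (M : R[i]) :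
  `|x| <= M * `|y| -> nrm x <= complex.Re M * nrm y.
Proof.
rewrite !nrmE lecE => /andP[_]; case: M => m1 m2 /=; by rewrite mulr0 subr0.
Qed.

(** * Powers of the resolvent function *)

Section PowrBounds.
Context {R : realType}.
Variable p : R.
Hypothesis p1 : 1 <= p.
Let f (x : R) := (1 + x ^+ 2) `^ (- (p / 2)).

Let p20 : 0 <= p / 2. Proof. by rewrite divr_ge0// (le_trans _ p1). Qed.
Let ge1 (x : R) : 1 <= 1 + x ^+ 2. Proof. by rewrite lerDl sqr_ge0. Qed.

Lemma resolvent_power_measurable : measurable_fun setT f.
Proof.
apply: (measurableT_comp (measurable_powR _)).
by apply: measurable_funD => //; exact: exprn_measurable.
Qed.

Lemma resolvent_power_decr (x K : R) : - K <= x <= K -> f K <= f x.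
Proof.
move=> /andP[Kx xK]; rewrite /f !powRN lef_pV2 ?posrE ?powR_gt0 ?(lt_le_trans _ (ge1 _))//.
have h1 (y : R) : 0 <= 1 + y ^+ 2 by apply: le_trans (ge1 y).
apply: ge0_ler_powR; rewrite ?nnegrE// lerD2l.
rewrite -[x ^+ 2]real_normK ?num_real// -[K ^+ 2]real_normK ?num_real//.
rewrite lerXn2r ?nnegrE// ler_norml; have := ler_norm K; move=> hK.
by apply/andP; split; lra.
Qed.

Lemma resolvent_power_01 (x : R) : 0 <= f x <= 1.
Proof.
rewrite powR_ge0 /= /f powRN invf_le1 ?powR_gt0 ?(lt_le_trans _ (ge1 _))//.
rewrite -[leLHS](powRr0 (1 + x ^+ 2)) ler_powR//.
Qed.

(** Passing from the real exponent to a natural one makes the trace bound polynomial in [K], ready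
    for comparison with [2 ^ n]. *)
Lemma resolvent_power_inv (K : R) (q : nat) : p / 2 <= q%:R -> (f K)^-1 <= (1 + K ^+ 2) ^+ q.
Proof.
move=> pq; rewrite /f powRN invrK -(powR_mulrn q (le_trans ler01 (ge1 K))).
by rewrite ler_powR.
Qed.

Lemma resolvent_power_gt0 (K : R) : 0 < f K.
Proof. by rewrite powR_gt0// (lt_le_trans _ (ge1 _)). Qed.

End PowrBounds.

Lemma not_finitely_summable (R : realType) (a : R) (a_gt0 : 0 < a) (a_neq1 : a != 1)
    (A : cstarType R) (u : Ga a_gt0 -> A) (Au : group_cstar u)
    (H : hilbertType R) (pi : A -> H -> H) (D : unbounded_operator H) :
  spectral_triple (group_algebra u) pi D -> quasi_equivalent_left_regular u pi ->
  ~ finitely_summable D.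
Proof.
move=> st qe [p p1 [E [T [DE Tf [B Bb Bfin]]]]].
have rpi := st_rep st.
have [k ak] := exists_contraction a_gt0 a_neq1.
have [eta etan0 bes] := bessel_vector qe.
set W := @words R a a_gt0 k.
have e0 : 0 < nrm eta.
  by rewrite lt_def nrm_ge0 andbT; apply: contra etan0 => /eqP/nrm0_eq0->.
have [/nrm_dense dD _] := st_self_adjoint st.
have e40 : 0 < nrm eta / 4 by rewrite divr_gt0.
have [xi Dxi exi] := dD eta _ e40.
have comm g : exists2 M : R, 0 <= M & forall v, udom D v ->
    nrm (D (pi (u g) v) - pi (u g) (D v)) <= M * nrm v.
  have [M hM] := st_commutator st (group_algebra_gen u g).
  exists `|complex.Re M| => // v /hM/commutator_nrm h; apply: le_trans h _.
  by rewrite ler_wpM2r ?nrm_ge0// ler_norm.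
have [M0 M00 hM0] := comm (@gen0 _ _ a_gt0 k).
have [M1 M10 hM1] := comm (@gen1 _ _ a_gt0 k).
pose mu := (M0 + M1) * nrm xi.
have mu0 : 0 <= mu by rewrite mulr_ge0 ?addr_ge0 ?nrm_ge0.
(* Prefixing one letter costs one commutator, at most [mu], since the generators act by
   isometries. *)
have energy n g : g \in W n -> udom D (pi (u g) xi) /\
    nrm (D (pi (u g) xi)) <= nrm (D xi) + n%:R * mu.
  have step x h M (e : R) : 0 <= M <= M0 + M1 -> (forall v, udom D v ->
      nrm (D (pi (u x) v) - pi (u x) (D v)) <= M * nrm v) ->
      udom D (pi (u h) xi) /\ nrm (D (pi (u h) xi)) <= e ->
      udom D (pi (u (x * h)%g) xi) /\ nrm (D (pi (u (x * h)%g) xi)) <= e + mu.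
    move=> /andP[Mp MM] hM [Dh hh]; rewrite (gcs_mul Au) (rep_mul rpi); split.
      by apply: (st_domain st) => //; exact: group_algebra_gen.
    rewrite -[D (pi (u x) _)](subrK (pi (u x) (D (pi (u h) xi)))) addrC.
    apply: le_trans (ler_nrmD _ _) _; rewrite (rep_group_nrm Au rpi) lerD//.
    by apply: le_trans (hM _ Dh) _; rewrite (rep_group_nrm Au rpi) ler_wpM2r ?nrm_ge0.
  elim: n g => [|n IH] g.
    by rewrite inE => /eqP ->; rewrite (gcs_one Au) (rep_one rpi) mul0r addr0; split.
  have -> : nrm (D xi) + n.+1%:R * mu = nrm (D xi) + n%:R * mu + mu.
    by rewrite -natr1 mulrDl mul1r addrA.
  rewrite mem_cat => /orP[] /mapP[h /IH hh ->].
    by apply: (step _ _ M0) => //; rewrite M00 lerDl.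
  by apply: (step _ _ M1) => //; rewrite M10 lerDr.
(* Chosen so that [|D xi| + n mu <= d (n + 1)] for all [n]; the last summand makes it positive. *)
pose d := nrm (D xi) + mu + 1.
have d0 : 0 < d by rewrite ltr_wpDl// addr_ge0 ?nrm_ge0.
(* With [K n = al (n + 1)] the ratio of the energy to [K n] is at most [|eta| / 8], and
   [2 (1/8)^2 <= (1/4)^2] bounds the part lost outside [[- K n, K n]] by [|eta| / 4]. *)
pose al := d * 8 / nrm eta.
have al0 : 0 < al by rewrite divr_gt0// mulr_gt0.
pose K n : R := al * n.+1%:R.
have K0 n : 0 < K n by rewrite mulr_gt0.
pose I n : set (measurableTypeR R) := `[- K n, K n]%classic.
have mI n : measurable (I n) by exact: measurable_itv.
have low n g : g \in W n -> nrm eta / 4 <= nrm (pvm E (I n) (pi (u g) eta)).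
  move=> gW; have [Dg hg] := energy n g gW.
  have := pvm_low_energy DE (K0 n) Dg; rewrite -/(I n) => h.
  have h1 : nrm (pi (u g) xi - pvm E (I n) (pi (u g) xi)) <= nrm eta / 4.
    rewrite -ler_sqr ?nnegrE ?nrm_ge0 ?(ltW e40)//; apply: le_trans h _.
    have hr : nrm (D (pi (u g) xi)) / K n <= nrm eta / 8.
      rewrite ler_pdivrMr// /K /al; apply: le_trans hg _.
      have -> : nrm eta / 8 * (d * 8 / nrm eta * n.+1%:R) = d * n.+1%:R.
        by field; rewrite lt0r_neq0.
      rewrite /d -natr1; have : 0 <= n%:R :> R by [].
      have := nrm_ge0 (D xi); set x := nrm (D xi); set y := n%:R; move=> x0 y0.
      by have := mulr_ge0 x0 y0; nra.
    apply: le_trans (_ : 2 * (nrm eta / 8) ^+ 2 <= _).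
      by rewrite ler_pM2l// ler_sqr ?nnegrE ?divr_ge0 ?nrm_ge0 ?(ltW (K0 n)).
    by have := sqr_ge0 (nrm eta); rewrite !exprMn; set z := nrm eta ^+ 2; lra.
  have h2 : nrm (pvm E (I n) (pi (u g) (eta - xi))) <= nrm eta / 4.
    by apply: le_trans (pvm_contract _ _ (mI n)) _; rewrite (rep_group_nrm Au rpi) ltW.
  have h3 : nrm (pvm E (I n) (pi (u g) xi)) <= nrm (pvm E (I n) (pi (u g) eta)) + nrm eta / 4.
    have -> : xi = eta - (eta - xi) by rewrite opprB addrC subrK.
    rewrite rep_linB// -[pi _ _ - _]addrC pvmD// addrC.
    apply: le_trans (ler_nrmD _ _) _; rewrite lerD2l.
    have -> : - pi (u g) (eta - xi) = (-1) *: pi (u g) (eta - xi) by rewrite scaleN1r.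
    by rewrite pvmZ// scaleN1r nrmN.
  have h4 : nrm (pi (u g) xi) <= nrm (pvm E (I n) (pi (u g) xi)) + nrm eta / 4.
    have := ler_nrmB (pi (u g) xi) (pvm E (I n) (pi (u g) xi)); move: h1; lra.
  (* Three losses of at most [|eta| / 4] each: from [eta] to [xi], by the cut-off, and from [xi]
     back to [eta]. *)
  have h5 := ler_nrmB eta xi; rewrite (rep_group_nrm Au rpi) in h4.
  move: h3 h4 h5 exi; lra.
pose f (x : R) := (1 + x ^+ 2) `^ (- (p / 2)).
have fK n e : f (K n) * nrm (pvm E (I n) e) ^+ 2 <= complex.Re (hdot (T e) e).
  apply: (borel_calculus_ge e Tf).
  - exact: resolvent_power_measurable.
  - exact: resolvent_power_01.
  - exact: ltW (resolvent_power_gt0 _ _).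
  - by move=> x; exact: resolvent_power_decr.
pose tau := fine (\esum_(e in B) (complex.Re (hdot (T e) e))%:E).
have T0 e : 0 <= complex.Re (hdot (T e) e).
  by apply: le_trans (fK 0%N e); rewrite mulr_ge0 ?sqr_ge0// ltW// resolvent_power_gt0.
have Btau : (\esum_(e in B) (complex.Re (hdot (T e) e))%:E <= tau%:E)%E.
  by rewrite fineK// ge0_fin_numE// esum_ge0// => e _; rewrite lee_fin.
have tau0 : 0 <= tau by rewrite fine_ge0// esum_ge0// => e _; rewrite lee_fin.
pose q := Num.bound (p / 2).
have pq : p / 2 <= q%:R.
  by apply/ltW/archi_boundP; rewrite divr_ge0// (le_trans _ p1).
have main n : 2 ^+ n * (nrm eta / 4) ^+ 2 <= (f (K n))^-1 * tau.
  apply: (@le_trans _ _ (\sum_(g <- W n) nrm (pvm E (I n) (pi (u g) eta)) ^+ 2)).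
    apply: (@le_trans _ _ (\sum_(g <- W n) (nrm eta / 4) ^+ 2)).
      by rewrite big_const_seq count_predT iter_addr_0 size_words -natrX mulr_natl.
    rewrite big_seq [leRHS]big_seq; apply: ler_sum => g /low h.
    by rewrite ler_sqr ?nnegrE ?nrm_ge0 ?(ltW e40).
  apply: (bessel_trace (mI n) Bb _ _ Btau).
  - by rewrite invr_gt0 resolvent_power_gt0.
  - by move=> e; rewrite ler_pdivlMl ?resolvent_power_gt0.
  - by move=> c; apply: bes; exact: words_uniq.
(* The inverse of [f (K n)] is at most [((1 + al^2) (n+1)^2)^q], a polynomial of degree [2 q] in
   [n + 1]. *)
apply: (@expn2_not_poly R ((1 + al ^+ 2) ^+ q * tau / (nrm eta / 4) ^+ 2) (q * 2)) => n.
rewrite mulrAC ler_pdivlMr ?exprn_gt0//; apply: le_trans (main n) _.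
rewrite mulrAC ler_wpM2r//; apply: le_trans (resolvent_power_inv _ pq) _ => //.
rewrite mulnC exprM -exprMn lerXn2r ?nnegrE ?mulr_ge0 ?addr_ge0 ?sqr_ge0//.
rewrite /K exprMn mulrDl mul1r lerD2r; rewrite -natrX ler1n expn_gt0//.
Qed.

(** * Amenability and weak containment *)

Section GramSchmidt.
Context {R : realType} {H : hilbertType R}.
Local Notation C := R[i].
Implicit Types (es : seq H) (v w : H).

Definition orthonormal es := uniq es /\
  forall e f, e \in es -> f \in es -> hdot e f = (e == f)%:R.

Lemma orthonormal_sum_dot es (c : H -> C) e : orthonormal es -> e \in es ->
  hdot (\sum_(f <- es) c f *: f) e = c e.
Proof.
move=> [ue oe] ee; rewrite hdot_suml (bigD1_seq e)//= hdotZl oe// eqxx mulr1.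
rewrite big1_seq ?addr0// => f /andP[fe fes].
by rewrite hdotZl oe// (negPf fe) mulr0.
Qed.

Lemma orthonormal_nrm es (c : H -> C) : orthonormal es ->
  nrm (\sum_(f <- es) c f *: f) ^+ 2 = \sum_(f <- es) nrm (c f) ^+ 2.
Proof.
move=> oe; apply: complexI; rewrite -hdotvv hdot_sumr rmorph_sum /=.
apply: eq_big_seq => e ee.
by rewrite hdotZr orthonormal_sum_dot// mulJ_nrm.
Qed.

Lemma orthonormal_bessel es v : orthonormal es ->
  \sum_(e <- es) nrm (hdot v e) ^+ 2 <= nrm v ^+ 2.
Proof.
move=> oe; have := @bessel_dot R H H es id v; move=> /(_ _).
rewrite (eq_bigr (fun e => nrm (hdot v e) ^+ 2)); last first.
  by move=> e _; rewrite hdot_conj nrmJ.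
by apply => c; rewrite orthonormal_nrm.
Qed.

(** Serves to resolve a finitely supported [H]-valued function on [G] into finitely many scalar
    ones; dependent vectors add nothing to the system. *)
Lemma gram_schmidt (vs : seq H) : exists2 es, orthonormal es &
  forall v, v \in vs -> v = \sum_(e <- es) hdot v e *: e.
Proof.
elim: vs => [|v vs [es oe vsE]]; first by exists [::].
pose r := v - \sum_(e <- es) hdot v e *: e.
have re e : e \in es -> hdot r e = 0.
  by move=> ee; rewrite hdotBl orthonormal_sum_dot// subrr.
have [r0|rn0] := eqVneq r 0.
  exists es => // w; rewrite inE => /orP[/eqP ->|/vsE//].
  by apply/eqP; rewrite -subr_eq0; apply/eqP.
have nr0 : 0 < nrm r.
  by rewrite lt_def nrm_ge0 andbT; apply: contra rn0 => /eqP/nrm0_eq0->.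
pose n := (nrm r)^-1%:C%C *: r.
have ne e : e \in es -> hdot n e = 0 by move=> ee; rewrite hdotZl re// mulr0.
have nn : hdot n n = 1.
  rewrite hdotvv nrmZ nrm_real ger0_norm ?invr_ge0 ?nrm_ge0// mulVf ?expr1n//.
  by rewrite lt0r_neq0.
have nes : n \notin es.
  by apply/negP => /ne /eqP; rewrite nn oner_eq0.
exists (n :: es).
  split; first by rewrite /= nes; case: oe.
  move=> e f; rewrite !inE => /orP[/eqP ->|ee] /orP[/eqP ->|fe].
  - by rewrite nn eqxx.
  - by rewrite ne//; case: eqP fe nes => // <- ->.
  - by rewrite hdot_conj ne// rmorph0; case: eqP ee nes => // -> ->.
  - by case: oe => _ ->.
move=> w; rewrite inE => /orP[/eqP ->|wv]; rewrite big_cons.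
  have -> : hdot v n *: n = r; last by rewrite /r subrK.
  have -> : hdot v n = (nrm r)%:C%C.
    rewrite -[v](subrK (\sum_(e <- es) hdot v e *: e)) -/r hdotDl.
    rewrite [X in _ + X]hdot_suml [X in _ + X]big1_seq ?addr0; last first.
      by move=> e /andP[_ ee]; rewrite hdotZl [hdot e n]hdot_conj ne// rmorph0 mulr0.
    rewrite /n hdotZr conj_real hdotvv -rmorphM expr2 mulrA mulVf ?mul1r//.
    by rewrite lt0r_neq0.
  by rewrite scalerA -rmorphM divff ?scale1r ?lt0r_neq0.
have -> : hdot w n = 0.
  rewrite (vsE _ wv) hdot_suml big1_seq// => e /andP[_ ee].
  by rewrite hdotZl [hdot e n]hdot_conj ne// rmorph0 mulr0.
by rewrite scale0r add0r -vsE.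
Qed.

End GramSchmidt.

Section OpNorm.
Context {R : realType} (V : normedModType R[i]).
Implicit Types (T : V -> V) (M : R).

Lemma op_norm_le T M : 0 <= M -> (forall v, nrm (T v) <= M * nrm v) -> op_norm T <= M.
Proof.
move=> M0 TM; apply: ge_sup.
  by exists (nrm (T 0)), 0; rewrite //= normr0 ler01.
move=> _ [v /= v1 <-]; apply: le_trans (TM v) _.
by rewrite -[leRHS]mulr1 ler_wpM2l// -lecR -nrmE.
Qed.

(** The bound [M] guarantees that the supremum defining [op_norm] is a genuine one and not the
    default value for an unbounded set. *)
Lemma le_op_norm T M v : (forall (c : R[i]) v, T (c *: v) = c *: T v) ->
  (forall v, nrm (T v) <= M * nrm v) -> nrm (T v) <= op_norm T * nrm v.
Proof.
move=> TZ TM.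
have [v0|vn0] := eqVneq (nrm v) 0.
  by rewrite v0 mulr0; apply: le_trans (TM v) _; rewrite v0 mulr0.
have vp : 0 < nrm v by rewrite lt_def vn0 nrm_ge0.
have -> : v = (nrm v)%:C%C *: ((nrm v)^-1%:C%C *: v).
  by rewrite scalerA -rmorphM divff ?scale1r.
rewrite TZ !nrmZ !nrm_real !ger0_norm ?invr_ge0 ?nrm_ge0// mulVf// mulr1 mulrC.
rewrite ler_wpM2r ?nrm_ge0//; apply: ub_le_sup.
  exists `|M| => _ [w /= w1 <-]; apply: le_trans (TM w) _.
  apply: le_trans (_ : `|M| * nrm w <= _); first by rewrite ler_wpM2r ?nrm_ge0 ?ler_norm.
  by rewrite -[leRHS]mulr1 ler_wpM2l// -lecR -nrmE.
exists ((nrm v)^-1%:C%C *: v) => //=.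
by rewrite nrmE nrmZ nrm_real ger0_norm ?invr_ge0 ?nrm_ge0// mulVf// lexx.
Qed.

End OpNorm.

(** * Fell absorption: the maximal norm against the regular one *)

Section WeakContainment.
Context {R : realType} (G : groupType).
Local Notation C := R[i].
Implicit Types (s : seq (C * G)).

Definition rep_alg (H : hilbertType R) (sigma : G -> H -> H) s (v : H) : H :=
  \sum_(p <- s) p.1 *: sigma p.2 v.

Section UnitaryRep.
Context (H : hilbertType R) (sigma : G -> H -> H).
Hypothesis us : unitary_rep sigma.

Lemma urep_nrm g v : nrm (sigma g v) = nrm v.
Proof.
by apply/eqP; rewrite -(eqrXn2 (n := 2))// ?nrm_ge0// !nrm_sqr (urep_dot us).
Qed.

Lemma rep_alg_nrm s v : nrm (rep_alg sigma s v) <= (\sum_(p <- s) nrm p.1) * nrm v.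
Proof.
apply: le_trans (ler_nrm_sum _ _ _) _; rewrite mulr_suml.
by apply: ler_sum => p _; rewrite nrmZ urep_nrm.
Qed.

Lemma urep0 g : sigma g 0 = 0.
Proof. by apply: nrm0_eq0; rewrite urep_nrm nrm0. Qed.

Lemma urepZ g (c : C) v : sigma g (c *: v) = c *: sigma g v.
Proof. by have := urep_linear us g c v 0; rewrite urep0 !addr0. Qed.

Lemma rep_algZ s (c : C) v : rep_alg sigma s (c *: v) = c *: rep_alg sigma s v.
Proof.
rewrite /rep_alg scaler_sumr; apply: eq_bigr => p _.
by rewrite urepZ !scalerA mulrC.
Qed.

End UnitaryRep.

Lemma rep_alg_max_norm (H : hilbertType R) (sigma : G -> H -> H) s v :
  unitary_rep sigma -> nrm (rep_alg sigma s v) <= max_norm s * nrm v.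
Proof.
move=> us; apply: le_trans (le_op_norm v (rep_algZ us s) (rep_alg_nrm us s)) _.
rewrite ler_wpM2r ?nrm_ge0//; apply: ub_le_sup; last by exists H, sigma.
(* This bound is uniform over all unitary representations, so the supremum in [max_norm] is
   finite. *)
exists (\sum_(p <- s) nrm p.1) => _ [H' [sigma' [us' ->]]].
by apply: op_norm_le => [|v']; [apply: sumr_ge0|apply: rep_alg_nrm].
Qed.

Lemma left_regular_urep : unitary_rep (@left_regular R G).
Proof.
split.
- by move=> g c f h; exact: ell2_ext.
- exact: left_regular_dot.
- exact: left_regularM.
- exact: left_regular1.
Qed.

Lemma max_norm_le s (M : R) : 0 <= M ->
  (forall (H : hilbertType R) (sigma : G -> H -> H) v, unitary_rep sigma ->
    nrm (rep_alg sigma s v) <= M * nrm v) -> max_norm s <= M.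
Proof.
move=> M0 h; apply: ge_sup.
  by eexists; exists (ell2 G), (@left_regular R G); split; [exact: left_regular_urep|].
move=> _ [H [sigma [us ->]]]; apply: op_norm_le => // v; exact: h.
Qed.

Section Coefficient.
Variables (s : seq (C * G)) (M : R).
Hypothesis M0 : 0 <= M.
Hypothesis sM : forall f : ell2 (R := R) G, nrm (rep_alg (@left_regular R G) s f) <= M * nrm f.
Context (H : hilbertType R) (sigma : G -> H -> H).
Hypothesis us : unitary_rep sigma.
Variables (S : seq G) (xi : G -> R).
Hypothesis uS : uniq S.
Hypothesis xi0 : forall h, h \notin S -> xi h = 0.
Hypothesis xi1 : \sum_(h <- S) xi h ^+ 2 = 1.

(** The matrix coefficient [<left_regular g xi, xi>] of the real function [xi], whose support lies
    in [S]. *)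
Definition overlap g : R := \sum_(h <- S) xi (g^-1 * h)%g * xi h.

(* Fell absorption: [v |-> F v] intertwines [sigma], up to the coefficient
   [overlap], with a multiple of the regular representation; [coef v e] is the
   component of [F v] along [e]. *)
Let F (v : H) (h : G) : H := (xi h)%:C%C *: sigma (h^-1)%g v.
Let coef (v e : H) : ell2 (R := R) G := \sum_(h <- S) hdot (F v h) e *: delta h.

Let F0 v h : h \notin S -> F v h = 0.
Proof. by move=> hS; rewrite /F xi0// rmorph0 scale0r. Qed.

Let coefE v e h : coef v e h = hdot (F v h) e.
Proof.
by rewrite /coef sum_deltaE//; case: ifPn => // hS; rewrite F0// hdot0l.
Qed.

Let coef_nrm v es : orthonormal es -> nrm v <= 1 -> \sum_(e <- es) nrm (coef v e) ^+ 2 <= 1.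
Proof.
move=> oe v1; under eq_bigr do rewrite /coef nrm_sum_delta//.
rewrite exchange_big/= -xi1; apply: ler_sum => h _.
apply: le_trans (orthonormal_bessel _ oe) _.
rewrite /F nrmZ nrm_real (urep_nrm us) exprMn real_normK ?num_real//.
by rewrite -[leRHS]mulr1 ler_wpM2l ?sqr_ge0// expr_le1// nrm_ge0.
Qed.

Let F_dot v w g h : hdot (F v (g^-1 * h)%g) (F w h) =
  (xi (g^-1 * h)%g * xi h)%:C%C * hdot (sigma g v) w.
Proof.
rewrite /F hdotZl hdotZr conj_real mulrA -rmorphM; congr (_ * _).
by rewrite invgM invgK (urep_mul us) (urep_dot us).
Qed.

(** The sum equals the sum over [e] of [<lam(s) (coef v e), coef w e>], with [lam] the regular
    representation. Each term is at most [M |coef v e| |coef w e|], and the squared norms add up to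
    at most 1 for [v] and for [w]. *)
Lemma coefficient_bound v w : nrm v <= 1 -> nrm w <= 1 ->
  nrm (\sum_(p <- s) p.1 * ((overlap p.2)%:C%C * hdot (sigma p.2 v) w)) <= M.
Proof.
move=> v1 w1.
(* Resolving [F v] is enough: components of [F w] outside this span are orthogonal to [F v]. *)
have [es oe esE] := gram_schmidt [seq F v h | h <- S].
have FE h : F v h = \sum_(e <- es) hdot (F v h) e *: e.
  have [hS|hS] := boolP (h \in S); first by apply: esE; exact: map_f.
  by rewrite F0// big1// => e _; rewrite hdot0l scale0r.
have sumE g : \sum_(e <- es) hdot (left_regular g (coef v e)) (coef w e) =
    (overlap g)%:C%C * hdot (sigma g v) w.
  rewrite (eq_bigr (fun e => \sum_(h <- S) (hdot (F w h) e)^* * hdot (F v (g^-1 * h)%g)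
    e)); last first.
    move=> e _; rewrite [X in hdot _ X]/coef hdot_sumr; apply: eq_bigr => h _.
    by rewrite hdotZr hdot_delta; congr (_ * _); exact: coefE.
  rewrite exchange_big/= /overlap rmorph_sum mulr_suml; apply: eq_bigr => h _.
  rewrite -F_dot [F v _ in RHS]FE hdot_suml; apply: eq_bigr => e _.
  by rewrite hdotZl -hdot_conj mulrC.
have -> : \sum_(p <- s) p.1 * ((overlap p.2)%:C%C * hdot (sigma p.2 v) w) =
    \sum_(e <- es) hdot (rep_alg (@left_regular R G) s (coef v e)) (coef w e).
  under eq_bigr do rewrite -sumE mulr_sumr.
  rewrite exchange_big/=; apply: eq_bigr => e _.
  by rewrite hdot_suml; apply: eq_bigr => p _; rewrite hdotZl.
apply: le_trans (ler_nrm_sum _ _ _) _.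
apply: (@le_trans _ _ (\sum_(e <- es) M / 2 * (nrm (coef v e) ^+ 2 + nrm (coef w e) ^+ 2))).
  apply: ler_sum => e _; apply: le_trans (hdot_CauchySchwarz _ _) _.
  apply: le_trans (ler_wpM2r (nrm_ge0 _) (sM _)) _.
  rewrite -!mulrA ler_wpM2l//.
  have := sqr_ge0 (nrm (coef v e) - nrm (coef w e)); rewrite sqrrB; lra.
rewrite -mulr_sumr big_split/= -[leRHS](divfK (_ : 2 != 0))// ler_wpM2l ?divr_ge0//.
by rewrite -[2]/(1 + 1) lerD// coef_nrm.
Qed.

End Coefficient.

(** The [l^2] form of amenability: coefficients of the regular representation approximate the
    constant 1 on finite sets, i.e. the trivial representation is weakly contained in it. *)
Definition reiter := forall (gs : seq G) (eps : R), 0 < eps ->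
  exists (S : seq G) (xi : G -> R), [/\ uniq S, (forall h, h \notin S -> xi h = 0),
    \sum_(h <- S) xi h ^+ 2 = 1 & forall g, g \in gs -> `|1 - overlap S xi g| <= eps].

Lemma max_norm_regular s (M : R) : reiter -> 0 <= M ->
  (forall f : ell2 (R := R) G, nrm (rep_alg (@left_regular R G) s f) <= M * nrm f) ->
  max_norm s <= M.
Proof.
move=> rG M0 sM; apply: max_norm_le => // H sigma v us.
have unit v1 w1 : nrm v1 <= 1 -> nrm w1 <= 1 -> nrm (hdot (rep_alg sigma s v1) w1) <= M.
  move=> v1b w1b; apply/ler_addgt0Pr => e e0.
  set c := \sum_(p <- s) nrm p.1.
  have c0 : 0 <= c by apply: sumr_ge0.
  have c1 : 0 < c + 1 by rewrite ltr_wpDl.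
  (* The coefficients of [s] have total mass [c], so this accuracy of the overlap costs at most [e];
     the [+ 1] covers [c = 0]. *)
  have [S [xi [uS xi0 xi1 ov]]] := rG [seq p.2 | p <- s] (e / (c + 1)) (divr_gt0 e0 c1).
  have := coefficient_bound M0 sM us uS xi0 xi1 v1b w1b.
  set z := \sum_(p <- s) _ => zM.
  rewrite -[hdot _ _](subrK z) addrC; apply: le_trans (ler_nrmD _ _) _; rewrite lerD//.
  rewrite /z /rep_alg hdot_suml -sumrB; apply: le_trans (ler_nrm_sum _ _ _) _.
  apply: (@le_trans _ _ (\sum_(p <- s) nrm p.1 * (e / (c + 1)))).
    rewrite big_seq [leRHS]big_seq; apply: ler_sum => p ps.
    rewrite hdotZl -mulrBr nrmM ler_wpM2l ?nrm_ge0//.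
    rewrite -{1}[hdot _ _]mul1r -mulrBl nrmM -[1]/(1%:C%C) -rmorphB nrm_real.
    rewrite -[leRHS]mulr1 ler_pM//; first by apply: ov; exact: map_f.
    apply: le_trans (hdot_CauchySchwarz _ _) _; rewrite (urep_nrm us).
    by rewrite -[leRHS]mulr1 ler_pM ?nrm_ge0.
  rewrite -mulr_suml -/c mulrA ler_pdivrMr// mulrC ler_wpM2l ?(ltW e0)//.
  by rewrite lerDl.
have [x0|xn0] := eqVneq (nrm v) 0.
  by rewrite x0 mulr0 -[v]scale1r (nrm0_eq0 x0) scaler0 -(scale0r 0) (rep_algZ us) scale0r nrm0.
pose x := rep_alg sigma s ((nrm v)^-1%:C%C *: v).
have v1 : nrm ((nrm v)^-1%:C%C *: v) <= 1.
  by rewrite nrmZ nrm_real ger0_norm ?invr_ge0 ?nrm_ge0// mulVf.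
suff xM : nrm x <= M.
  have -> : v = (nrm v)%:C%C *: ((nrm v)^-1%:C%C *: v) by rewrite scalerA -rmorphM divff ?scale1r.
  rewrite (rep_algZ us) -/x !nrmZ !nrm_real !ger0_norm ?invr_ge0 ?nrm_ge0// mulVf// mulr1 mulrC.
  by rewrite ler_wpM2r ?nrm_ge0.
have [->//|xn] := eqVneq (nrm x) 0.
(* Pairing [x] with its own direction recovers its norm. *)
have := unit _ ((nrm x)^-1%:C%C *: x) v1.
rewrite nrmZ nrm_real ger0_norm ?invr_ge0 ?nrm_ge0// mulVf// => /(_ (lexx _)).
rewrite -/x hdotZr conj_real hdotvv -rmorphM nrm_real expr2 mulrA mulVf// mul1r.
by rewrite ger0_norm ?nrm_ge0.
Qed.

End WeakContainment.

(** * Almost invariant multisets *)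

Section Reiter.
Context {R : realType} (G : groupType).
Implicit Types (w t : seq G) (phi : G -> R).

(* w and t, seen as sums of Dirac masses, are at distance at most k for the
   norm dual to the uniform one. *)
Definition near_multiset (k : R) w t := forall phi, (forall h, 0 <= phi h <= 1) ->
  \sum_(h <- w) phi h - \sum_(h <- t) phi h <= k.

Lemma sum_count (S : seq G) t phi : uniq S -> (forall h, h \notin S -> phi h = 0) ->
  \sum_(h <- t) phi h = \sum_(h <- S) phi h * (count_mem h t)%:R.
Proof.
move=> uS phi0; elim: t => [|x t IH].
  by rewrite big_nil big1// => h _; rewrite mulr0.
rewrite big_cons IH /=; under [RHS]eq_bigr do rewrite natrD mulrDr.
rewrite big_split/=; congr (_ + _).
have [xS|xS] := boolP (x \in S).
  rewrite (bigD1_seq x)//= eqxx mulr1 big1 ?addr0// => h hx.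
  by rewrite eq_sym (negPf hx) mulr0.
rewrite phi0// big1_seq// => h /andP[_ hS].
by case: eqP hS xS => [->->//|_ _ _]; rewrite mulr0.
Qed.

(** The vector is the square root of the density [f w] of the multiset. Its overlap is the sum of
    [sqrt (f t * f w)]: at most 1 by the arithmetic-geometric inequality, and bounded below because
    [sqrt (x y) >= min x y]. *)
Lemma reiter_multiset :
  (forall (gs : seq G) (eps : R), 0 < eps -> exists2 w : seq G, (0 < size w)%N &
    forall g, g \in gs -> near_multiset (eps * (size w)%:R) w [seq (g * h)%g | h <- w]) ->
  reiter (R := R) G.
Proof.
move=> hG gs eps e0; have [w w0 hw] := hG gs eps e0.
have n0 : 0 < (size w)%:R :> R by rewrite ltr0n.
set N := (size w)%:R in n0.
pose S := undup w; pose f t h : R := (count_mem h t)%:R / N.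
have f0 t h : 0 <= f t h by rewrite divr_ge0// ltW.
have uS : uniq S by exact: undup_uniq.
have fS h : h \notin S -> f w h = 0.
  by rewrite mem_undup => /count_memPn hw0; rewrite /f hw0 mul0r.
have tot t : \sum_(h <- S) f t h <= (size t)%:R / N.
  rewrite -mulr_suml ler_pM2r ?invr_gt0//.
  rewrite (eq_big_seq (fun h => (h \in S)%:R * (count_mem h t)%:R)); last first.
    by move=> h ->; rewrite mul1r.
  rewrite -sum_count//; last by move=> h /negPf->.
  apply: le_trans (_ : \sum_(h <- t) 1 <= _);
    last by rewrite big_const_seq count_predT iter_addr_0.
  by apply: ler_sum => h _; case: (_ \in _); rewrite ?ler01.
have totw : \sum_(h <- S) f w h = 1.
  rewrite -mulr_suml (eq_big_seq (fun h => (h \in S)%:R * (count_mem h w)%:R)); last first.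
    by move=> h ->; rewrite mul1r.
  rewrite -sum_count//; last by move=> h /negPf->.
  rewrite (eq_big_seq (fun=> 1)); last by move=> h; rewrite -mem_undup => ->.
  by rewrite big_const_seq count_predT iter_addr_0 divff// lt0r_neq0.
exists S, (fun h => Num.sqrt (f w h)); split=> //.
- by move=> h /fS ->; rewrite sqrtr0.
- by rewrite -[RHS]totw; apply: eq_bigr => h _; rewrite sqr_sqrtr.
move=> g gg; set t := [seq (g * h)%g | h <- w].
have ft h : f w (g^-1 * h)%g = f t h.
  rewrite /f /t count_map; congr (_%:R / N); apply: eq_count => x /=.
  by rewrite -(inj_eq (mulgI g)) mulVKg.
have ov : overlap S (fun h => Num.sqrt (f w h)) g = \sum_(h <- S) Num.sqrt (f t h) *
  Num.sqrt (f w h).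
  by apply: eq_bigr => h _; rewrite ft.
rewrite ler_norml; apply/andP; split.
  rewrite lerNl opprB (le_trans _ (ltW e0))// subr_le0 ov.
  apply: (@le_trans _ _ (\sum_(h <- S) (f t h + f w h) / 2)).
    apply: ler_sum => h _; have := sqr_ge0 (Num.sqrt (f t h) - Num.sqrt (f w h)).
    by rewrite sqrrB !sqr_sqrtr//; lra.
  rewrite -mulr_suml big_split/= totw; have := tot t; rewrite size_map divff ?lt0r_neq0//.
  lra.
(* This test function picks out the positive part of [f w - f t], which dominates
   [f w - sqrt (f t * f w)] pointwise. *)
pose phi h : R := (f t h < f w h)%R%:R.
have phi0 h : h \notin S -> phi h = 0.
  by move=> /fS hS; rewrite /phi hS ltNge f0.
have phi01 h : 0 <= phi h <= 1 by rewrite /phi; case: (_ < _); rewrite lexx ler01.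
have := hw g gg phi phi01; rewrite -/t !(sum_count _ uS phi0) -sumrB => h.
have h' : \sum_(h <- S) phi h * (f w h - f t h) <= eps.
  rewrite -(ler_pM2r n0) mulr_suml; apply: le_trans h.
  rewrite le_eqVlt; apply/orP; left; apply/eqP/eq_bigr => x _.
  rewrite /f; set A := (_)%:R; set B := (_)%:R.
  by field; rewrite lt0r_neq0.
apply: le_trans h'; rewrite ov -[X in X - _]totw -sumrB; apply: ler_sum => x _.
rewrite /phi; case: ltP => hx /=.
  rewrite mul1r lerD2l lerN2 -{1}[f t x]sqr_sqrtr// expr2 ler_wpM2l ?sqrtr_ge0//.
  by rewrite ler_wsqrtr// ltW.
rewrite mul0r subr_le0 -{1}[f w x]sqr_sqrtr// expr2 ler_wpM2r ?sqrtr_ge0//.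
by rewrite ler_wsqrtr.
Qed.

(* Averaging over a long orbit of [x] makes a multiset almost invariant under
   [x] and keeps its invariance under the elements that commute with [x]. *)
Lemma abelian_reiter (xs : seq G) (eps : R) : 0 < eps ->
  (forall x y, x \in xs -> y \in xs -> (x * y = y * x)%g) ->
  exists2 w : seq G, (0 < size w)%N &
    forall g, g \in xs -> near_multiset (eps * (size w)%:R) w [seq (g * h)%g | h <- w].
Proof.
move=> e0; elim: xs => [|x xs IH] cxs; first by exists [:: 1%g].
have [|w w0 hw] := IH; first by move=> y z yx zx; apply: cxs; rewrite inE ?yx ?zx orbT.
(* For an orbit of length at least [1 / eps], translation by [x] changes only the two ends, a
   fraction [eps] of the total mass. *)
pose n := (Num.bound (eps^-1)).+1.
have n0 : 0 < n%:R :> R by rewrite ltr0n.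
have ne : 1 <= eps * n%:R.
  rewrite -ler_pdivrMl// mulr1; apply/ltW.
  apply: (@lt_le_trans _ _ (Num.bound eps^-1)%:R); last by rewrite ler_nat.
  by apply: archi_boundP; rewrite invr_ge0 ltW.
pose w' := flatten [seq [seq (x ^+ j * h)%g | h <- w] | j <- iota 0 n].
have sumw' (psi : G -> R) : \sum_(h <- w') psi h = \sum_(0 <= j < n) \sum_(h <- w) psi (x
  ^+ j * h)%g.
  rewrite big_flatten big_map /index_iota subn0; apply: eq_bigr => j _.
  by rewrite big_map.
have szw' : (size w')%:R = n%:R * (size w)%:R :> R.
  have := sumw' (fun=> 1); rewrite big_const_seq count_predT iter_addr_0 => ->.
  rewrite big_const_seq count_predT iter_addr_0 size_iota subn0.
  by rewrite big_const_seq count_predT iter_addr_0 mulr_natl.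
exists w'; first by rewrite -(ltr0n R) szw' mulr_gt0// ltr0n.
move=> y; rewrite inE => /orP[/eqP ->|yxs] phi phi01; rewrite big_map !sumw'.
  pose s j := \sum_(h <- w) phi (x ^+ j * h)%g.
  have -> : \sum_(0 <= j < n) \sum_(h <- w) phi (x * (x ^+ j * h))%g = \sum_(0 <= j < n) s j.+1.
    by apply: eq_bigr => j _; apply: eq_bigr => h _; rewrite mulgA -expgS.
  rewrite -[\sum_(0 <= j < n) \sum_(h <- w) _]/(\sum_(0 <= j < n) s j).
  have -> : \sum_(0 <= j < n) s j - \sum_(0 <= j < n) s j.+1 = s 0%N - s n.
    by rewrite -[RHS]opprB -(telescope_sumr s (leq0n n)) -sumrB -sumrN;
      apply: eq_bigr => j _; rewrite opprB.
  rewrite szw' mulrA.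
  apply: (@le_trans _ _ (size w)%:R); last by rewrite -[leLHS]mul1r ler_wpM2r.
  apply: (@le_trans _ _ (s 0%N)).
    by rewrite gerBl; apply: sumr_ge0 => h _; have /andP[] := phi01 (x ^+ n * h)%g.
  apply: le_trans (_ : \sum_(h <- w) 1 <= _);
    last by rewrite big_const_seq count_predT iter_addr_0.
  by apply: ler_sum => h _; have /andP[] := phi01 (x ^+ 0 * h)%g.
(* Commutation lets [y] pass through [x ^+ j], so the invariance of [w] applies on each slice, with
   the test function translated by [x ^+ j]. *)
have cyx j : (y * x ^+ j = x ^+ j * y)%g.
  apply: commuteX; apply: cxs; rewrite inE ?yxs ?orbT ?eqxx//.
rewrite -sumrB szw' mulrCA mulr_natl.
apply: le_trans (_ : \sum_(0 <= j < n) (eps * (size w)%:R) <= _); last first.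
  by rewrite big_const_seq count_predT iter_addr_0 size_iota subn0.
apply: ler_sum => j _.
have := hw y yxs (fun h => phi (x ^+ j * h)%g) (fun h => phi01 _).
by rewrite big_map; under [X in _ - X <= _]eq_bigr do rewrite mulgA -cyx -mulgA.
Qed.

End Reiter.

(** * Amenability of the semidirect product *)

Section ReiterGa.
Context {R : realType} {a : R} {a_gt0 : 0 < a}.
Local Notation G := (Ga a_gt0).

(** Sliding a window of [N] integers by one step telescopes to its two ends and costs at most [B].
    After [|m|] steps the bound is still independent of [N], so it becomes negligible relative to
    the window. *)
Lemma shift_sum_bound (s : int -> R) (B : R) (m : int) (N : nat) :
  (forall z, 0 <= s z <= B) ->
  \sum_(0 <= l < N) (s l - s (m + l)) <= `|m|%N%:R * B.
Proof.
move=> sB.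
have B0 : 0 <= B by have /andP[h1 h2] := sB 0; exact: le_trans h2.
have up (k : int) : \sum_(0 <= l < N) (s (k + l) - s (k + 1 + l)) <= B.
  have -> : \sum_(0 <= l < N) (s (k + l%:Z) - s (k + 1 + l%:Z)) = s k - s (k + N%:Z).
    have := telescope_sumr (fun l => s (k + l%:Z)) (leq0n N); rewrite addr0 => E.
    rewrite -[RHS]opprB -E -sumrN; apply: eq_bigr => l _; rewrite opprB; congr (_ - s _).
    by rewrite -addrA; congr (_ + _).
  by have /andP[? ?] := sB k; have /andP[? ?] := sB (k + N%:Z); lra.
have dn (k : int) : \sum_(0 <= l < N) (s (k + 1 + l%:Z) - s (k + l%:Z)) <= B.
  have -> : \sum_(0 <= l < N) (s (k + 1 + l%:Z) - s (k + l%:Z)) = s (k + N%:Z) - s k.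
    have := telescope_sumr (fun l => s (k + l%:Z)) (leq0n N); rewrite addr0 => <-.
    by apply: eq_bigr => l _; congr (s _ - _); rewrite -addrA; congr (_ + _).
  by have /andP[? ?] := sB k; have /andP[? ?] := sB (k + N%:Z); lra.
have H (n : nat) (d : int) : d = 1 \/ d = -1 ->
  \sum_(0 <= l < N) (s l%:Z - s (d * n%:Z + l%:Z)) <= n%:R * B.
  move=> hd; elim: n => [|n IH].
    by rewrite mul0r big1// => l _; rewrite mulr0 add0r subrr.
  rewrite -natr1 mulrDl mul1r.
  apply: le_trans (_ : \sum_(0 <= l < N) (s l%:Z - s (d * n%:Z + l%:Z)) +
     \sum_(0 <= l < N) (s (d * n%:Z + l%:Z) - s (d * n.+1%:Z + l%:Z)) <= _).
    by rewrite -big_split/=; apply: ler_sum => l _; rewrite addrA subrK.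
  apply: lerD => //; case: hd => ->.
    rewrite !mul1r; apply: le_trans (up n%:Z); apply: ler_sum => l _.
    by rewrite -addn1 PoszD.
  rewrite !mulN1r; apply: le_trans (dn (- n.+1%:Z)); apply: ler_sum => l _.
  by rewrite (_ : - n.+1%:Z + 1 = - n%:Z)// -addn1 PoszD; lia.
case: (intP m) => [|n|n]; rewrite ?abszN.
- by have := H 0%N 1 (or_introl erefl); rewrite mulr0.
- by have := H n.+1 1 (or_introl erefl); rewrite mul1r.
- by have := H n.+1 (-1) (or_intror erefl); rewrite mulN1r.
Qed.

Definition Ga_shift (z : int) : G := MkGa a_gt0 z Ba0.
Definition Ga_trans (b : R) (bP : Ba a b) : G := MkGa a_gt0 0 bP.

Lemma Ga_shiftM (y z : int) : (Ga_shift y * Ga_shift z)%g = Ga_shift (y + z).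
Proof. by apply: Ga_ext; rewrite /= ?mulr0 ?addr0. Qed.

Lemma Ga_transC b c (bP : Ba a b) (cP : Ba a c) : (Ga_trans bP * Ga_trans cP = Ga_trans cP
  * Ga_trans bP)%g.
Proof. by apply: Ga_ext; rewrite /= ?expr0z ?mul1r ?addr0// addrC. Qed.

(** Left multiplication by [g] slides the shifts by [Ga_l g]; the leftover translation is written on
    the right, next to the multiset whose invariance will absorb it. *)
Lemma Ga_shift_trans (g : G) (z : int) :
  (g * Ga_shift z)%g = (Ga_shift (Ga_l g + z) * Ga_trans (BaM (a_gt0 := a_gt0) (- (Ga_l g +
    z)) (Ga_bP g)))%g.
Proof.
apply: Ga_ext; rewrite /= ?mulr0 ?addr0 ?add0r//.
by rewrite mulrA -expfzDr ?gt_eqF// subrr expr0z mul1r.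
Qed.

Lemma Ga_reiter : reiter (R := R) G.
Proof.
apply: reiter_multiset => gs eps e0.
have e20 : 0 < eps / 2 by rewrite divr_gt0.
(* The window length is fixed before the translations, which depend on it: sliding by [Ga_l g] must
   cost at most the fraction [eps / 2], for every [g] in [gs]. *)
pose N := (\sum_(g <- gs) Num.bound (`|Ga_l g|%N%:R / (eps / 2))).+1.
have N0 : 0 < N%:R :> R by rewrite ltr0n.
have Ng g : g \in gs -> `|Ga_l g|%N%:R <= eps / 2 * N%:R.
  move=> gg; rewrite -ler_pdivrMl// mulrC; apply: le_trans (ltW (archi_boundP _)) _.
    by rewrite divr_ge0// ltW.
  rewrite ler_nat; apply: leqW; rewrite (big_rem g)//=; exact: leq_addr.
pose y (g : G) (l : nat) := Ga_trans (BaM (a_gt0 := a_gt0) (- (Ga_l g + l%:Z)) (Ga_bP g)).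
(* All leftover translations, for every [g] and every position in the window: a finite subset of an
   abelian subgroup. *)
pose xs := [seq y g l | g <- gs, l <- iota 0 N].
have [|w w0 hw] := @abelian_reiter R G xs (eps / 2) e20.
  by move=> _ _ /allpairsP[p [_ _ ->]] /allpairsP[q [_ _ ->]]; exact: Ga_transC.
pose w' := flatten [seq [seq (Ga_shift l%:Z * h)%g | h <- w] | l <- iota 0 N].
have sumw' (psi : G -> R) : \sum_(h <- w') psi h = \sum_(0 <= j < N) \sum_(h <- w) psi
  (Ga_shift j%:Z * h)%g.
  rewrite big_flatten big_map /index_iota subn0; apply: eq_bigr => j _.
  by rewrite big_map.
have szw' : (size w')%:R = N%:R * (size w)%:R :> R.
  have := sumw' (fun=> 1); rewrite big_const_seq count_predT iter_addr_0 => ->.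
  rewrite big_const_seq count_predT iter_addr_0 size_iota subn0.
  by rewrite big_const_seq count_predT iter_addr_0 mulr_natl.
exists w'; first by rewrite -(ltr0n R) szw' mulr_gt0// ltr0n.
move=> g gg phi phi01; rewrite big_map !sumw' szw'.
pose s (z : int) := \sum_(h <- w) phi (Ga_shift z * h)%g.
have s01 z : 0 <= s z <= (size w)%:R.
  apply/andP; split; first by apply: sumr_ge0 => h _; have /andP[] := phi01 (Ga_shift z * h)%g.
  apply: le_trans (_ : \sum_(h <- w) 1 <= _);
    last by rewrite big_const_seq count_predT iter_addr_0.
  by apply: ler_sum => h _; have /andP[] := phi01 (Ga_shift z * h)%g.
have step l : (l < N)%N ->
    s (Ga_l g + l%:Z) - \sum_(h <- w) phi (g * (Ga_shift l%:Z * h))%g <= eps / 2 * (size w)%:R.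
  move=> lN; have yx : y g l \in xs by apply: allpairs_f; rewrite ?mem_iota.
  have := hw _ yx (fun h => phi (Ga_shift (Ga_l g + l%:Z) * h)%g) (fun h => phi01 _).
  rewrite big_map; under [X in _ - X <= _]eq_bigr do rewrite mulgA -Ga_shift_trans -mulgA.
  by [].
have h1 := @shift_sum_bound s (size w)%:R (Ga_l g) N s01.
have h2 : \sum_(0 <= l < N) (s (Ga_l g + l%:Z) - \sum_(h <- w) phi (g * (Ga_shift l%:Z * h))%g)
   <= N%:R * (eps / 2 * (size w)%:R).
  rewrite mulr_natl.
  apply: le_trans (_ : \sum_(0 <= j < N) (eps / 2 * (size w)%:R) <= _); last first.
    by rewrite big_const_seq count_predT iter_addr_0 size_iota subn0.
  by rewrite big_nat [leRHS]big_nat; apply: ler_sum => l /andP[_ lN]; exact: step.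
have h3 : `|Ga_l g|%N%:R * (size w)%:R <= eps / 2 * N%:R * (size w)%:R :> R.
  by rewrite ler_wpM2r// Ng.
rewrite -sumrB; apply: le_trans (_ : 
   \sum_(0 <= l < N) (s l%:Z - s (Ga_l g + l%:Z)) +
   \sum_(0 <= l < N) (s (Ga_l g + l%:Z) - \sum_(h <- w) phi (g * (Ga_shift l%:Z * h))%g) <= _).
  by rewrite -big_split/=; apply: ler_sum => l _; rewrite addrA subrK.
by move: h1 h2 h3; set X := (size w)%:R; set Y := N%:R => h1 h2 h3; nra.
Qed.

End ReiterGa.

(** * The regular representation of the C*-algebra *)

Section RegularRepresentation.
Context {R : realType} (G : groupType) (A : cstarType R) (u : G -> A).
Local Notation C := R[i].
Local Notation ell2 := (ell2 (R := R) G).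
Hypothesis Au : group_cstar u.
Implicit Types (s t : seq (C * G)) (x y : A) (f g : ell2).

Definition alg_elt s : A := \sum_(p <- s) p.1 *: u p.2.
Let lam s f : ell2 := rep_alg (@left_regular R G) s f.

Lemma cmulDl x y z : cmul (x + y) z = cmul x z + cmul y z :> A.
Proof. by have := cmul_linearl 1 x y z; rewrite !scale1r. Qed.

Lemma cmul0l z : cmul 0 z = 0 :> A.
Proof. by apply: (addrI (cmul 0 z)); rewrite -cmulDl !addr0. Qed.

Lemma cmulZl (c : C) x z : cmul (c *: x) z = c *: cmul x z :> A.
Proof. by have := cmul_linearl c x 0 z; rewrite cmul0l !addr0. Qed.

Lemma cmulDr x y z : cmul z (x + y) = cmul z x + cmul z y :> A.
Proof. by have := cmul_linearr 1 x y z; rewrite !scale1r. Qed.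

Lemma cmul0r z : cmul z 0 = 0 :> A.
Proof. by apply: (addrI (cmul z 0)); rewrite -cmulDr !addr0. Qed.

Lemma cmulZr (c : C) x z : cmul z (c *: x) = c *: cmul z x :> A.
Proof. by have := cmul_linearr c x 0 z; rewrite cmul0r !addr0. Qed.

Lemma cmulBl x y z : cmul (x - y) z = cmul x z - cmul y z :> A.
Proof. by rewrite cmulDl -scaleN1r cmulZl scaleN1r. Qed.

Lemma cmulBr x y z : cmul z (x - y) = cmul z x - cmul z y :> A.
Proof. by rewrite cmulDr -scaleN1r cmulZr scaleN1r. Qed.

Lemma cstarD x y : cstar (x + y) = cstar x + cstar y :> A.
Proof. by have := cstar_conj_linear 1 x y; rewrite rmorph1 !scale1r. Qed.

Lemma cstar0 : cstar 0 = 0 :> A.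
Proof. by apply: (addrI (cstar 0)); rewrite -cstarD !addr0. Qed.

Lemma cstarZ (c : C) x : cstar (c *: x) = c^* *: cstar x :> A.
Proof. by have := cstar_conj_linear c x 0; rewrite cstar0 !addr0. Qed.

Lemma cstarB x y : cstar (x - y) = cstar x - cstar y :> A.
Proof. by rewrite cstarD -scaleN1r cstarZ rmorphN1 scaleN1r. Qed.

Lemma nrm_cmul x y : nrm (cmul x y) <= nrm x * nrm y.
Proof. by rewrite -lecR rmorphM /= -!nrmE; exact: norm_cmul_le. Qed.

Lemma nrm_cstar x : nrm (cstar x) = nrm x.
Proof.
have h (y : A) : nrm y <= nrm (cstar y).
  have [->|yn0] := eqVneq (nrm y) 0; first exact: nrm_ge0.
  have yp : 0 < nrm y by rewrite lt_def yn0 nrm_ge0.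
  rewrite -(ler_pM2r yp) -expr2; apply: le_trans (nrm_cmul _ _).
  by rewrite -lecR rmorphXn /= -!nrmE -norm_cstar_cmul.
by apply/eqP; rewrite eq_le h -{2}(cstarK x) h.
Qed.

Lemma alg_elt_nil : alg_elt [::] = 0. Proof. exact: big_nil. Qed.

Lemma alg_elt_lin (c : C) s t :
  alg_elt ([seq (c * p.1, p.2) | p <- s] ++ t) = c *: alg_elt s + alg_elt t.
Proof.
rewrite /alg_elt big_cat big_map scaler_sumr; congr (_ + _).
by apply: eq_bigr => p _; rewrite scalerA.
Qed.

Lemma rep_alg_lin (c : C) s t f :
  lam ([seq (c * p.1, p.2) | p <- s] ++ t) f = c *: lam s f + lam t f.
Proof.
rewrite /lam /rep_alg big_cat big_map scaler_sumr; congr (_ + _).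
by apply: eq_bigr => p _; rewrite scalerA.
Qed.

Lemma nrm_alg_elt s : nrm (alg_elt s) = max_norm s.
Proof. by apply: complexI; rewrite -nrmE (gcs_norm Au). Qed.

Lemma lam_nrm s f : nrm (lam s f) <= nrm (alg_elt s) * nrm f.
Proof. by rewrite nrm_alg_elt; apply: rep_alg_max_norm; exact: left_regular_urep. Qed.

Lemma lam_sub_nrm s t f : nrm (lam s f - lam t f) <= nrm (alg_elt s - alg_elt t) * nrm f.
Proof.
have := lam_nrm ([seq (- 1 * p.1, p.2) | p <- t] ++ s) f.
by rewrite rep_alg_lin alg_elt_lin !scaleN1r !(addrC (- _)).
Qed.

Lemma alg_elt_approx x (e : R) : 0 < e -> exists s, nrm (x - alg_elt s) < e.
Proof.
move=> e0; have /nrm_dense/(_ x e e0) [_ [s [su ->]] xs] := gcs_dense Au.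
have /choice[v vP] : forall p : C * A, exists g : G, range u p.2 -> u g = p.2.
  move=> p; have [[g _ gp]|np] := pselect (range u p.2); first by exists g.
  by exists 1%g.
exists [seq (p.1, v p) | p <- s]; rewrite /alg_elt big_map.
rewrite (_ : \sum_(p <- s) _ = \sum_(p <- s) p.1 *: p.2)//.
by apply: eq_big_seq => p ps /=; rewrite vP//; exact: su.
Qed.

(** Extension by continuity from the group algebra. The estimate against every [s], not only along
    the approximating sequence, makes the limit independent of that sequence, and all later
    identities are read off from it. *)
Lemma regular_ext_exists x f : exists w : ell2, forall s,
  nrm (w - lam s f) <= nrm (x - alg_elt s) * nrm f.
Proof.
have /choice[S SP] : forall n : nat, exists s, nrm (x - alg_elt s) < n.+1%:R^-1.
  by move=> n; apply: alg_elt_approx; rewrite invr_gt0.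
have [||l lP] := @nrm_cauchy_cvg _ _ (fun n => lam (S n) f) (fun n => 2 * nrm f * n.+1%:R^-1).
- move=> n m nm; apply: le_trans (lam_sub_nrm _ _ _) _.
  rewrite mulrAC ler_wpM2r ?nrm_ge0//.
  apply: le_trans (nrm_distD x _ _) _; rewrite nrm_distC mulr_natl mulr2n.
  apply: lerD; first exact: ltW.
  by apply: le_trans (ltW (SP m)) _; rewrite lef_pV2 ?posrE// ler_nat.
- rewrite -[X in _ --> X](mulr0 (2 * nrm f)); apply: cvgMr; exact: cvg_harmonic.
exists l => s; apply/ler_addgt0Pr => e e0.
(* Two of the three parts bound the distance to the limit, the third the error of the [n]-th
   approximant of [x]. *)
have [n ne] : exists n : nat, 3 * nrm f * n.+1%:R^-1 <= e.
  exists (Num.bound (3 * nrm f / e)); rewrite ler_pdivrMr// [leRHS]mulrC -ler_pdivrMr//.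
  apply: le_trans (ltW (archi_boundP _)) _; last by rewrite ler_nat.
  by rewrite divr_ge0 ?mulr_ge0 ?nrm_ge0// ltW.
apply: le_trans (nrm_distD (lam (S n) f) _ _) _; rewrite nrm_distC.
have h1 := lP n; have h2 := lam_sub_nrm (S n) s f.
have h3 : nrm (alg_elt (S n) - alg_elt s) * nrm f <= (n.+1%:R^-1 + nrm (x - alg_elt s)) * nrm f.
  rewrite ler_wpM2r ?nrm_ge0//; apply: le_trans (nrm_distD x _ _) _.
  by rewrite lerD2r nrm_distC ltW.
move: ne h1 h2 h3; rewrite mulrDl; set k := n.+1%:R^-1; lra.
Qed.

Definition regular_ext x f : ell2 := sval (cid (regular_ext_exists x f)).
Local Notation rho := regular_ext.

Lemma regular_extP x f s : nrm (rho x f - lam s f) <= nrm (x - alg_elt s) * nrm f.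
Proof. exact: (svalP (cid (regular_ext_exists x f))). Qed.

Lemma regular_ext_alg s f : rho (alg_elt s) f = lam s f.
Proof.
by apply: nrm_eps => e e0; apply: le_trans (regular_extP _ _ _) _; rewrite subrr nrm0 mul0r ltW.
Qed.

Lemma regular_ext_gen (h : G) f : rho (u h) f = left_regular h f.
Proof.
have -> : u h = alg_elt [:: (1, h)] by rewrite /alg_elt big_seq1 scale1r.
by rewrite regular_ext_alg /lam /rep_alg big_seq1 scale1r.
Qed.

Lemma regular_ext_nrm x f : nrm (rho x f) <= nrm x * nrm f.
Proof.
by have := regular_extP x f [::]; rewrite alg_elt_nil /lam /rep_alg big_nil !subr0.
Qed.

(** [K] may depend on the two vectors but not on [s]; density then makes the right side arbitrarily
    small. *)
Lemma eq_of_alg_elt_approx x (v w : ell2) (K : R) :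
  (forall s, nrm (v - w) <= K * nrm (x - alg_elt s)) -> v = w.
Proof.
move=> h; apply: nrm_eps => e e0.
have K1 : 0 < `|K| + 1 by rewrite ltr_wpDl.
have [s xs] := alg_elt_approx x (divr_gt0 e0 K1).
apply: le_trans (h s) _.
have : `|K| * nrm (x - alg_elt s) <= (`|K| + 1) * (e / (`|K| + 1)).
  by rewrite ler_pM ?nrm_ge0 ?lerDl// ltW.
rewrite [leRHS]mulrC divfK ?lt0r_neq0// => h2; apply: le_trans h2.
by rewrite ler_wpM2r ?nrm_ge0// ler_norm.
Qed.

Let lam_lin s (c : C) f g : lam s (c *: f + g) = c *: lam s f + lam s g.
Proof.
rewrite /lam /rep_alg scaler_sumr -big_split; apply: eq_bigr => p _ /=.
by rewrite (urep_linear (left_regular_urep G)) scalerDr !scalerA mulrC.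
Qed.

Lemma regular_ext_linear x : linear (rho x).
Proof.
move=> c f g; apply: (@eq_of_alg_elt_approx x _ _ (nrm (c *: f + g) + nrm c * nrm f + nrm
  g)) => s.
have := regular_extP x (c *: f + g) s; have := regular_extP x f s; have := regular_extP x g s.
rewrite lam_lin => hg hf hfg.
have -> : rho x (c *: f + g) - (c *: rho x f + rho x g) =
   (rho x (c *: f + g) - (c *: lam s f + lam s g)) - (c *: (rho x f - lam s f) + (rho x g -
     lam s g)).
  by rewrite scalerBr; apply: ell2_ext => i; rewrite !(ell2D, ell2N, ell2Z); ring.
apply: le_trans (ler_nrmD _ _) _; rewrite nrmN.
have hB := ler_nrmD (c *: (rho x f - lam s f)) (rho x g - lam s g); rewrite nrmZ in hB.
have hc := ler_wpM2l (nrm_ge0 c) hf.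
lra.
Qed.

Lemma regular_ext_lin (c : C) x y f : rho (c *: x + y) f = c *: rho x f + rho y f.
Proof.
apply: nrm_eps => e e0.
(* Two errors of size [(|c| + 1) (e / K) |f|] occur; the [+ 1] keeps [K] positive when [f = 0]. *)
pose K := (nrm c * 2 + 2) * nrm f + 1.
have K0 : 0 < K by rewrite ltr_wpDl// mulr_ge0 ?nrm_ge0// addr_ge0// mulr_ge0 ?nrm_ge0.
have d0 : 0 < e / K by rewrite divr_gt0.
have [s /ltW xs] := alg_elt_approx x d0; have [t /ltW yt] := alg_elt_approx y d0.
set st := [seq (c * p.1, p.2) | p <- s] ++ t.
have := regular_extP (c *: x + y) f st; have := regular_extP x f s; have := regular_extP y f t.
rewrite rep_alg_lin alg_elt_lin => hy hx hxy.
have -> : rho (c *: x + y) f - (c *: rho x f + rho y f) =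
   (rho (c *: x + y) f - (c *: lam s f + lam t f)) - (c *: (rho x f - lam s f) + (rho y f -
     lam t f)).
  by rewrite scalerBr; apply: ell2_ext => i; rewrite !(ell2D, ell2N, ell2Z); ring.
have hxy' : nrm (c *: x + y - (c *: alg_elt s + alg_elt t)) <= (nrm c + 1) * (e / K).
  have -> : c *: x + y - (c *: alg_elt s + alg_elt t) = c *: (x - alg_elt s) + (y - alg_elt t).
    by rewrite scalerBr opprD addrACA.
  apply: le_trans (ler_nrmD _ _) _; rewrite nrmZ mulrDl mul1r lerD// ler_wpM2l ?nrm_ge0//.
apply: le_trans (ler_nrmD _ _) _; rewrite nrmN.
apply: le_trans (_ : (nrm c + 1) * (e / K) * nrm f + (nrm c + 1) * (e / K) * nrm f <= _).
  apply: lerD; first by apply: le_trans hxy _; rewrite ler_wpM2r ?nrm_ge0.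
  apply: le_trans (ler_nrmD _ _) _; rewrite nrmZ !mulrDl mul1r lerD//.
    rewrite -mulrA ler_wpM2l ?nrm_ge0//; apply: le_trans hx _; rewrite ler_wpM2r ?nrm_ge0//.
  by apply: le_trans hy _; rewrite ler_wpM2r ?nrm_ge0.
have -> : (nrm c + 1) * (e / K) * nrm f + (nrm c + 1) * (e / K) * nrm f = e / K * (K - 1)
  by rewrite /K; ring.
rewrite -[leRHS](divfK (lt0r_neq0 K0)) ler_wpM2l ?(ltW d0)//; lra.
Qed.

Lemma regular_ext_subl x y f : rho (x - y) f = rho x f - rho y f.
Proof. by have := regular_ext_lin (-1) y x f; rewrite !scaleN1r !(addrC (- _)). Qed.

Lemma regular_ext_subr x f g : rho x (f - g) = rho x f - rho x g.
Proof. by have := regular_ext_linear x (-1) g f; rewrite !scaleN1r !(addrC (- _)). Qed.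

Lemma regular_ext_sumr x (I : Type) (r : seq I) (c : I -> C) (F : I -> ell2) :
  rho x (\sum_(i <- r) c i *: F i) = \sum_(i <- r) c i *: rho x (F i).
Proof.
elim: r => [|i r IH].
  by rewrite !big_nil -(subrr (0 : ell2)) regular_ext_subr !subrr.
by rewrite !big_cons regular_ext_linear IH.
Qed.

Lemma regular_ext_suml (I : Type) (r : seq I) (c : I -> C) (F : I -> A) f :
  rho (\sum_(i <- r) c i *: F i) f = \sum_(i <- r) c i *: rho (F i) f.
Proof.
elim: r => [|i r IH].
  by rewrite !big_nil -(subrr (0 : A)) regular_ext_subl !subrr.
by rewrite !big_cons regular_ext_lin IH.
Qed.

Lemma cmul_suml (I : Type) (r : seq I) (c : I -> C) (F : I -> A) y :
  cmul (\sum_(i <- r) c i *: F i) y = \sum_(i <- r) c i *: cmul (F i) y.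
Proof. by elim: r => [|i r IH]; rewrite ?big_nil ?cmul0l// !big_cons cmul_linearl IH. Qed.

Lemma cmul_sumr (I : Type) (r : seq I) (c : I -> C) (F : I -> A) y :
  cmul y (\sum_(i <- r) c i *: F i) = \sum_(i <- r) c i *: cmul y (F i).
Proof. by elim: r => [|i r IH]; rewrite ?big_nil ?cmul0r// !big_cons cmul_linearr IH. Qed.

Let mul_gen_alg h t f : rho (cmul (u h) (alg_elt t)) f = left_regular h (rho (alg_elt t) f).
Proof.
rewrite /alg_elt cmul_sumr !regular_ext_suml -[RHS]regular_ext_gen regular_ext_sumr.
by apply: eq_bigr => p _; rewrite -(gcs_mul Au) !regular_ext_gen left_regularM.
Qed.

Let mul_gen h y f : rho (cmul (u h) y) f = left_regular h (rho y f).
Proof.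
apply: (@eq_of_alg_elt_approx y _ _ ((nrm (u h) + 1) * nrm f)) => t.
rewrite -[rho (cmul _ _) f](subrK (rho (cmul (u h) (alg_elt t)) f)) -regular_ext_subl -cmulBr.
rewrite mul_gen_alg -addrA -[X in _ + X]opprB.
have -> : left_regular h (rho y f) - left_regular h (rho (alg_elt t) f) =
  left_regular h (rho y f - rho (alg_elt t) f) by rewrite left_regularB.
apply: le_trans (ler_nrmD _ _) _; rewrite nrmN (urep_nrm (left_regular_urep G)) -regular_ext_subl.
rewrite mulrDl mul1r mulrDl lerD//; last by rewrite mulrC regular_ext_nrm.
apply: le_trans (regular_ext_nrm _ _) _; rewrite mulrAC ler_wpM2r ?nrm_ge0//.
exact: nrm_cmul.
Qed.

(** The identity is first known for [x] a generator and [y] in the group algebra; density extends it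
    to all [y], linearity to [x] in the group algebra, and density again to all [x]. *)
Lemma regular_ext_mul x y f : rho (cmul x y) f = rho x (rho y f).
Proof.
apply: (@eq_of_alg_elt_approx x _ _ (nrm y * nrm f * 2)) => s.
rewrite -[rho (cmul _ _) f](subrK (rho (cmul (alg_elt s) y) f)) -regular_ext_subl -cmulBl.
have -> : rho (cmul (alg_elt s) y) f = rho (alg_elt s) (rho y f).
  rewrite /alg_elt cmul_suml !regular_ext_suml; apply: eq_bigr => p _.
  by rewrite mul_gen regular_ext_gen.
rewrite -addrA -[X in _ + X]opprB -regular_ext_subl; apply: le_trans (ler_nrmD _ _) _;
  rewrite nrmN.
have h1 : nrm (rho (cmul (x - alg_elt s) y) f) <= nrm y * nrm f * nrm (x - alg_elt s).
  apply: le_trans (regular_ext_nrm _ _) _; rewrite mulrAC ler_wpM2r ?nrm_ge0// mulrC.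
  exact: nrm_cmul.
have h2 : nrm (rho (x - alg_elt s) (rho y f)) <= nrm y * nrm f * nrm (x - alg_elt s).
  apply: le_trans (regular_ext_nrm _ _) _; rewrite mulrC ler_wpM2r ?nrm_ge0//.
  exact: regular_ext_nrm.
lra.
Qed.

Lemma left_regular_adj (h : G) f g : hdot (left_regular h f) g = hdot f (left_regular h^-1%g g).
Proof. by rewrite -[RHS](left_regular_dot h) -left_regularM mulgV left_regular1. Qed.

Lemma regular_ext_star x f g : hdot (rho x f) g = hdot f (rho (cstar x) g).
Proof.
apply: nrm_eps => e e0.
pose K := 2 * (nrm f * nrm g) + 1.
have K0 : 0 < K by rewrite ltr_wpDl// !mulr_ge0 ?nrm_ge0.
have [s /ltW xs] := alg_elt_approx x (divr_gt0 e0 K0).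
have alg : hdot (rho (alg_elt s) f) g = hdot f (rho (cstar (alg_elt s)) g).
  have -> : cstar (alg_elt s) = \sum_(p <- s) p.1^* *: u (p.2^-1)%g.
    rewrite /alg_elt; elim: (s) => [|p r IH]; first by rewrite !big_nil cstar0.
    by rewrite !big_cons cstar_conj_linear IH (gcs_star Au).
  rewrite /alg_elt !regular_ext_suml hdot_suml hdot_sumr; apply: eq_bigr => p _.
  by rewrite hdotZl hdotZr conjCK !regular_ext_gen left_regular_adj.
have -> : hdot (rho x f) g - hdot f (rho (cstar x) g) =
  hdot (rho (x - alg_elt s) f) g - hdot f (rho (cstar (x - alg_elt s)) g).
  by rewrite cstarB !regular_ext_subl hdotBl hdotBr alg; ring.
have h1 : nrm (hdot (rho (x - alg_elt s) f) g) <= e / K * (nrm f * nrm g).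
  apply: le_trans (hdot_CauchySchwarz _ _) _; rewrite mulrA ler_wpM2r ?nrm_ge0//.
  by apply: le_trans (regular_ext_nrm _ _) _; rewrite ler_wpM2r ?nrm_ge0.
have h2 : nrm (hdot f (rho (cstar (x - alg_elt s)) g)) <= e / K * (nrm f * nrm g).
  apply: le_trans (hdot_CauchySchwarz _ _) _; rewrite mulrCA ler_wpM2l ?nrm_ge0//.
  by apply: le_trans (regular_ext_nrm _ _) _; rewrite nrm_cstar ler_wpM2r ?nrm_ge0.
apply: le_trans (ler_nrmD _ _) _; rewrite nrmN.
have : e / K * (2 * (nrm f * nrm g)) <= e / K * K
  by rewrite ler_wpM2l ?divr_ge0 ?(ltW e0) ?(ltW K0)// /K lerDl.
rewrite divfK ?lt0r_neq0//; lra.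
Qed.

Lemma regular_ext_rep : representation regular_ext.
Proof.
split.
- move=> x; apply: (@linear_bounded_operator _ _ _ _ (nrm x)); first exact: regular_ext_linear.
  by move=> f; exact: regular_ext_nrm.
- exact: regular_ext_lin.
- exact: regular_ext_mul.
- by move=> f; rewrite -(gcs_one Au) regular_ext_gen left_regular1.
- exact: regular_ext_star.
Qed.

(** An algebra element close to [x - y] acts on [l^2] with small norm; by amenability its maximal
    norm, which is its norm in [A], is just as small. *)
Lemma regular_ext_inj : reiter (R := R) G -> injective regular_ext.
Proof.
move=> rG x y xy; apply/eqP; rewrite -subr_eq0; apply/eqP/nrm0_eq0/eqP.
rewrite eq_le nrm_ge0 andbT; apply/ler_addgt0Pr => e e0; rewrite add0r.
have e20 : 0 < e / 2 by rewrite divr_gt0.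
have [s /ltW xs] := alg_elt_approx (x - y) e20.
have : nrm (alg_elt s) <= e / 2.
  rewrite nrm_alg_elt; apply: max_norm_regular => // [|f]; first exact: ltW.
  have := regular_extP (x - y) f s; rewrite regular_ext_subl xy subrr sub0r nrmN.
  by move=> h; apply: le_trans h _; rewrite ler_wpM2r ?nrm_ge0.
have := ler_nrmD (x - y - alg_elt s) (alg_elt s); rewrite subrK; lra.
Qed.

End RegularRepresentation.

(** * Diagonal operators *)

Section DiagonalOperators.
Context {R : realType} {I : choiceType}.
Local Notation C := R[i].
Local Notation ell2 := (@ell2 R I).
Implicit Types (f g : ell2) (m k : I -> R).

Lemma square_summable_ell2 (h : I -> C) (f : ell2) : (forall i, h i = f i) -> square_summable h.
Proof. by move=> hf; rewrite (_ : h = f)//; [exact: ell2_summable|exact/funext]. Qed.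

Definition diag_dom m : set ell2 := [set f | square_summable (diag_fun m f)].

Lemma diag_dom_subspace m : linear_subspace (diag_dom m).
Proof.
split=> [|c f g Df Dg].
  by apply: (@square_summable_ell2 _ 0) => i; rewrite /diag_fun ell20 mulr0.
apply: (@square_summable_ell2 _ (c *: diag m f + diag m g)) => i.
by rewrite ell2D ell2Z !diagE// /diag_fun ell2D ell2Z; ring.
Qed.

Lemma diag_dom_linear m (c : C) f g : diag_dom m f -> diag_dom m g ->
  diag m (c *: f + g) = c *: diag m f + diag m g.
Proof.
move=> Df Dg; apply: ell2_ext => i; rewrite diagE; last exact: (diag_dom_subspace m).2.
by rewrite !ell2D !ell2Z !diagE//; ring.
Qed.

Definition diag_op m : unbounded_operator ell2 :=
  UnboundedOperator (diag_dom_subspace m) (@diag_dom_linear m).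

Lemma diag_dom_delta m i : diag_dom m (delta i).
Proof.
apply: (@square_summable_ell2 _ ((m i)%:C%C *: delta i)) => j.
rewrite ell2Z /diag_fun !deltaE; case: eqP => [->//|_]; by rewrite !mulr0.
Qed.

Lemma diag_delta m i : diag m (delta i) = (m i)%:C%C *: delta i.
Proof.
apply: ell2_ext => j; rewrite diagE; last exact: diag_dom_delta.
rewrite ell2Z !deltaE; case: eqP => [->//|_]; by rewrite !mulr0.
Qed.

Lemma diag_symmetric m f g : diag_dom m f -> diag_dom m g ->
  hdot (diag m f) g = hdot f (diag m g).
Proof.
move=> Df Dg; rewrite /hdot /= /ell2_dot; congr csum; apply/funext => i.
by rewrite !diagE// rmorphM/= conj_real; ring.
Qed.

(** The domain is the maximal one. Testing the adjoint relation on the [delta i] forces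
    [m i * f i = g i] at every [i], so [f] lies in it. *)
Lemma diag_op_self_adjoint m : self_adjoint (diag_op m).
Proof.
split.
  have [_ /nrm_dense dB] := @delta_basis R I.
  apply/nrm_dense => f e e0; have [g [s [sX ->]] fg] := dB f e e0.
  exists (\sum_(p <- s) p.1 *: p.2) => //=.
  rewrite big_seq; elim/big_ind: _ => [|x y Dx Dy|p /sX [i _ <-]].
  - exact: (diag_dom_subspace m).1.
  - by rewrite -[x]scale1r; exact: (diag_dom_subspace m).2.
  - rewrite -[_ *: _]addr0; apply: (diag_dom_subspace m).2; last exact: (diag_dom_subspace m).1.
    exact: diag_dom_delta.
move=> f g; split=> [fg|[Df ->] h Dh]; last exact: diag_symmetric.
have fgi i : (m i)%:C%C * f i = g i.
  have := fg _ (diag_dom_delta m i); rewrite /= diag_delta hdotZl => h.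
  have : (m i)%:C%C * hdot f (delta i) = hdot g (delta i).
    by rewrite hdot_conj [RHS]hdot_conj -h rmorphM/= conj_real.
  by rewrite !hdot_delta.
have Df : diag_dom m f by apply: (@square_summable_ell2 _ g).
by split=> //; apply: ell2_ext => i /=; rewrite diagE// fgi.
Qed.

Lemma diag_dot m f : (forall i, 0 <= m i) -> diag_dom m f ->
  hdot (diag m f) f = (fine (\esum_(i in setT) (m i * sqmod (f i))%:E))%:C%C /\
  (\esum_(i in setT) (m i * sqmod (f i))%:E < +oo)%E.
Proof.
move=> m0 Df; set z := fun i => (diag m f) i * (f i)^*.
have zE i : z i = (m i * sqmod (f i))%:C%C.
  by rewrite /z diagE// rmorphM /= sqmodE normCK mulrA.
have fin : (\esum_(i in setT) (m i * sqmod (f i))%:E < +oo)%E.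
  have [h _] := ell2_csummable (diag m f) f; apply: le_lt_trans h.
  by apply: le_esum => i _; rewrite lee_fin -/(z i) zE /= ler_norm.
split=> //; rewrite /hdot /= /ell2_dot -/z (_ : z = fun i => (m i * sqmod (f i))%:C%C);
  last exact/funext.
rewrite /csum rsum_ge0E//=; last by move=> i; rewrite mulr_ge0 ?sqmod_ge0.
congr Complex; rewrite -[RHS](subrr (fine 0)); congr (fine _ - fine _).
  by apply: esum1 => i _; rewrite maxxx.
by apply: esum1 => i _; rewrite oppr0 maxxx.
Qed.

Lemma diag_domb m f (M : R) : (forall i, `|m i| <= M) -> diag_dom m f.
Proof. exact: diag_fun_summable. Qed.

(** The multipliers [r], [m r] and [m^2 r] are all bounded by 1, so [diag r] maps into the domain of
    the square. *)
Lemma diag_resolvent m :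
  inverse_1addD2 (diag_op m) (diag (fun i => (1 + m i ^+ 2)^-1)).
Proof.
set r := fun i => _.
have mp i : 0 < 1 + m i ^+ 2 by rewrite ltr_pwDl// sqr_ge0.
have r1 i : `|r i| <= 1.
  by rewrite ger0_norm ?invr_ge0 ?(ltW (mp i))// invf_le1// lerDl sqr_ge0.
have mr1 i : `|m i * r i| <= 1.
  rewrite normrM [`|r i|]gtr0_norm ?invr_gt0// ler_pdivrMr// mul1r.
  by have := sqr_ge0 (`|m i| - 1); have := real_normK (num_real (m i));
    rewrite sqrrB => ->; have := normr_ge0 (m i); lra.
have mmr1 i : `|m i * (m i * r i)| <= 1.
  rewrite mulrA -expr2 normrM [`|r i|]gtr0_norm ?invr_gt0// ler_pdivrMr// mul1r.
  by rewrite ger0_norm ?sqr_ge0// lerDr.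
have D1 f : diag_dom m (diag r f).
  apply: (@square_summable_ell2 _ (diag (fun i => m i * r i) f)) => i.
  by rewrite (diagEb _ _ mr1) /diag_fun (diagEb _ _ r1) rmorphM mulrA.
have D2 f : diag_dom m (diag m (diag r f)).
  apply: (@square_summable_ell2 _ (diag (fun i => m i * (m i * r i)) f)) => i.
  by rewrite (diagEb _ _ mmr1) /diag_fun (diagE _ (D1 f)) (diagEb _ _ r1) !rmorphM !mulrA.
have rK i : r i * (1 + m i ^+ 2) = 1 by rewrite mulVf// lt0r_neq0.
split=> [f|f Df DDf].
  split; [exact: D1|exact: D2|].
  change (diag r f + diag m (diag m (diag r f)) = f); apply: ell2_ext => i.
  rewrite ell2D (diagE _ (D2 f)) (diagE _ (D1 f)) (diagEb _ _ r1).
  rewrite !mulrA -mulrDl -!rmorphM -rmorphD /=.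
  by rewrite (_ : r i + m i * m i * r i = 1) ?mul1r// -(rK i); ring.
change (diag r (f + diag m (diag m f)) = f); apply: ell2_ext => i.
rewrite (diagEb _ _ r1) ell2D (diagE _ DDf) (diagE _ Df).
rewrite mulrDr !mulrA -mulrDl -!rmorphM -rmorphD /=.
by rewrite (_ : r i + r i * m i * m i = 1) ?mul1r// -(rK i); ring.
Qed.

End DiagonalOperators.

(** * Compactness of diagonal operators *)

Section CompactDiagonal.
Context {R : realType} {I : choiceType}.
Local Notation C := R[i].
Local Notation ell2 := (@ell2 R I).

Lemma ultra_fmap (T U : Type) (f : T -> U) (F : set_system T) :
  UltraFilter F -> UltraFilter (f @ F).
Proof.
move=> FU; have FP : ProperFilter F by exact: ultra_proper.
split; first exact: fmap_proper_filter.
move=> G GP FG; apply/seteqP; split=> // A GA.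
have [//|nA] := in_ultra_setVsetC (f @^-1` A) FU.
have GnA : G (~` A) by apply: FG.
by case: (@filter_not_empty _ G GP); rewrite -(setICr A); exact: filterI.
Qed.

Lemma bounded_ultra_cvg (T : Type) (F : set_system T) (h : T -> R) (a b : R) :
  UltraFilter F -> (\forall x \near F, a <= h x <= b) -> exists l : R, h @ F --> l.
Proof.
move=> FU hb; have := @segment_compact R a b; rewrite compact_ultra.
move=> /(_ (h @ F) (ultra_fmap h FU)) [].
  by apply: filterS hb => x; rewrite /= in_itv.
by move=> l [_ hl]; exists l.
Qed.

(** Weak compactness of the unit ball, by ultrafilters: preimages in the ball converge
    coordinatewise to some [V] of the ball, and multipliers that vanish at infinity turn this into
    norm convergence of the images. The image of the ball is thus already compact, hence closed. *)
Lemma diag_compact (k : I -> R) (M : R) : (forall i, `|k i| <= M) ->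
  (forall e : R, 0 < e -> exists s : seq I, forall i, i \notin s -> `|k i| <= e) ->
  compact_operator (diag (I := I) k).
Proof.
move=> kM k0; split; first exact: diag_linear kM.
set U := [set v : ell2 | `|v| <= 1].
have Un (v : ell2) : U v <-> nrm v <= 1 by rewrite /U /= nrmE -lecR.
suff cKU : compact (diag k @` U).
  by rewrite -(closure_id _).1//; apply: compact_closed => //; exact: norm_hausdorff.
rewrite compact_ultra => F FU FK.
have FP : ProperFilter F by exact: ultra_proper.
have /choice[c cP] : forall f : ell2, exists v : ell2, (diag k @` U) f -> U v /\ diag k v = f.
  move=> f; have [[v Uv vf]|nf] := pselect ((diag k @` U) f); first by exists v.
  by exists 0.
have cU : \forall f \near F, nrm (c f) <= 1.
  by apply: filterS FK => f /cP[/Un].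
have bd (p : C -> R) i : (forall z, `|p z| <= nrm z) ->
  exists l : R, (fun f => p (c f i)) @ F --> l.
  move=> pz; apply: (@bounded_ultra_cvg _ _ _ (-1) 1) => //; apply: filterS cU => f cf.
  rewrite -ler_norml; apply: le_trans (pz _) _; exact: le_trans (ell2_coord_le _ _) cf.
have reP z : `|complex.Re z| <= nrm (z : C).
  by rewrite -lecR -nrmE normc_ge_Re.
have imP z : `|complex.Im z| <= nrm (z : C).
  rewrite -ler_sqr ?nnegrE// real_normK ?num_real//.
  by rewrite -sqmod_nrm /sqmod lerDr sqr_ge0.
have /choice[re reL] := fun i => bd _ i reP.
have /choice[im imL] := fun i => bd _ i imP.
pose v i : C := (re i +i* im i)%C.
have sqL i (w : C) : (fun f => sqmod (c f i - w)) @ F --> sqmod (v i - w).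
  have E z : sqmod (z - w) = (complex.Re z - complex.Re w) * (complex.Re z - complex.Re w)
     + (complex.Im z - complex.Im w) * (complex.Im z - complex.Im w).
    by case: (z) (w) => a b [d e]; rewrite /sqmod /= !expr2.
  rewrite E; under eq_fun do rewrite E.
  apply: cvgD; apply: cvgM; apply: cvgB; try exact: cvg_cst.
  - exact: reL. - exact: reL. - exact: imL. - exact: imL.
have sumL (s : seq I) (q : I -> R) (w : I -> C) :
    (fun f => \sum_(i <- s) q i * sqmod (c f i - w i)) @ F --> \sum_(i <- s) q i * sqmod (v
      i - w i).
  elim: s => [|i s IH].
    by rewrite big_nil; under eq_fun do rewrite big_nil; exact: cvg_cst.
  rewrite big_cons; under eq_fun do rewrite big_cons.
  by apply: cvgD => //; apply: cvgM; [exact: cvg_cst|exact: sqL].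
have v1 (s : seq I) : uniq s -> \sum_(i <- s) nrm (v i) ^+ 2 <= 1.
  move=> us; have := sumL s (fun=> 1) (fun=> 0).
  rewrite (eq_bigr (fun i => nrm (v i) ^+ 2)); last by move=> i _; rewrite mul1r subr0 sqmod_nrm.
  move=> /cvgr_to_le; apply; apply: filterS cU => f cf.
  rewrite (eq_bigr (fun i => nrm (c f i) ^+ 2)); last by move=> i _;
    rewrite mul1r subr0 sqmod_nrm.
  by apply: le_trans (ell2_sum_le _ us) _; rewrite expr_le1// nrm_ge0.
have vP : v \in @ell2_pred R I by rewrite inE /=; exact: square_summable_le v1.
pose V : ell2 := Ell2 vP.
have VU : nrm V <= 1 by apply/ell2_nrm_le => // s us; rewrite expr1n; exact: v1.
exists (diag k V); split; first by exists V => //; exact/Un.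
apply/cvgrPdist_lt => _ /gt0_RRe[e e0 ->].
(* Off [s] the multiplier is at most [e / 4] and two vectors of the ball differ by at most 2, a
   squared error of [e^2 / 4]. The finitely many coordinates in [s] contribute as much, and
   [e^2 / 2 <= (3 e / 4)^2]. *)
have e3 : 0 < e / 4 by rewrite divr_gt0.
have [s0 hs] := k0 _ e3.
pose s := undup s0.
have := sumL s (fun i => k i ^+ 2) v.
rewrite [X in _ --> X]big1; last by move=> i _; rewrite subrr sqmod_nrm nrm0 expr0n mulr0.
move=> /cvgrPdist_lt/(_ (e ^+ 2 / 4)) hF.
have {}hF := hF ltac:(by rewrite divr_gt0// exprn_gt0).
near=> f.
have fK : (diag k @` U) f by near: f.
have [/Un cf1 cfE] := cP f fK.
rewrite nrmE ltcR -cfE.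
have : `|0 - \sum_(i <- s) k i ^+ 2 * sqmod (c f i - v i)| < e ^+ 2 / 4 by near: f.
rewrite sub0r normrN => /(le_lt_trans (ler_norm _)) hsum.
apply: (@le_lt_trans _ _ (e * 3 / 4)); last by lra.
apply/ell2_nrm_le; first by rewrite !mulr_ge0// ltW.
move=> t ut; rewrite (bigID (fun i => i \in s))/=.
have coord i : nrm ((diag k V - diag k (c f)) i) ^+ 2 = k i ^+ 2 * sqmod (c f i - v i).
  rewrite ell2B !(diagEb _ _ kM) -mulrBr nrmM nrm_real exprMn real_normK ?num_real//.
  by rewrite sqmod_nrm nrm_distC.
have h1 : \sum_(i <- t | i \in s) nrm ((diag k V - diag k (c f)) i) ^+ 2 <= e ^+ 2 / 4.
  apply: le_trans (ltW hsum); under eq_bigr do rewrite coord.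
  rewrite -big_filter; set t' := [seq i <- t | i \in s].
  have pt : perm_eq s (t' ++ [seq i <- s | i \notin t']).
    rewrite perm_sym; apply: perm_trans (permEl (perm_filterC (mem t') s)).
    rewrite perm_cat2r; apply: uniq_perm.
    - exact: filter_uniq.
    - by rewrite filter_uniq// undup_uniq.
    - move=> i; rewrite !mem_filter inE /= mem_filter; case: (i \in s) => //=; by rewrite ?andbT.
  rewrite (perm_big _ pt) big_cat lerDl; apply: sumr_ge0 => i _.
  by rewrite mulr_ge0 ?sqr_ge0 ?sqmod_ge0.
have h2 : \sum_(i <- t | i \notin s) nrm ((diag k V - diag k (c f)) i) ^+ 2 <= e ^+ 2 / 4.
  apply: (@le_trans _ _ (\sum_(i <- t) (e / 4) ^+ 2 * nrm ((V - c f) i) ^+ 2)).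
    rewrite [leRHS](bigID (fun i => i \in s))/= -[leLHS]add0r; apply: lerD.
      by apply: sumr_ge0 => i _; rewrite mulr_ge0 ?sqr_ge0.
    apply: ler_sum => i; rewrite mem_undup => /hs ki.
    rewrite coord sqmod_nrm nrm_distC ler_wpM2r ?sqr_ge0//.
    by rewrite -real_normK ?num_real// ler_sqr ?nnegrE// ltW.
  rewrite -mulr_sumr.
  have hV : nrm (V - c f) <= 2.
    by apply: le_trans (ler_nrmD _ _) _; rewrite nrmN -[2]/(1 + 1) lerD.
  apply: (@le_trans _ _ ((e / 4) ^+ 2 * 2 ^+ 2)); last by rewrite -exprMn; have := sqr_ge0 e; lra.
  rewrite ler_wpM2l ?sqr_ge0//; apply: le_trans (ell2_sum_le _ ut) _.
  by rewrite ler_sqr ?nnegrE ?nrm_ge0.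
apply: le_trans (lerD h1 h2) _; have := sqr_ge0 e; lra.
Unshelve. all: by end_near. Qed.

End CompactDiagonal.

(** * Spectral measure of a multiplication operator with natural values *)

Section DiagonalSpectral.
Context {R : realType} {I : choiceType}.
Local Notation C := R[i].
Local Notation ell2 := (@ell2 R I).
Variable L : I -> nat.
Implicit Types (f v w : ell2) (B : set (measurableTypeR R)).

Let sphere (n : nat) : set I := [set i | L i = n].

Let weight v n : \bar R := \esum_(i in sphere n) (sqmod (v i))%:E.

Let weight_ge0 v n : 0 <= fine (weight v n).
Proof. by rewrite fine_ge0// esum_ge0// => i _; rewrite lee_fin sqmod_ge0. Qed.

Let weight_fin v n : weight v n \is a fin_num.
Proof.
rewrite ge0_fin_numE; last by apply: esum_ge0 => i _; rewrite lee_fin sqmod_ge0.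
apply: le_lt_trans (ell2_summable v); rewrite /weight esum_mkcond.
by apply: le_esum => i _; case: ifP => // _; rewrite lee_fin sqmod_ge0.
Qed.

(** The push-forward along [L] of the measure with mass [|v i|^2] at [i]. Grouping by levels makes
    it a countable series of Dirac masses although [I] may be uncountable. *)
Definition level_measure v : {measure set (measurableTypeR R) -> \bar R} :=
  mseries (fun n => mscale (NngNum (weight_ge0 v n)) (dirac (n%:R : measurableTypeR R))) 0.

Lemma level_integral v (h : R -> R) : measurable_fun setT h -> (forall x, 0 <= h x) ->
  (\int[level_measure v]_x (h x)%:E = \esum_(i in setT) (h (L i)%:R * sqmod (v i))%:E)%E.
Proof.
move=> mh h0.
have mh' : @measurable_fun _ _ (measurableTypeR R) (\bar R) setT (fun x => (h x)%:E)
  by exact/measurable_EFinP.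
have h0' x : setT x -> (0 <= (h x)%:E)%E by rewrite lee_fin.
have T : setT = \bigcup_n sphere n by apply/seteqP; split=> // i _; exists (L i).
rewrite T nneseries_sum_bigcup; last 2 first.
- by apply/trivIsetP => m n _ _ mn; apply/seteqP; split=> // i [mi ni]; move: mn;
  rewrite -(mi : L i = m) -(ni : L i = n) eqxx.
- by move=> i; rewrite lee_fin mulr_ge0 ?sqmod_ge0.
rewrite /level_measure ge0_integral_measure_series//.
apply: eq_eseriesr => n _.
rewrite ge0_integral_mscale// integral_dirac// diracT mul1e /=.
rewrite fineK// muleC.
pose u i := if i \in sphere n then sqmod (v i) else 0.
have u0 i : 0 <= u i by rewrite /u; case: ifP; rewrite ?sqmod_ge0.
have wE : weight v n = (\esum_(i in setT) (u i)%:E)%E.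
  by rewrite /weight esum_mkcond; apply: eq_esum => i _; rewrite /u; case: ifP.
have ufin : (\esum_(i in setT) (u i)%:E < +oo)%E by rewrite -wE -ge0_fin_numE ?wE ?esum_geE// -wE.
rewrite wE -esumZr// [RHS]esum_mkcond; apply: eq_esum => i _; rewrite /u.
by case: ifPn => [|_]; rewrite ?mulr0// inE => /= ->.
Qed.

Definition level_proj B : ell2 -> ell2 := diag (fun i => \1_B ((L i)%:R : R)).

Let ind_le1 B i : `|\1_B ((L i)%:R : R) : R| <= 1.
Proof. by rewrite indicE; case: (_ \in _); rewrite ?normr1 ?normr0. Qed.

Lemma level_projE B v i : level_proj B v i = (\1_B ((L i)%:R : R))%:C%C * v i.
Proof. exact: diagEb (ind_le1 B). Qed.

Lemma level_measureE B : measurable B -> forall v,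
  level_measure v B = (complex.Re (hdot (level_proj B v) v))%:E.
Proof.
move=> mB v.
have [||-> fin] := @diag_dot R I (fun i => \1_B ((L i)%:R : R)) v.
- by move=> i; rewrite indicE; case: (_ \in _).
- by apply: diag_domb (ind_le1 B).
rewrite [complex.Re _]/= fineK; last first.
  by rewrite ge0_fin_numE// esum_ge0// => i _; rewrite lee_fin mulr_ge0 ?sqmod_ge0.
rewrite -(level_integral v (h := \1_B)).
- by rewrite integral_indic// setIT.
- exact: measurable_indic.
- by move=> x; rewrite indicE; case: (_ \in _).
Qed.

Lemma level_proj_linear B : measurable B -> linear (level_proj B).
Proof. by move=> _; exact: diag_linear (ind_le1 B). Qed.

Lemma level_proj_symmetric B : measurable B ->
  forall v w, hdot (level_proj B v) w = hdot v (level_proj B w).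
Proof. by move=> _ v w; apply: diag_symmetric; exact: diag_domb (ind_le1 B). Qed.

Lemma level_proj_setI B B' : measurable B -> measurable B' ->
  forall v, level_proj (B `&` B') v = level_proj B (level_proj B' v).
Proof.
move=> _ _ v; apply: ell2_ext => i; rewrite !level_projE mulrA -rmorphM.
by rewrite indicI.
Qed.

Lemma level_proj_setT v : level_proj setT v = v.
Proof. by apply: ell2_ext => i; rewrite level_projE indicT mul1r. Qed.

Definition level_pvm : projection_valued_measure ell2 :=
  PVM level_proj_linear level_proj_symmetric level_proj_setI level_proj_setT level_measureE.

Let Lr i : R := (L i)%:R.

Lemma level_spectral : spectral_measure (diag_op Lr) level_pvm.
Proof.
move=> v.
have sq : (\int[level_measure v]_x ((x : R) ^+ 2)%:E = \esum_(i in setT) (sqmod (diag_fun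
  Lr v i))%:E)%E.
  rewrite (level_integral v (h := fun x => x ^+ 2)); last 2 first.
  - exact: exprn_measurable.
  - by move=> x; exact: sqr_ge0.
  apply: eq_esum => i _; congr (_%:E).
  by rewrite /diag_fun sqmodM !sqmod_nrm nrm_real real_normK ?num_real.
split; first by rewrite sq.
move=> Dv; have [||E fin] := @diag_dot R I Lr v; [by move=> i; rewrite /Lr|exact: Dv|].
change (hdot (diag Lr v) v = (\int[level_measure v]_x (x : R))%:C%C); rewrite E;
  congr (fine _)%:C%C.
rewrite integralE.
have -> : (\int[level_measure v]_x ((fun x : measurableTypeR R => (x : R)%:E)^\+ x) =
   \esum_(i in setT) (Lr i * sqmod (v i))%:E)%E.
  rewrite (eq_integral (fun x : measurableTypeR R => (Num.max (x : R) 0)%:E)); last first.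
    by move=> x _; rewrite funeposE -EFin_max.
  rewrite (level_integral v (h := fun x => Num.max x 0)).
  - by apply: eq_esum => i _; rewrite max_l// /Lr.
  - by apply: measurable_maxr.
  - by move=> x; rewrite le_max lexx orbT.
(* The levels are natural numbers, so the negative part of the identity integrates to 0. *)
have -> : (\int[level_measure v]_x ((fun x : measurableTypeR R => (x : R)%:E)^\- x) = 0)%E.
  rewrite (eq_integral (fun x : measurableTypeR R => (Num.max (- (x : R)) 0)%:E)); last first.
    by move=> x _; rewrite funenegE -EFinN -EFin_max.
  rewrite (level_integral v (h := fun x => Num.max (- x) 0)).
  - by apply: esum1 => i _; rewrite max_r ?mul0r// oppr_le0.
  - by exact: measurable_maxr.
  - by move=> x; rewrite le_max lexx orbT.
by rewrite sube0.
Qed.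

Lemma level_calculus (f : R -> R) : measurable_fun setT f -> (forall x, 0 <= f x <= 1) ->
  borel_calculus level_pvm f (diag (fun i => f (Lr i))).
Proof.
move=> mf f01.
have f1 i : `|f (Lr i)| <= 1 by have /andP[? ?] := f01 (Lr i); rewrite ger0_norm.
split; first exact: diag_bounded f1.
move=> v; have [||-> _] := @diag_dot R I (fun i => f (Lr i)) v.
- by move=> i; have /andP[] := f01 (Lr i).
- exact: diag_domb f1.
congr (fine _)%:C%C; rewrite -(level_integral v mf)// => x.
by have /andP[] := f01 x.
Qed.

Lemma diag_finite_trace (q : I -> R) (M : R) : (forall i, 0 <= q i) ->
  (forall s : seq I, uniq s -> \sum_(i <- s) q i <= M) -> finite_trace (diag (I := I) q).
Proof.
move=> q0 qM; exists (range delta); first exact: delta_basis.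
rewrite esum_image; last first.
  move=> i j _ _ /(congr1 (fun f : ell2 => f i)); rewrite !deltaE eqxx.
  by case: eqP => // _ /eqP; rewrite oner_eq0.
apply: (@le_lt_trans _ _ M%:E); last exact: ltry.
rewrite (eq_esum (b := fun i => (q i)%:E)); last first.
  by move=> i _; rewrite diag_delta hdotZl hdot_delta deltaE eqxx mulr1.
exact/esum_leP.
Qed.

End DiagonalSpectral.

(** * Word length and part (ii) *)

Section WordLength.
Context {R : realType} {a : R} {a_gt0 : 0 < a}.
Local Notation G := (Ga a_gt0).

Definition Ga_gens : seq G :=
  [:: Ga_trans Ba1; (Ga_trans Ba1)^-1%g; Ga_shift 1; Ga_shift (-1)].

(** The list may repeat elements; its length bounds the cardinality of the ball. *)
Fixpoint wball (n : nat) : seq G :=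
  if n is n'.+1 then wball n' ++ [seq (s * h)%g | s <- Ga_gens, h <- wball n'] else [:: 1%g].

Lemma wballE n : wball n.+1 = wball n ++ [seq (s * h)%g | s <- Ga_gens, h <- wball n].
Proof. by []. Qed.

Lemma size_wball n : size (wball n) = (5 ^ n)%N.
Proof.
elim: n => // n IH; rewrite wballE size_cat size_allpairs IH expnS.
by rewrite -mulSn.
Qed.

Lemma wballS n h : h \in wball n -> h \in wball n.+1.
Proof. by rewrite wballE mem_cat => ->. Qed.

Lemma wball_le n m h : (n <= m)%N -> h \in wball n -> h \in wball m.
Proof. by move=> /subnK <-; elim: (m - n)%N => // k IH /IH; exact: wballS. Qed.

(** Elements whose left translation increases the word length by a bounded amount. That they exhaust
    the group gives both generation, by translating the unit, and the Lipschitz property of the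
    length. *)
Let S : set G := [set g | exists c : nat, forall n h, h \in wball n ->
  (g * h)%g \in wball (c + n)].

Let S1 : S 1%g.
Proof. by exists 0%N => n h; rewrite mul1g. Qed.

Let SM g h : S g -> S h -> S (g * h)%g.
Proof.
move=> [c gc] [d hd]; exists (c + d)%N => n k /hd/gc; by rewrite mulgA addnA.
Qed.

Let Sgen s : s \in Ga_gens -> S s.
Proof.
move=> sg; exists 1%N => n h hn; rewrite add1n wballE mem_cat; apply/orP; right.
exact: allpairs_f.
Qed.

Let SX g n : S g -> S (g ^+ n)%g.
Proof. by move=> Sg; elim: n => [|n IH]; rewrite ?expg0// expgS; exact: SM. Qed.

Let shiftX (z : int) n : (Ga_shift z ^+ n)%g = Ga_shift (a_gt0 := a_gt0) (n%:Z * z).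
Proof.
elim: n => [|n IH]; first by rewrite expg0 mul0r.
by rewrite expgS IH Ga_shiftM -addn1 PoszD mulrDl mul1r addrC.
Qed.

Let Sshift (z : int) : S (Ga_shift z).
Proof.
case: (intP z) => [|n|n].
- exact: S1.
- rewrite -[n.+1%:Z]mulr1 -shiftX; apply: SX; apply: Sgen; by rewrite !inE eqxx !orbT.
- rewrite -[- n.+1%:Z]mulrN1 -shiftX; apply: SX; apply: Sgen; by rewrite !inE eqxx !orbT.
Qed.

Let transE b b' (bP : Ba a b) (bP' : Ba a b') : b = b' ->
  Ga_trans (a_gt0 := a_gt0) bP = Ga_trans bP'.
Proof. by move=> bb; exact: Ga_ext. Qed.

Let transM b b' (bP : Ba a b) (bP' : Ba a b') :
  (Ga_trans bP * Ga_trans bP')%g = Ga_trans (a_gt0 := a_gt0) (BaD bP bP').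
Proof. by apply: Ga_ext; rewrite /= ?addr0// expr0z mul1r. Qed.

Let Sint (m : int) : exists P : Ba a m%:~R, S (Ga_trans P).
Proof.
have H (n : nat) : exists P : Ba a n%:R, S (Ga_trans P).
  elim: n => [|n [P SP]]; first by exists Ba0; exact: S1.
  have P' : Ba a n.+1%:R by rewrite -natr1; exact: BaD P Ba1.
  exists P'; rewrite (@transE _ _ P' (BaD P Ba1)); last by rewrite natr1.
  by rewrite -transM; apply: SM => //; apply: Sgen; rewrite inE eqxx.
have H' (n : nat) : exists P : Ba a (- n%:R), S (Ga_trans P).
  elim: n => [|n [P SP]].
    have P : Ba a (- 0%:R) by rewrite oppr0; exact: Ba0.
    exists P; rewrite (_ : Ga_trans P = 1%g); first exact: S1.
    by apply: Ga_ext; rewrite /= ?oppr0.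
  have P' : Ba a (- n.+1%:R) by rewrite -natr1 opprD; exact: BaD P (BaN Ba1).
  exists P'; rewrite (_ : Ga_trans P' = (Ga_trans P * (Ga_trans Ba1)^-1)%g).
    by apply: SM => //; apply: Sgen; rewrite !inE eqxx !orbT.
  by apply: Ga_ext; rewrite /= ?oppr0 ?addr0// !expr0z !mul1r -natr1 opprD.
case: (intP m) => [|n|n].
- exact: (H 0%N).
- exact: (H n.+1).
- have [P SP] := H' n.+1.
  have P' : Ba a (- n.+1%:Z)%:~R by rewrite rmorphN.
  by exists P'; rewrite (@transE _ _ P' P)// rmorphN.
Qed.

(** Conjugating the translation by [m] with the shift by [n] multiplies it by [a ^ n]; this is why
    two generators and their inverses suffice. *)
Let Smon (m n : int) : exists P : Ba a (m%:~R * a ^ n), S (Ga_trans P).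
Proof.
have [P SP] := Sint m.
have P' : Ba a (m%:~R * a ^ n) by rewrite mulrC; exact: (BaM (a_gt0 := a_gt0)).
exists P'; rewrite (_ : Ga_trans P' = (Ga_shift n * Ga_trans P * Ga_shift (- n))%g).
  by apply: SM; [apply: SM|].
by apply: Ga_ext; rewrite /= ?addr0 ?subrr// ?mulr0 ?addr0 ?add0r// mulrC.
Qed.

Let Strans b (bP : Ba a b) : S (Ga_trans bP).
Proof.
have [s bs] := bP.
elim: s b bP bs => [|p s IH] b bP.
  rewrite big_nil => b0; rewrite (@transE _ _ bP Ba0)//; exact: S1.
rewrite big_cons => bE.
have [P SP] := Smon p.1 p.2.
have P' : Ba a (\sum_(q <- s) q.1%:~R * a ^ q.2) by exists s.
by rewrite (@transE _ _ bP (BaD P P'))// -transM; apply: SM => //; exact: (IH _ P').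
Qed.

Let Sall g : S g.
Proof.
rewrite (_ : g = (Ga_trans (Ga_bP g) * Ga_shift (Ga_l g))%g); first exact: SM.
by apply: Ga_ext; rewrite /= ?mulr0 ?addr0 ?add0r.
Qed.

Let wball_total g : exists n, g \in wball n.
Proof.
have [c gc] := Sall g; exists (c + 0)%N; rewrite -[g]mulg1; apply: gc.
by rewrite inE.
Qed.

Definition wlen (g : G) : nat := ex_minn (wball_total g).

Lemma wlen_mem g : g \in wball (wlen g).
Proof. by rewrite /wlen; case: ex_minnP. Qed.

Lemma wlen_le g n : g \in wball n -> (wlen g <= n)%N.
Proof. by rewrite /wlen; case: ex_minnP => m _ h /h. Qed.

Lemma wlen_lipschitz g : exists c : nat, forall h,
  (wlen (g * h)%g <= wlen h + c)%N /\ (wlen h <= wlen (g * h)%g + c)%N.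
Proof.
have [c gc] := Sall g; have [d gd] := Sall g^-1%g.
exists (c + d)%N => h; split.
  by apply: leq_trans (wlen_le (gc _ _ (wlen_mem h))) _; lia.
have := wlen_le (gd _ _ (wlen_mem (g * h)%g)); rewrite mulKg; lia.
Qed.

(** The base 10 is twice the growth rate 5. Each term is one of the summands [10^-n] over the balls
    containing [g]; exchanging the sums leaves [5^n 10^-n], a geometric series with sum 2. *)
Lemma wlen_exp_sum (s : seq G) : uniq s -> \sum_(g <- s) (10%:R ^- wlen g : R) <= 2.
Proof.
move=> us; pose N := (\sum_(g <- s) wlen g)%N.
have lN g : g \in s -> (wlen g <= N)%N by move=> gs; rewrite /N (big_rem g)//= leq_addr.
apply: (@le_trans _ _ (\sum_(g <- s) \sum_(n < N.+1) (g \in wball n)%:R * 10%:R ^- n)).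
  rewrite big_seq [leRHS]big_seq; apply: ler_sum => g gs.
  have lg : (wlen g < N.+1)%N by rewrite ltnS lN.
  rewrite (bigD1 (Ordinal lg))//= wlen_mem mul1r lerDl; apply: sumr_ge0 => i _.
  by rewrite mulr_ge0 ?invr_ge0 ?exprn_ge0.
rewrite exchange_big/=.
apply: (@le_trans _ _ (\sum_(n < N.+1) 2%:R ^- n)).
  apply: ler_sum => n _; rewrite -mulr_suml.
  have -> : \sum_(g <- s) (g \in wball n)%:R = (size [seq g <- s | g \in wball n])%:R :> R.
    rewrite size_filter; elim: (s) => [|x t IH]; first by rewrite big_nil.
    by rewrite big_cons IH natrD.
  apply: (@le_trans _ _ ((5 ^ n)%:R * 10%:R ^- n)).
    rewrite ler_wpM2r ?invr_ge0 ?exprn_ge0// ler_nat -size_wball; apply: uniq_leq_size.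
      exact: filter_uniq.
    by move=> g; rewrite mem_filter => /andP[].
  rewrite natrX -exprVn -exprMn -exprVn (_ : 5%:R * 10%:R^-1 = 2%:R^-1 :> R)//; lra.
elim: N.+1 => [|k IH]; first by rewrite big_ord0.
have : \sum_(n < k) 2%:R ^- n = 2 - 2 * 2%:R ^- k :> R.
  elim: k {IH} => [|k IH]; first by rewrite big_ord0 expr0 invr1; lra.
  rewrite big_ord_recr /= IH exprS invfM; set y := _ ^- k; lra.
rewrite big_ord_recr /= => ->; have : 0 <= 2%:R ^- k :> R by rewrite invr_ge0 exprn_ge0.
lra.
Qed.

(** Completing the square gives [- t x^2 <= c^2 / (4 t) - c x]; with [c = ln 10] this reduces the
    Gaussian sum to the exponential one. *)
Lemma wlen_theta (t : R) : 0 < t -> exists M : R, forall s : seq G, uniq s ->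
  \sum_(g <- s) expR (- (t * (wlen g)%:R ^+ 2)) <= M.
Proof.
move=> t0; pose c := ln (10%:R : R).
exists (expR (c ^+ 2 / (4 * t)) * 2) => s us.
apply: le_trans (ler_wpM2l (expR_ge0 _) (wlen_exp_sum us)).
rewrite mulr_sumr; apply: ler_sum => g _.
have -> : 10%:R ^- wlen g = expR (- (c * (wlen g)%:R)).
  by rewrite expRN mulrC expRM_natl lnK// posrE.
rewrite -expRD ler_expR; set x := (wlen g)%:R.
have : 0 <= (2 * t * x - c) ^+ 2 / (4 * t) by rewrite divr_ge0 ?sqr_ge0// mulr_ge0// ltW.
have -> : (2 * t * x - c) ^+ 2 / (4 * t) = t * x ^+ 2 - c * x + c ^+ 2 / (4 * t).
  by field; rewrite lt0r_neq0.
lra.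
Qed.

Lemma wlen_proper (N : nat) : exists s : seq G, forall g, g \notin s -> (N < wlen g)%N.
Proof.
exists (wball N) => g; apply: contraNT; rewrite -leqNgt => h.
exact: wball_le h (wlen_mem g).
Qed.

End WordLength.

Section GroupAlgebra.
Context {R : realType} (G : groupType) (A : cstarType R) (u : G -> A).
Local Notation C := R[i].
Hypothesis Au : group_cstar u.

Lemma lspan_subspace (V : lmodType C) (X : set V) : linear_subspace (lspan X).
Proof.
split; first by exists [::]; rewrite big_nil.
move=> c v w [s [sX ->]] [t [tX ->]].
exists ([seq (c * p.1, p.2) | p <- s] ++ t); split.
  by move=> p; rewrite mem_cat => /orP[/mapP[q qs ->]|/tX//]; exact: sX qs.
rewrite big_cat big_map scaler_sumr; congr (_ + _).
by apply: eq_bigr => p _; rewrite scalerA.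
Qed.

Lemma lspan_ind (V : lmodType C) (X P : set V) :
  linear_subspace P -> X `<=` P -> lspan X `<=` P.
Proof.
move=> sP XP v [s [sX ->]]; apply: (@subspace_sum _ _ _ _ s fst snd) => // p /sX; exact: XP.
Qed.

Lemma group_algebra_star_subalgebra : star_subalgebra (group_algebra u).
Proof.
have sA := @lspan_subspace _ (range u); split=> //.
- move=> x y Sx Sy; move: x Sx; apply: lspan_ind.
    split; first by rewrite /= cmul0l; exact: sA.1.
    by move=> c v w /= Sv Sw; rewrite cmul_linearl; exact: sA.2.
  move=> _ [g _ <-]; rewrite /=; move: y Sy; apply: lspan_ind.
    split; first by rewrite /= cmul0r; exact: sA.1.
    by move=> c v w /= Sv Sw; rewrite cmul_linearr; exact: sA.2.
  by move=> _ [h _ <-]; rewrite /= -(gcs_mul Au); exact: group_algebra_gen.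
- apply: lspan_ind.
    split; first by rewrite /= cstar0; exact: sA.1.
    by move=> c v w /= Sv Sw; rewrite cstar_conj_linear; exact: sA.2.
  by move=> _ [g _ <-]; rewrite /= (gcs_star Au); exact: group_algebra_gen.
Qed.

End GroupAlgebra.

Lemma quasi_equivalent_refl (R : realType) (A : cstarType R) (H : hilbertType R)
  (pi : A -> H -> H) : quasi_equivalent pi pi.
Proof.
have h K : nonzero_subrep pi K -> ~ disjoint_subreps pi K pi setT.
  move=> nK dK; apply: (dK K K nK (fun _ h => h) nK (fun _ _ => Logic.I)).
  by exists id; split=> //; exact: image_id.
by split.
Qed.

(** * The word-length spectral triple *)

Section ThetaSummable.
Context {R : realType} (a : R) (a_gt0 : 0 < a).
Local Notation G := (Ga a_gt0).
Variables (A : cstarType R) (u : G -> A).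
Hypothesis Au : group_cstar u.
Local Notation C := R[i].
Local Notation rho := (regular_ext Au).

Definition wlenR (g : G) : R := (wlen g)%:R.
Local Notation D := (diag_op wlenR).

(** The commutator is the translation followed by multiplication by the difference [k] of two word
    lengths, which is bounded by the Lipschitz constant of the length. *)
Lemma translate_commutator (g : G) : exists M : R, 0 <= M /\ forall f, udom D f ->
  udom D (left_regular g f) /\ nrm (D (left_regular g f) - left_regular g (D f)) <= M * nrm f.
Proof.
have [c hc] := wlen_lipschitz g; exists c%:R; split=> // f Df.
pose k (h : G) : R := wlenR h - wlenR (g^-1 * h)%g.
have kc h : `|k h| <= c%:R.
  have [h1 h2] := hc (g^-1 * h)%g; rewrite mulVKg in h1 h2.
  have {}h1 : wlenR h <= wlenR (g^-1 * h)%g + c%:R by rewrite -natrD ler_nat.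
  have {}h2 : wlenR (g^-1 * h)%g <= wlenR h + c%:R by rewrite -natrD ler_nat.
  by rewrite /k ler_norml; apply/andP; split; lra.
have E h : diag_fun wlenR (left_regular g f) h = (left_regular g (diag wlenR f) + diag k
  (left_regular g f)) h.
  rewrite ell2D (diagEb _ _ kc) -[left_regular g (diag wlenR f) h]/(diag wlenR f (g^-1 * h)%g).
  rewrite (diagE _ Df) -[left_regular g f h]/(f (g^-1 * h)%g) /diag_fun /k rmorphB /=.
  by ring.
have Dg : udom D (left_regular g f) by exact: (square_summable_ell2 E).
split=> //.
have -> : D (left_regular g f) - left_regular g (D f) = diag k (left_regular g f).
  apply: ell2_ext => h; rewrite ell2B (diagE _ Dg) -/(diag_fun _ _ h) E ell2D.
  by rewrite addrAC subrr add0r.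
apply: le_trans (diag_nrm _ _ kc) _ => //.
by rewrite (urep_nrm (left_regular_urep G)).
Qed.

Lemma regular_commutator (x : A) : group_algebra u x -> exists M : R, 0 <= M /\
  forall f, udom D f -> udom D (rho x f) /\ nrm (D (rho x f) - rho x (D f)) <= M * nrm f.
Proof.
move: x; apply: lspan_ind.
  split.
    exists 0; split=> // f Df; have z (h : ell2 G) : rho 0 h = 0.
      by rewrite -(subrr (0 : A)) regular_ext_subl subrr.
    rewrite !z; split; first exact: (udom_subspace D).1.
    by rewrite subr0 uop0 nrm0 mul0r.
  move=> c x y [M [M0 hM]] [N [N0 hN]]; exists (nrm c * M + N); split.
    by rewrite addr_ge0// mulr_ge0 ?nrm_ge0.
  move=> f Df; have [D1 h1] := hM f Df; have [D2 h2] := hN f Df.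
  rewrite !regular_ext_lin; split; first exact: (udom_subspace D).2.
  rewrite uop_linear// opprD addrACA -scalerBr.
  apply: le_trans (ler_nrmD _ _) _; rewrite nrmZ mulrDl lerD// -mulrA ler_wpM2l ?nrm_ge0//.
move=> _ [g _ <-]; have [M [M0 hM]] := translate_commutator g.
exists M; split=> // f Df; rewrite !regular_ext_gen; exact: hM.
Qed.

Lemma theta_spectral_triple : spectral_triple (group_algebra u) rho D.
Proof.
split.
- exact: group_algebra_star_subalgebra.
- exact: gcs_dense Au.
- exact: regular_ext_rep.
- exact: regular_ext_inj (@Ga_reiter _ _ _).
- exact: diag_op_self_adjoint.
- by move=> x v /regular_commutator[M [_ hM]] /hM[].
- move=> x /regular_commutator[M [_ hM]]; exists M%:C%C => v /hM[_ h].
  by rewrite !nrmE -rmorphM lecR.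
- exists (diag (fun i => (1 + wlenR i ^+ 2)^-1)); first exact: diag_resolvent.
  have pos i : 0 < 1 + wlenR i ^+ 2 by rewrite ltr_pwDl// sqr_ge0.
  apply: (@diag_compact _ _ _ 1) => [i|e e0].
    by rewrite ger0_norm ?invr_ge0 ?(ltW (pos i))// invf_le1// lerDl sqr_ge0.
  (* Outside the ball of radius [1 / e], rounded up, [1 + n^2 >= n >= 1 / e]. *)
  have [s hs] := @wlen_proper R a a_gt0 (Num.bound e^-1); exists s => i /hs hi.
  rewrite gtr0_norm ?invr_gt0// -[e]invrK lef_pV2 ?posrE ?invr_gt0//.
  have e1 : e^-1 <= wlenR i.
    apply: le_trans (ltW (archi_boundP _)) _; first by rewrite invr_ge0 ltW.
    by rewrite ler_nat ltnW.
  apply: le_trans e1 _.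
  by have := sqr_ge0 (wlenR i - 1); rewrite sqrrB; have : 0 <= wlenR i by []; lra.
Qed.

Lemma theta_summable : theta_summable_from D 0.
Proof.
move=> t t0; exists (level_pvm (@wlen R a a_gt0)), (diag (fun i => expR (- (t * wlenR i ^+ 2)))).
split; first exact: level_spectral.
- apply: level_calculus.
    apply: measurableT_comp => //; under eq_fun do rewrite -mulNr.
    by apply: measurable_funM => //; exact: exprn_measurable.
  move=> x; rewrite expR_ge0 /= -expR0 ler_expR oppr_le0 mulr_ge0 ?sqr_ge0//; exact: ltW.
- have [M hM] := @wlen_theta R a a_gt0 t t0.
  by apply: (@diag_finite_trace _ _ _ M) => // i; exact: expR_ge0.
Qed.

End ThetaSummable.

Theorem theorem5p2 (R : realType) (a : R) (a_gt0 : 0 < a) (a_neq1 : a != 1)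
    (A : cstarType R) (u : Ga a_gt0 -> A) (Au : group_cstar u) :
  (~ exists (H : hilbertType R) (pi : A -> H -> H) (D : unbounded_operator H),
       [/\ spectral_triple (group_algebra u) pi D,
           quasi_equivalent_left_regular u pi &
           finitely_summable D]) /\
  (exists (H : hilbertType R) (pi : A -> H -> H) (D : unbounded_operator H),
       [/\ spectral_triple (group_algebra u) pi D,
           quasi_equivalent_left_regular u pi &
           theta_summable_from D 0]).
Proof.
split.
  move=> [H [pi [D [st qe]]]]; exact: (not_finitely_summable a_neq1 Au st qe).
exists (ell2 (Ga a_gt0)), (regular_ext Au), (diag_op (@wlenR R a a_gt0)); split.
- exact: theta_spectral_triple.
- exists (regular_ext Au); split; [exact: regular_ext_rep|exact: regular_ext_gen|].
  exact: quasi_equivalent_refl.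
- exact: theta_summable.
Qed.
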